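(* Let $h$ be an M-determinate probability measure on $S^1\times\mathbf{R}$ all of whose absolute moments exist, let $K>0$, and let $\rho_t$ be the solution of the continuous Kuramoto model with initial measure $\rho_0=h$. Suppose that for the $N$-dimensional Kuramoto model $$\frac{d\theta_i}{dt}=\omega_i+\frac{K}{N}\sum_{j=1}^N\sin(\theta_j-\theta_i),\qquad i=1,\dots,N,$$ the pairs $(\theta_j(0),\omega_j)$, $j=1,\dots,N$, of initial values and natural frequencies are independent and identically distributed according to the probability measure $h(\theta,\omega)$. For $m=0,1,2,\dots$, $k=0,\pm1,\pm2,\dots$ and $t\ge 0$ let $$Z^m_k(t)=\int_{\mathbf{R}}\int_0^{2\pi}P_m(\omega)e^{\sqrt{-1}k\theta}\,d\rho_t,\qquad \hat Z^m_k(t)=\frac1N\sum_{j=1}^N P_m(\omega_j)e^{\sqrt{-1}k\theta_j(t)},$$ where $\{P_m\}_{m\ge 0}$ are the orthonormal polynomials of the frequency distribution $g$ of $h$. Then $$|Z^m_k(t)-\hat Z^m_k(t)|\to 0\quad\text{almost surely as } N\to\infty,$$ for any $m,k$ and $t$. Further, for any number $\delta$ with $0<\delta<1$ there exists a number $C=C(m,k,t,\delta)>0$ such that $$P\bigl(|Z^m_k(t)-\hat Z^m_k(t)|<C/\sqrt N\bigr)\to 1-\delta\qquad (N\to\infty),$$ where $P(A)$ denotes the probability that an event $A$ occurs.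
   Context: $S^1=\mathbf{R}/2\pi\mathbf{Z}$. Continuous Kuramoto model with initial probability measure $h$ on $S^1\times\mathbf{R}$: the evolution equation for probability measures $\rho_t=\rho_t(\theta,\omega)$ on $S^1\times\mathbf{R}$ $$\frac{\partial\rho_t}{\partial t}+\frac{\partial}{\partial\theta}\Bigl(\bigl(\omega+\tfrac{K}{2\sqrt{-1}}(Z^0_1(t)e^{-\sqrt{-1}\theta}-\overline{Z^0_1(t)}e^{\sqrt{-1}\theta})\bigr)\rho_t\Bigr)=0,\quad Z^0_1(t)=\int_{\mathbf{R}}\int_0^{2\pi}e^{\sqrt{-1}\theta}d\rho_t,\quad \rho_0=h.$$ Solutions are understood in the weak sense: let $x(t,s;\theta,\omega)\in S^1$ be the solution of $$\frac{d}{dt}x(t,s;\theta,\omega)=\omega+K\int_{\mathbf{R}}\int_0^{2\pi}\sin\bigl(x(t,0;\theta',\omega')-x(t,s;\theta,\omega)\bigr)\,dh(\theta',\omega'),\qquad x(s,s;\theta,\omega)=\theta.$$ The weak solution is $$\rho_t(\theta,\omega)=h(x(0,t;\theta,\omega),\omega)\exp\Bigl[K\int_0^t ds\int_{\mathbf{R}}\int_0^{2\pi}\cos\bigl(x(s,0;\theta',\omega')-x(s,t;\theta,\omega)\bigr)dh(\theta',\omega')\Bigr],$$ i.e. $\rho_t$ is the measure characterized by $\int\int a(\theta,\omega)\,d\rho_t=\int\int a(x(t,0;\theta,\omega),\omega)\,dh$ for measurable $a$ (the push-forward of $h$ under $(\theta,\omega)\mapsto(x(t,0;\theta,\omega),\omega)$).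 Absolute moments of $h$: $M^n_k=\int_{\mathbf{R}}\int_0^{2\pi}|\omega^n e^{\sqrt{-1}k\theta}|\,dh$, $n\ge 0$, $k\in\mathbf{Z}$; they exist if they are finite. Moments: $m^n_k=\int_{\mathbf{R}}\int_0^{2\pi}\omega^n e^{\sqrt{-1}k\theta}\,dh$. The measure $h$ is M-determinate if it is the unique probability measure on $S^1\times\mathbf{R}$ with its moments $\{m^n_k\}_{n,k}$. The frequency distribution $g$ of $h$ is the probability measure on $\mathbf{R}$ given by $g(E)=\int_{\mathbf{R}}\int_0^{2\pi}\chi_E(\omega)\,dh$ for Borel sets $E$, where $\chi_E$ is the characteristic function of $E$ (the $\omega$-marginal of $h$). $\{P_m(\omega)\}_{m=0}^\infty$ is the orthonormal system in $L^2(\mathbf{R},dg)$ of real polynomials, $\deg P_m=m$, $P_0\equiv1$, obtained from $\{\omega^m\}_{m=0}^\infty$ by Gram–Schmidt orthogonalization (so it is assumed that this yields a polynomial $P_m$ for every $m\ge0$, i.e. that the support of $g$ is infinite). For the almost sure statement, $(\theta_j(0),\omega_j)_{j\ge1}$ is an i.i.d. sequence on a common probability space, and for each $N$ the functions $\theta_1(t),\dots,\theta_N(t)$ are the solution of the $N$-dimensional Kuramoto model with the first $N$ pairs as data.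
   Formalization: The second claim is stated only for m,k,t such that P(|Z−Ẑ|<C/√N) does not tend to 1 for every C>0; without this it is false, e.g. for m=k=0, where Z=Ẑ=1 and the probability is always 1. The condition is necessary for the claim. *)

(* Defs.v *)
From HB Require Import structures.
From mathcomp Require Import all_boot all_order all_algebra.
From mathcomp Require Import all_classical all_reals all_analysis.
From mathcomp Require Import complex.

Set Implicit Arguments.
Unset Strict Implicit.
Unset Printing Implicit Defensive.

Import Order.TTheory GRing.Theory Num.Theory.
Import numFieldNormedType.Exports.
Import ComplexField.Normc.

Local Open Scope classical_set_scope.
Local Open Scope ring_scope.
Local Open Scope quotient_scope.

Section circle.
Variable R : realType.

Definition angle_rel (a b : R) : bool :=
  `[< exists n : int, a - b = n%:~R * (2 * pi) >].

Lemma angle_rel_refl : reflexive angle_rel.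
Proof. by move=> a; apply/asboolP; exists 0; rewrite subrr mul0r. Qed.

Lemma angle_rel_sym : symmetric angle_rel.
Proof.
move=> a b; apply/asboolP/asboolP => -[n E]; exists (- n);
  by rewrite -opprB E mulrNz mulNr.
Qed.

Lemma angle_rel_trans : transitive angle_rel.
Proof.
move=> b a c /asboolP[n E] /asboolP[n' E']; apply/asboolP; exists (n + n').
by rewrite intrD mulrDl -E -E' addrA subrK.
Qed.

Canonical angle_equiv :=
  EquivRel angle_rel angle_rel_refl angle_rel_sym angle_rel_trans.

(* R / 2 pi Z with the quotient topology. *)
Definition circle_top : ptopologicalType :=
  quotient_topology {eq_quot angle_equiv}.

(* S^1 as a measurable space: its Borel sigma-algebra. *)
Definition circle := g_sigma_algebraType (@open circle_top).

Definition angle (a : R) : circle := \pi_({eq_quot angle_equiv}) a.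

Definition crepr (z : circle) : R := repr (z : {eq_quot angle_equiv}).

Lemma creprK (z : circle) : angle (crepr z) = z.
Proof. exact: (@reprK _ {eq_quot angle_equiv}). Qed.

Lemma angleP (a b : R) :
  angle a = angle b <-> exists n : int, a - b = n%:~R * (2 * pi).
Proof.
split=> [/(@eqquotP _ _ {eq_quot angle_equiv})/asboolP//|E].
by apply/(@eqquotP _ _ {eq_quot angle_equiv})/asboolP.
Qed.

(* exp(i k z); see cexp_angle for independence of the representative. *)
Definition cexp (k : int) (z : circle) : R[i] :=
  (cos (k%:~R * crepr z) +i* sin (k%:~R * crepr z))%C.

(* sin(z - w); see csin_sub_angle. *)
Definition csin_sub (z w : circle) : R := sin (crepr z - crepr w).

Lemma crepr_angle (a : R) :
  exists n : int, crepr (angle a) = a + n%:~R * (2 * pi).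
Proof.
by have /angleP[n E] := creprK (angle a); exists n; rewrite -E addrC subrK.
Qed.

Lemma sincos_periodz (a : R) (n : int) :
  (sin (a + n%:~R * (2 * pi)) = sin a) * (cos (a + n%:~R * (2 * pi)) = cos a).
Proof.
have P (b : R) (m : nat) :
    (sin (b + m%:~R * (2 * pi)) = sin b) * (cos (b + m%:~R * (2 * pi)) = cos b).
  have -> : m%:~R * (2 * pi) = (pi *+ 2) *+ m :> R.
    by rewrite -[pi *+ 2]mulr_natl -[RHS]mulr_natl.
  by rewrite (periodicn (@sinD2pi R)) (periodicn (@cosD2pi R)).
case: n => m; first exact: P.
have := P (a + (Negz m)%:~R * (2 * pi)) m.+1.
by rewrite NegzE mulrNz mulNr subrK => -[-> ->].
Qed.

Lemma cexp_angle (k : int) (a : R) :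
  cexp k (angle a) = (cos (k%:~R * a) +i* sin (k%:~R * a))%C.
Proof.
rewrite /cexp; have [n ->] := crepr_angle a.
by rewrite mulrDr mulrA -intrM !sincos_periodz.
Qed.

Lemma csin_sub_angle (a b : R) : csin_sub (angle a) (angle b) = sin (a - b).
Proof.
rewrite /csin_sub; have [n ->] := crepr_angle a; have [m ->] := crepr_angle b.
by rewrite opprD addrACA -mulNr -mulrDl -mulrNz -intrD sincos_periodz.
Qed.

(* On the time interval [0, +oo[, the curve y on S^1 has velocity v: this is
   expressed on a continuous lift of y to R. *)
Definition has_velocity (y : R -> circle) (v : R -> R) : Prop :=
  exists Y : R -> R,
    [/\ forall t : R, 0 <= t -> angle (Y t) = y t,
        {within `[0, +oo[, continuous Y} &
        forall t : R, 0 < t -> is_derive t (1 : R) Y (v t)].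

End circle.

Section complex_integral.
Context d (T : measurableType d) (R : realType).

Definition Cintegral (mu : {measure set T -> \bar R}) (f : T -> R[i]) : R[i] :=
  ((\int[mu]_x complex.Re (f x)) +i* (\int[mu]_x complex.Im (f x)))%C.

End complex_integral.

Section moments.
Variable R : realType.
Implicit Type h : probability (circle R * R)%type R.

Definition monomial (n : nat) (k : int) (p : circle R * R) : R[i] :=
  ((p.2 ^+ n)%:C)%C * cexp k p.1.

Definition abs_moments_exist h : Prop :=
  forall (n : nat) (k : int),
    (\int[h]_p (normc (monomial n k p))%:E < +oo)%E.

Definition moment h (n : nat) (k : int) : R[i] := Cintegral h (monomial n k).

Definition M_determinate h : Prop :=
  forall h' : probability (circle R * R)%type R,
    abs_moments_exist h' ->
    (forall n k, moment h' n k = moment h n k) ->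
    forall A, measurable A -> h' A = h A.

Definition frequency (p : circle R * R) : R := p.2.

Lemma measurable_frequency : measurable_fun [set: circle R * R] frequency.
Proof. exact: measurable_snd. Qed.

HB.instance Definition _ :=
  isMeasurableFun.Build _ _ _ _ frequency measurable_frequency.

Definition frequency_distribution h : probability R R :=
  distribution h frequency.

End moments.

Section orthonormal_polynomials.
Variables (R : realType) (g : probability R R).

Definition measure_support : set R :=
  [set w | forall U : set R, open U -> U w -> (0 < g U)%E].

Definition inner (p q : {poly R}) : R := \int[g]_w (p.[w] * q.[w]).

Definition gs_step (s : seq {poly R}) (p : {poly R}) : {poly R} :=
  let q := p - \sum_(e <- s) inner p e *: e in (Num.sqrt (inner q q))^-1 *: q.

(* The first n polynomials obtained from 1, X, X^2, ... by Gram-Schmidt. *)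
Fixpoint gs_seq (n : nat) : seq {poly R} :=
  if n is m.+1 then rcons (gs_seq m) (gs_step (gs_seq m) 'X^m) else [::].

Definition orthonormal_poly (m : nat) : {poly R} := gs_step (gs_seq m) 'X^m.

Lemma gs_seqE n : gs_seq n = [seq orthonormal_poly m | m <- iota 0 n].
Proof.
elim: n => [//|n IHn].
by rewrite -[in RHS]addn1 iotaD map_cat cats1 -IHn.
Qed.

End orthonormal_polynomials.

Section kuramoto.
Variable R : realType.
Implicit Types (h : probability (circle R * R)%type R) (K : R).

(* x t s th w is x(t, s; th, w). *)
Definition kuramoto_flow h K (x : R -> R -> circle R -> R -> circle R) : Prop :=
  (forall t : R, 0 <= t ->
     measurable_fun setT (fun p : circle R * R => x t 0 p.1 p.2)) /\
  (forall (s : R) th w, 0 <= s ->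
     x s s th w = th /\
     has_velocity (fun t => x t s th w)
       (fun t => w + K * \int[h]_p csin_sub (x t 0 p.1 p.2) (x t s th w))).

Definition continuous_kuramoto_solution h K
    (rho : R -> probability (circle R * R)%type R) : Prop :=
  exists2 x, kuramoto_flow h K x &
    forall t : R, 0 <= t -> forall A : set (circle R * R), measurable A ->
      rho t A = pushforward h (fun p : circle R * R => (x t 0 p.1 p.2, p.2)) A.

Definition kuramoto_solution K (N : nat) (omega : 'I_N -> R)
    (theta : R -> 'I_N -> circle R) : Prop :=
  forall i, has_velocity (theta ^~ i)
    (fun t => omega i + K / N%:R * \sum_(j < N) csin_sub (theta t j) (theta t i)).

Definition Zfun (f : {poly R}) (k : int) (p : circle R * R) : R[i] :=
  ((f.[p.2])%:C)%C * cexp k p.1.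

Definition Z h (rho : R -> probability (circle R * R)%type R)
    (m : nat) (k : int) (t : R) : R[i] :=
  Cintegral (rho t)
    (Zfun (orthonormal_poly (frequency_distribution h) m) k).

Definition Zhat h (N : nat) (omega : 'I_N -> R) (theta : R -> 'I_N -> circle R)
    (m : nat) (k : int) (t : R) : R[i] :=
  (N%:R)^-1 * \sum_(j < N)
    Zfun (orthonormal_poly (frequency_distribution h) m) k (theta t j, omega j).

End kuramoto.

Section iid.
Context d d' (T : measurableType d) (T' : measurableType d') (R : realType).
Variable P : probability T R.

Definition mutually_independent (X : nat -> {RV P >-> T'}) : Prop :=
  forall (J : seq nat) (A : nat -> set T'), uniq J ->
    (forall j, measurable (A j)) ->
    P (\bigcap_(j in [set` J]) (X j @^-1` A j)) =
    (\prod_(j <- J) P (X j @^-1` A j))%E.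

Definition identically_distributed (X : nat -> {RV P >-> T'})
    (h : probability T' R) : Prop :=
  forall j A, measurable A -> distribution P (X j) A = h A.

End iid.

(* Main.v *)
Require Import Defs.
From HB Require Import structures.
From mathcomp Require Import all_boot all_order all_algebra.
From mathcomp Require Import all_classical all_reals all_analysis.
From mathcomp Require Import complex measurable_realfun.
From mathcomp Require Import ring lra.

Set Implicit Arguments.
Unset Strict Implicit.
Unset Printing Implicit Defensive.

Import Order.TTheory GRing.Theory Num.Theory.
Import numFieldNormedType.Exports.
Import ComplexField.Normc.

Local Open Scope classical_set_scope.
Local Open Scope ring_scope.

(* Write e_b for the error of the empirical means of sin (b = true) and cos (b = false)
   over the particles, compared with their mean-field values. Each particle is compared
   with the mean-field trajectory started at the same point: by Gronwall they differ by
   O(I), I the time integral of |e|, and the linear response to e is exact up to O(I^2).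
   Averaging, e solves a linear Volterra equation whose source A is a centred i.i.d.
   average, up to a term quadratic in centred averages. Solving the adjoint equation turns
   the fluctuation of Z^m_k into an i.i.d. average of one centred square-integrable function
   F, with an L^1 error O(1/N). Fourth moments give the almost sure convergence, since they
   are summable. For the second part the real and imaginary fluctuations, multiplied by
   sqrt N, have a Gaussian limit; unless it is zero, its squared modulus has a continuous
   law, and a quantile of that law gives C. The convergence in law is obtained from real
   characteristic functions through the moments of exp(-|V|^2/2), which lies in [0, 1]. *)

(** * Differential calculus and Gronwall inequalities *)

Section calculus.
Variable R : realType.
Implicit Types (f g : R -> R) (x t : R).

(** Trajectories on the circle are compared through real lifts. A lift is obtained by choice, so it
    carries no regularity in the starting or sample point; measurability is proved only for sines
    and cosines of its integer multiples. Nor is [theta] assumed measurable in the sample point: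
    this comes from continuous dependence of the particles on their frequencies and initial
    positions. The adjoint equation is used because its solution is deterministic: pairing the
    random fields with it leaves a sum of functions of single samples, which is the form that the
    central limit theorem accepts. The factor P_m(omega) of the observable is unbounded. It enters
    the estimates through its fourth moment, finite because all absolute moments of [h] are. The
    second part needs some nondegeneracy: for m = k = 0 the deviation is 0 for every N >= 1, and no
    constant C can produce the limit 1 - delta. Since exp(-|V|^2/2) takes its values in [0, 1],
    convergence of its moments already determines the limits of tail probabilities, by polynomial
    approximation and without a tightness argument. *)

Definition isd f x (a : R) : Prop := is_derive x (1 : R) f a.

Lemma contD f g : continuous f -> continuous g -> continuous (fun x => f x + g x).
Proof. by move=> cf cg x; apply: cvgD; [exact: cf|exact: cg]. Qed.

Lemma contB f g : continuous f -> continuous g -> continuous (fun x => f x - g x).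
Proof. by move=> cf cg x; apply: cvgB; [exact: cf|exact: cg]. Qed.

Lemma contM f g : continuous f -> continuous g -> continuous (fun x => f x * g x).
Proof. by move=> cf cg x; apply: cvgM; [exact: cf|exact: cg]. Qed.

Lemma contN f : continuous f -> continuous (fun x => - f x).
Proof. by move=> cf x; apply: cvgN; exact: cf. Qed.

Lemma cont_abs f : continuous f -> continuous (fun x => `|f x|).
Proof. by move=> cf x; apply: (cvg_norm (V := R^o)); exact: cf. Qed.

Lemma cont_comp f g : continuous f -> continuous g -> continuous (fun x => g (f x)).
Proof. by move=> cf cg x; apply: continuous_comp; [exact: cf|exact: cg]. Qed.

Lemma cont_cst (c : R) : continuous (fun _ : R => c).
Proof. exact: cst_continuous. Qed.

Lemma cont_sum (I : Type) (s : seq I) (F : I -> R -> R) :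
  (forall i, continuous (F i)) -> continuous (fun x => \sum_(i <- s) F i x).
Proof.
move=> cF; elim: s => [|i s IH].
  by under eq_fun do rewrite big_nil; exact: cont_cst.
by under eq_fun do rewrite big_cons; apply: contD.
Qed.

Lemma isd_eq f x (a b : R) : isd f x a -> a = b -> isd f x b.
Proof. by move=> ? <-. Qed.

Lemma isdD f g x (a b : R) : isd f x a -> isd g x b ->
  isd (fun y => f y + g y) x (a + b).
Proof. by move=> fa gb; exact: is_deriveD. Qed.

Lemma isdB f g x (a b : R) : isd f x a -> isd g x b ->
  isd (fun y => f y - g y) x (a - b).
Proof. by move=> fa gb; exact: is_deriveB. Qed.

Lemma isdN f x (a : R) : isd f x a -> isd (fun y => - f y) x (- a).
Proof. by move=> fa; exact: is_deriveN. Qed.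

Lemma isdM f g x (a b : R) : isd f x a -> isd g x b ->
  isd (fun y => f y * g y) x (f x * b + g x * a).
Proof. by move=> fa gb; exact: is_deriveM. Qed.

Lemma isd_cst (c : R) x : isd (fun _ : R => c) x 0.
Proof. exact: is_derive_cst. Qed.

Lemma isd_id x : isd (fun y : R => y) x 1.
Proof. exact: is_derive_id. Qed.

Lemma isd_sin x : isd sin x (cos x). Proof. exact: is_derive_sin. Qed.

Lemma isd_cos x : isd cos x (- sin x). Proof. exact: is_derive_cos. Qed.

Lemma isd_expR x : isd expR x (expR x). Proof. exact: is_derive_expR. Qed.

Lemma isd_comp f g x (a b : R) : isd g (f x) a -> isd f x b ->
  isd (fun y => g (f y)) x (a * b).
Proof. by move=> ga fb; exact: (@is_derive1_comp _ g f). Qed.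

Lemma isd_sum (I : Type) (s : seq I) (F : I -> R -> R) x (a : I -> R) :
  (forall i, isd (F i) x (a i)) ->
  isd (fun y => \sum_(i <- s) F i y) x (\sum_(i <- s) a i).
Proof.
move=> cF; elim: s => [|i s IH].
  by under eq_fun do rewrite big_nil; rewrite big_nil; exact: isd_cst.
by under eq_fun do rewrite big_cons; rewrite big_cons; apply: isdD.
Qed.

Lemma isd_near f g x (a : R) : (\forall y \near x, f y = g y) ->
  isd f x a -> isd g x a.
Proof. by move=> fg fa; exact: (near_eq_is_derive fg fa). Qed.

Lemma derive_le0_le f (df : R -> R) (a b : R) : a <= b -> continuous f ->
  (forall t, a < t < b -> isd f t (df t)) ->
  (forall t, a < t < b -> df t <= 0) -> f b <= f a.
Proof.
rewrite le_eqVlt => /predU1P[-> //|ab] cf fd df0.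
have fd' x : x \in `]a, b[ -> isd f x (df x) by rewrite in_itv /= => /fd.
have [c] := MVT ab fd' (continuous_subspaceT cf).
rewrite in_itv /= => /df0 dfc E; rewrite -subr_le0 E.
by rewrite mulr_le0_ge0// subr_ge0 ltW.
Qed.

Lemma derive_bound f (df : R -> R) (M a b : R) : a <= b -> continuous f ->
  (forall t, a < t < b -> isd f t (df t)) ->
  (forall t, a < t < b -> `|df t| <= M) -> `|f b - f a| <= M * (b - a).
Proof.
rewrite le_eqVlt => /predU1P[-> //|ab] cf fd df0.
  by rewrite !subrr normr0 mulr0.
have fd' x : x \in `]a, b[ -> isd f x (df x) by rewrite in_itv /= => /fd.
have [c] := MVT ab fd' (continuous_subspaceT cf).
rewrite in_itv /= => /df0 dfc ->.
have ba : 0 <= b - a by rewrite subr_ge0 ltW.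
by rewrite normrM (ger0_norm ba); apply: ler_wpM2r.
Qed.

Lemma isd_expR_lin (c x : R) : isd (fun y => expR (c * y)) x (c * expR (c * x)).
Proof.
apply: isd_eq.
  apply: (@isd_comp (fun y => c * y) expR); first exact: isd_expR.
  by apply: isdM; [exact: isd_cst|exact: isd_id].
by rewrite /=; ring.
Qed.

Lemma cont_id : continuous (fun x : R => x).
Proof. by move=> x. Qed.

Lemma cont_expR_lin (c : R) : continuous (fun y => expR (c * y)).
Proof.
apply: (@cont_comp (fun y => c * y) expR); last exact: continuous_expR.
by apply: contM; [exact: cont_cst|exact: cont_id].
Qed.

(* |f| need not be differentiable, so it is replaced by sqrt (f ^ 2 + e ^ 2). *)
Lemma gronwall f g (G df : R -> R) (C T : R) : 0 <= T -> 0 <= C ->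
  continuous f -> continuous G ->
  (forall t, 0 < t < T -> isd f t (df t)) ->
  (forall t, 0 < t < T -> isd G t (g t)) ->
  (forall t, 0 < t < T -> 0 <= g t) ->
  (forall t, 0 < t < T -> `|df t| <= C * `|f t| + g t) ->
  `|f T| <= expR (C * T) * (`|f 0| + (G T - G 0)).
Proof.
move=> T0 C0 cf cG fd Gd g0 fb.
suff main (e : R) : 0 < e -> `|f T| <= expR (C * T) * (`|f 0| + e + (G T - G 0)).
  apply/ler_addgt0Pr => e e0.
  apply: le_trans (main (e / expR (C * T)) _) _.
    by rewrite divr_gt0// expR_gt0.
  rewrite addrAC [leLHS]mulrDr [_ * (e / _)]mulrCA mulfV ?mulr1//.
  by rewrite gt_eqF ?expR_gt0.
move=> e0.
pose p (t : R) := Num.sqrt (f t ^+ 2 + e ^+ 2).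
have s0 t : 0 < f t ^+ 2 + e ^+ 2 by rewrite ltr_wpDl ?sqr_ge0// exprn_gt0.
have p0 t : 0 < p t by rewrite sqrtr_gt0.
have fp t : `|f t| <= p t.
  by rewrite -sqrtr_sqr ler_sqrt ?lerDl ?sqr_ge0// ltW.
have cp : continuous p.
  apply: (@cont_comp (fun t => f t ^+ 2 + e ^+ 2) Num.sqrt); last exact: sqrt_continuous.
  by apply: contD; [exact: contM|exact: cont_cst].
have pd t : 0 < t < T -> isd p t (f t * df t / p t).
  move=> tT; apply: isd_eq.
    apply: (@isd_comp (fun t => f t ^+ 2 + e ^+ 2) Num.sqrt).
      exact: (is_derive1_sqrt (s0 t)).
    by apply: isdD; [apply: isdM; exact: fd|exact: isd_cst].
  rewrite -/(p t); have : p t != 0 by rewrite gt_eqF.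
  by move=> pt; field.
(* The integrating factor multiplies [p] only. It is at most 1 and [g] is nonnegative, so [G] may be
   subtracted without a weight. *)
have key : expR (- C * T) * p T - G T <= expR (- C * 0) * p 0 - G 0.
  apply: (@derive_le0_le (fun t => expR (- C * t) * p t - G t) (fun t => expR (- C * t) * (f t * df t / p t) +
     p t * (- C * expR (- C * t)) - g t)) => //.
  - by apply: contB => //; apply: contM => //; exact: cont_expR_lin.
  - move=> t tT; apply: isdB; last exact: Gd.
    by apply: isdM; [exact: isd_expR_lin|exact: pd].
  move=> t tT.
  have E1 : expR (- C * t) <= 1.
    by rewrite -expR0 ler_expR mulNr oppr_le0 mulr_ge0//; case/andP: tT => /ltW.
  have E0 := expR_ge0 (- C * t).
  suff H : f t * df t / p t <= C * p t + g t.
    have H2 : expR (- C * t) * (f t * df t / p t) <= expR (- C * t) * (C * p t + g t).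
      exact: ler_wpM2l.
    have H3 : expR (- C * t) * g t <= g t by rewrite ler_piMl// g0.
    move: H2 H3; rewrite mulrDr.
    set a := expR _; set b := _ / _; set c := p t; set d := g t; lra.
  rewrite ler_pdivrMr//.
  apply: (le_trans (ler_norm _)); rewrite normrM.
  apply: (@le_trans _ _ (p t * (C * p t + g t))); last by rewrite mulrC.
  apply: ler_pM => //; apply: (le_trans (fb _ tT)).
  by rewrite lerD2r ler_wpM2l.
have p00 : p 0 <= `|f 0| + e.
  have : p 0 ^+ 2 <= (`|f 0| + e) ^+ 2.
    rewrite sqr_sqrtr ?(ltW (s0 0))// sqrrD real_normK ?num_real//.
    have : 0 <= `|f 0| * e by rewrite mulr_ge0// ltW.
    by rewrite -mulr_natr; lra.
  by rewrite ler_sqr ?nnegrE ?addr_ge0 ?(ltW (p0 0)) ?(ltW e0).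
apply: (le_trans (fp T)).
rewrite -ler_pdivrMl ?expR_gt0// -expRN -mulNr.
move: key; rewrite mulr0 expR0 mul1r; lra.
Qed.

Definition prim (f : R -> R) (t : R) : R :=
  \int[@lebesgue_measure R]_(s in `[0, t]) f s.

Lemma cont_integrable f (a b : R) : continuous f ->
  (@lebesgue_measure R).-integrable `[a, b] (EFin \o f).
Proof.
move=> cf; apply: continuous_compact_integrable; first exact: segment_compact.
exact: continuous_subspaceT.
Qed.

(** The integral is started at -1 to obtain an [F] that is differentiable on both sides of 0. As
    [prim f] vanishes for negative times, it equals F (max t 0), whence its continuity on the whole
    line. *)
Lemma prim_full f : continuous f -> exists F : R -> R,
  [/\ F 0 = 0, forall t, 0 <= t -> prim f t = F t,
      forall t, -1 < t -> isd F t (f t) & forall t, t < 0 -> prim f t = 0].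
Proof.
move=> cf.
pose F t := \int[@lebesgue_measure R]_(s in `[-1, t]) f s
  - \int[@lebesgue_measure R]_(s in `[-1, 0]) f s.
exists F; split; first by rewrite /F subrr.
- move=> t t0; rewrite /F Rintegral_itvB ?bnd_simp ?lerN10 //; last first.
    exact: cont_integrable.
  rewrite Rintegral_itv_obnd_cbnd//.
  apply: (integrableS _ _ _ (@cont_integrable f 0 t cf)) => //.
  by apply: subset_itvr; rewrite bnd_simp.
- move=> t t1; rewrite -[f t]subr0; apply: isdB; last exact: isd_cst.
  have [||d e] := @continuous_FTC1_closed R f (-1) t (t + 1) _ _ t1 (cf t).
  + by rewrite ltrDl.
  + exact: cont_integrable.
  apply: DeriveDef; first exact: d.
  by rewrite -e derive1E.
by move=> t t0; rewrite /prim set_itv_ge ?Rintegral_set0// bnd_simp -ltNge.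
Qed.

Lemma prim0 f : continuous f -> prim f 0 = 0.
Proof. by move=> /prim_full[F [F0 FE _ _]]; rewrite FE. Qed.

Lemma prim_derive f t : continuous f -> 0 < t -> isd (prim f) t (f t).
Proof.
move=> /prim_full[F [F0 FE Fd _]] t0; apply: isd_near (Fd t _); last exact: lt_trans t0.
near=> y; rewrite FE// ltW//; near: y; exact: lt_nbhsr.
Unshelve. all: by end_near. Qed.

Lemma prim_continuous f : continuous f -> continuous (prim f).
Proof.
move=> cf; have [F [F0 FE Fd Fn]] := prim_full cf.
have -> : prim f = fun t => F (Num.max t 0).
  apply/funext => t; rewrite /Num.max; case: ltP => t0; first by rewrite F0 Fn.
  by rewrite FE.
move=> t; apply: (@continuous_comp _ _ _ (fun t => Num.max t 0) F).
  by apply: continuous_max; [exact: cont_id|exact: cont_cst].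
apply: differentiable_continuous; apply/derivable1_diffP.
by have [|//] := Fd (Num.max t 0); rewrite lt_max ltrN10 orbT.
Qed.

Lemma prim_ge0 f t : (forall s, 0 <= f s) -> 0 <= prim f t.
Proof. by move=> f0; apply: Rintegral_ge0. Qed.

(** The differential form is applied to [prim f], whose derivative [f] is bounded by [g] plus C
    times [prim f] itself. The conclusion concerns the integral of [f], the only quantity that
    enters the particle estimates. *)
Lemma gronwall_int f g (C T : R) : 0 <= T -> 0 <= C ->
  continuous f -> continuous g -> (forall t, 0 <= f t) -> (forall t, 0 <= g t) ->
  (forall t, 0 <= t <= T -> f t <= g t + C * prim f t) ->
  prim f T <= expR (C * T) * prim g T.
Proof.
move=> T0 C0 cf cg f0 g0 fg.
rewrite -(ger0_norm (prim_ge0 T f0)).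
apply: (@le_trans _ _ (expR (C * T) * (`|prim f 0| + (prim g T - prim g 0)))).
  apply: (@gronwall _ g _ f) => //; try exact: prim_continuous.
  - by move=> t /andP[t0 _]; exact: prim_derive.
  - by move=> t /andP[t0 _]; exact: prim_derive.
  move=> t /andP[t0 tT]; rewrite !ger0_norm ?prim_ge0// addrC fg//.
  by rewrite !ltW.
by rewrite !prim0// normr0 add0r subr0.
Qed.

Lemma sin_bound1 x : `|sin x| <= `|x|.
Proof.
wlog x0 : x / 0 <= x.
  move=> H; have [/H//|/ltW x0] := leP 0 x.
  by rewrite -normrN -sinN -[X in _ <= X]normrN; apply: H; rewrite oppr_ge0.
have := @derive_bound sin cos 1 0 x x0 (@continuous_sin R).
rewrite sin0 !subr0 mul1r (ger0_norm x0); apply.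
  by move=> t _; exact: isd_sin.
by move=> t _; exact: cos_max.
Qed.

Lemma one_sub_cos x : 1 - cos x = 2 * sin (x / 2) ^+ 2.
Proof.
have -> : x = (x / 2) *+ 2 by rewrite -mulr_natr; field.
rewrite cos_mulr2n (_ : _ *+ 2 / 2 = x / 2) ?sin2cos2; last by field.
by ring.
Qed.

Lemma cos_bound2 x : `|1 - cos x| <= x ^+ 2 / 2.
Proof.
rewrite one_sub_cos ger0_norm; last by rewrite mulr_ge0 ?sqr_ge0.
have : sin (x / 2) ^+ 2 <= (x / 2) ^+ 2.
  rewrite -[leLHS]real_normK ?num_real// -[leRHS]real_normK ?num_real//.
  by rewrite ler_sqr ?nnegrE ?normr_ge0// sin_bound1.
by rewrite exprMn; lra.
Qed.

(** Each Taylor remainder is bounded twice for the sake of the central limit theorem. At scale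
    1/sqrt n, the cubic bound makes n times the remainder tend to 0 pointwise, while the quadratic
    bound dominates it by the integrable square of the variable. *)
Lemma sin_bound3 x : `|sin x - x| <= `|x| ^+ 3.
Proof.
wlog x0 : x / 0 <= x.
  move=> H; have [/H//|/ltW x0] := leP 0 x.
  rewrite -normrN opprD -sinN -[`|x|]normrN; apply: H; rewrite oppr_ge0//.
have := @derive_bound (fun t => sin t - t) (fun t => cos t - 1) (x ^+ 2) 0 x x0.
rewrite sin0 !subr0 (ger0_norm x0) -exprSr; apply.
- by apply: contB; [exact: continuous_sin|exact: cont_id].
- by move=> t _; apply: isdB; [exact: isd_sin|exact: isd_id].
move=> t /andP[t0 tx]; rewrite distrC (le_trans (cos_bound2 _))//.
have : t ^+ 2 <= x ^+ 2 by rewrite !expr2; nra.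
have := sqr_ge0 t; lra.
Qed.

Lemma sin_bound2 x : `|sin x - x| <= x ^+ 2.
Proof.
wlog x0 : x / 0 <= x.
  move=> H; have [/H//|/ltW x0] := leP 0 x.
  by rewrite -normrN opprD -sinN -sqrrN; apply: H; rewrite oppr_ge0.
have := @derive_bound (fun t => sin t - t) (fun t => cos t - 1) x 0 x x0.
rewrite sin0 !subr0 -expr2; apply.
- by apply: contB; [exact: continuous_sin|exact: cont_id].
- by move=> t _; apply: isdB; [exact: isd_sin|exact: isd_id].
move=> t /andP[t0 tx]; rewrite distrC.
have [t2|t2] := leP t 2.
  rewrite (le_trans (cos_bound2 _))//.
  have : t * t <= 2 * t by rewrite ler_wpM2r// ltW.
  rewrite -expr2; lra.
have := cos_max t; rewrite ler_norml => /andP[c1 c2].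
by rewrite ger0_norm; lra.
Qed.

Lemma cos_bound3 x : `|cos x - 1 + x ^+ 2 / 2| <= `|x| ^+ 3.
Proof.
wlog x0 : x / 0 <= x.
  move=> H; have [/H//|/ltW x0] := leP 0 x.
  by rewrite -sqrrN -cosN -[`|x|]normrN; apply: H; rewrite oppr_ge0.
have := @derive_bound (fun t => cos t - 1 + t ^+ 2 / 2) (fun t => - (sin t - t)) (x ^+ 2) 0 x x0.
rewrite cos0 !subr0 subrr expr0n /= mul0r addr0 subr0 (ger0_norm x0) -exprSr; apply.
- apply: contD; first by apply: contB; [exact: continuous_cos|exact: cont_cst].
  by apply: contM; [apply: contM; exact: cont_id|exact: cont_cst].
- move=> t _; apply: isd_eq.
    apply: isdD; first by apply: isdB; [exact: isd_cos|exact: isd_cst].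
    by apply: isdM; [apply: isdM; exact: isd_id|exact: isd_cst].
  by rewrite /=; field.
move=> t /andP[t0 tx]; rewrite normrN (le_trans (sin_bound2 _))//.
by rewrite ler_sqr ?nnegrE ltW// (lt_trans t0).
Qed.

Lemma cos_bound2' x : `|cos x - 1 + x ^+ 2 / 2| <= x ^+ 2.
Proof.
have := cos_bound2 x; rewrite !ler_norml => /andP[a b]; apply/andP; split; first lra.
have := cos_le1 x; have := sqr_ge0 x; lra.
Qed.

End calculus.

(** * Integration against finite measures *)

Section finite_integrals.
Context (R : realType).

Lemma bounded_integrable d (X : measurableType d) (m : {finite_measure set X -> \bar R})
    (f : X -> R) (M : R) :
  measurable_fun setT f -> (forall x, `|f x| <= M) -> m.-integrable setT (EFin \o f).
Proof.
move=> mf fM; apply: measurable_bounded_integrable => //.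
  by rewrite -ge0_fin_numE ?fin_num_measure.
by exists M; split; rewrite ?num_real // => N MN x _ /=; rewrite (le_trans (fM x))// ltW.
Qed.

Lemma Rintegral_bound d (X : measurableType d) (m : {finite_measure set X -> \bar R})
    (f : X -> R) (M : R) :
  measurable_fun setT f -> (forall x, `|f x| <= M) ->
  `|\int[m]_x f x| <= M * fine (m setT).
Proof.
move=> mf fM; have If := bounded_integrable m mf fM.
rewrite (le_trans (le_normr_Rintegral _ If))// -Rintegral_cst//.
apply: le_Rintegral => //.
  apply: bounded_integrable => [|x]; first exact: measurableT_comp.
  by rewrite normr_id; exact: fM.
apply: (@bounded_integrable _ _ _ _ `|M|) => //=.
Qed.

(** Cauchy-Schwarz against the constant 1, read off from the nonnegative integral of (f - a/b)^2,
    where a/b is the mean of [f]. A measure of total mass 0 is treated apart, as a/b has no meaning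
    there. *)
Lemma sqr_Rintegral_le d (X : measurableType d) (m : {finite_measure set X -> \bar R})
    (f : X -> R) : m.-integrable setT (EFin \o f) ->
  m.-integrable setT (EFin \o (fun x => f x ^+ 2)) ->
  (\int[m]_x f x) ^+ 2 <= fine (m setT) * \int[m]_x (f x ^+ 2).
Proof.
move=> If If2; set a := \int[m]_x f x; set b := fine (m setT).
have b0 : 0 <= b by rewrite fine_ge0.
have Ic (c : R) : m.-integrable setT (EFin \o (fun _ : X => c)).
  by apply: (@bounded_integrable _ _ _ _ `|c|) => //=.
have [b_eq0|bn0] := eqVneq b 0.
  have m0 : m setT = 0%E by rewrite -[LHS]fineK ?fin_num_measure// -/b b_eq0.
  rewrite b_eq0 mul0r.
  have -> : a = 0.
    rewrite /a /Rintegral null_set_integral//=.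
    by case/integrableP : If.
  by rewrite expr0n.
have bp : 0 < b by rewrite lt_neqAle eq_sym bn0.
have : 0 <= \int[m]_x ((f x - a / b) ^+ 2).
  by apply: Rintegral_ge0 => x _; exact: sqr_ge0.
have -> : \int[m]_x ((f x - a / b) ^+ 2) =
    \int[m]_x (f x ^+ 2) - 2 * (a / b) * a + (a / b) ^+ 2 * b.
  have -> : \int[m]_x ((f x - a / b) ^+ 2) =
      \int[m]_x (f x ^+ 2 - (2 * (a / b) * f x - (a / b) ^+ 2)).
    by apply: eq_Rintegral => x _; ring.
  have I1 : m.-integrable setT (EFin \o (fun x => 2 * (a / b) * f x)).
    have := integrableZl measurableT (2 * (a / b)) If.
    by apply: eq_integrable => // x _ /=; rewrite EFinM.
  rewrite RintegralB//; last by have := integrableB measurableT I1 (Ic ((a/b)^+2)).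
  rewrite RintegralB// RintegralZl// Rintegral_cst//= -/a -/b.
  ring.
have -> : 2 * (a / b) * a = 2 * a ^+ 2 / b by ring.
have -> : (a / b) ^+ 2 * b = a ^+ 2 / b by field.
move=> H; rewrite -ler_pdivrMl// mulrC; move: H; lra.
Qed.

Section fubini.
Context d1 d2 (X : measurableType d1) (Y : measurableType d2).
Variables (m1 : {finite_measure set X -> \bar R}) (m2 : {finite_measure set Y -> \bar R}).
Variables (f : X * Y -> R) (M : R).
Hypothesis mf : measurable_fun setT f.
Hypothesis fM : forall z, `|f z| <= M.

Lemma bounded_integrable_prod : (m1 \x m2)%E.-integrable setT (EFin \o f).
Proof.
apply/integrable12ltyP; first exact/measurable_EFinP.
apply: (@le_lt_trans _ _ (\int[m1]_x \int[m2]_y `|M|%:E)%E).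
  apply: ge0_le_integral => //.
  - by move=> x _; apply: integral_ge0.
  - apply: (@measurable_fun_fubini_tonelli_F _ _ _ _ _ m2 (abse \o (EFin \o f))) => //.
      by apply: measurableT_comp => //; exact/measurable_EFinP.
    by move=> z /=; rewrite lee_fin.
  - move=> x _; apply: ge0_le_integral => //.
    + by apply: measurableT_comp => //; apply/measurable_EFinP;
         apply: measurableT_comp => //; exact: measurable_pair1.
    by move=> y _ /=; rewrite lee_fin (le_trans (fM _))// ler_norm.
under eq_integral do rewrite integral_cst//.
rewrite integral_cst//.
have F1 := fin_num_measure m1 _ (@measurableT _ X).
have F2 := fin_num_measure m2 _ (@measurableT _ Y).
by rewrite -ge0_fin_numE ?mule_ge0// !fin_numM.
Qed.

Lemma Rintegral_prod1 : measurable_fun setT (fun x => \int[m2]_y f (x, y)).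
Proof.
apply: measurableT_comp => //.
exact: (measurable_fubini_F bounded_integrable_prod).
Qed.

Lemma Rintegral_prod2 : measurable_fun setT (fun y => \int[m1]_x f (x, y)).
Proof.
apply: measurableT_comp => //.
exact: (measurable_fubini_G bounded_integrable_prod).
Qed.

Lemma bounded_section1 x : m2.-integrable setT (EFin \o (fun y => f (x, y))).
Proof.
apply: bounded_integrable => [|y]; last exact: fM.
by apply: measurableT_comp => //; exact: measurable_pair1.
Qed.

Lemma bounded_section2 y : m1.-integrable setT (EFin \o (fun x => f (x, y))).
Proof.
apply: bounded_integrable => [|x]; last exact: fM.
by apply: measurableT_comp => //; exact: measurable_pair2.
Qed.

Lemma Rintegral_swap :
  \int[m1]_x \int[m2]_y f (x, y) = \int[m2]_y \int[m1]_x f (x, y).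
Proof.
rewrite /Rintegral; congr fine.
under eq_integral do rewrite fineK ?(integrable_fin_num measurableT (bounded_section1 _))//.
under [in RHS]eq_integral do rewrite fineK ?(integrable_fin_num measurableT (bounded_section2 _))//.
exact: (Fubini bounded_integrable_prod).
Qed.

End fubini.
End finite_integrals.

(** * Joint measurability and integration over a time interval *)

Section caratheodory.
Context (R : realType) d (T : measurableType d).

Lemma measurable_floor_scale (n : nat) (k : int) :
  measurable [set s : R | Num.floor (s * n%:R) = k].
Proof.
have -> : [set s : R | Num.floor (s * n%:R) = k] =
    (fun s : R => s * n%:R) @^-1` `[k%:~R, (k + 1)%:~R[.
  apply/seteqP; split => s /=; rewrite in_itv /=.
    by move=> <-; rewrite floor_le_tmp ?floorD1_gt.
  by move=> H; apply/eqP; rewrite floor_eq.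
rewrite -[X in measurable X]setTI.
by apply: (measurable_funM (f := id) (g := cst n%:R)) => //.
Qed.

(** Time is rounded down to the grid of mesh 1/(n+1). On each of the countably many cells the
    rounded function depends on the second variable alone, hence is measurable, and continuity in
    time makes the rounded functions converge pointwise. *)
Lemma measurable_caratheodory (f : R -> T -> R) :
  (forall s, measurable_fun setT (f s)) -> (forall a, continuous (f ^~ a)) ->
  measurable_fun setT (fun z : R * T => f z.1 z.2).
Proof.
move=> mf cf.
pose q (n : nat) (s : R) : R := (Num.floor (s * n.+1%:R))%:~R / n.+1%:R.
apply: (@measurable_fun_cvg _ _ _ _ (fun n z => f (q n z.1) z.2)) => [n|[s a] _] /=.
  move=> _ B mB; rewrite setTI.
  rewrite (_ : _ @^-1` B = \bigcup_(k in [set: int])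
     ([set s : R | Num.floor (s * n.+1%:R) = k] `*` (f (k%:~R / n.+1%:R) @^-1` B))).
    apply: countable_bigcupT_measurable => [|k]; [exact: countableP|apply: measurableX].
      exact: measurable_floor_scale.
    by rewrite -[X in measurable X]setTI; exact: mf.
  apply/seteqP; split => [[s a] /= fB|[s a] [k _] [/= <-]] //.
  by exists (Num.floor (s * n.+1%:R)).
suff qs : (fun n => q n s : R) @ \oo --> (s : R) by exact: (cvg_comp _ _ qs (cf a s)).
have H n : s - n.+1%:R^-1 <= q n s <= s.
  have n0 : (0 : R) < n.+1%:R by [].
  rewrite /q ler_pdivrMr// floor_le_tmp andbT ler_pdivlMr// mulrBl mulVf// lerBlDr.
  by have := floorD1_gt (s * n.+1%:R); rewrite intrD => /ltW.
apply: (@squeeze_cvgr _ _ _ _ (fun n => s - n.+1%:R^-1) (fun=> s)).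
- by apply: nearW => n; exact: H.
- rewrite -[X in _ --> X]subr0; apply: cvgB; first exact: cvg_cst.
  exact: cvg_harmonic.
- exact: cvg_cst.
Qed.

End caratheodory.

Section time_measure.
Context (R : realType).

(** A finite measure on the whole line rather than an integral over a subset: product measures and
    Fubini for bounded functions then apply directly. *)
Definition lam (T : R) := mrestr (@lebesgue_measure R) (measurable_itv `[0, T]).

HB.instance Definition _ (T : R) := Measure.on (lam T).

Lemma lam_fin (T : R) : fin_num_fun (lam T).
Proof.
move=> A mA; rewrite ge0_fin_numE// /lam /mrestr.
apply: (@le_lt_trans _ _ (@lebesgue_measure R `[0, T])).
  by apply: le_measure; rewrite ?inE//; apply: measurableI.
by rewrite lebesgue_measure_itv; case: ifP => //= _; rewrite ltry.
Qed.

HB.instance Definition _ (T : R) := Measure_isFinite.Build _ _ _ (lam T) (lam_fin T).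

Lemma lam_out (T : R) : lam T (~` `[0, T]) = 0%E.
Proof. by rewrite /lam /mrestr setICl measure0. Qed.

Lemma lam_setT (T : R) : 0 <= T -> fine (lam T setT) = T.
Proof.
move=> T0; rewrite /lam /mrestr setTI lebesgue_measure_itv /= lte_fin.
by case: ltP => [_|T1] /=; [rewrite subr0|apply/eqP; rewrite eq_le T0 T1].
Qed.

Lemma Rintegral_lam (T : R) (f : measurableTypeR R -> R) :
  (lam T).-integrable setT (EFin \o f) ->
  \int[lam T]_s f s = \int[@lebesgue_measure R]_(s in `[0, T]) f s.
Proof.
move=> If; rewrite /Rintegral; congr fine.
rewrite (@negligible_integral _ _ _ (lam T) setT (~` `[0, T])) //=.
- rewrite setDE setCK setTI; apply: eq_measure_integral => A mA AT.
  by rewrite /= /lam /mrestr setIidl.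
- by apply: measurableC; exact: measurable_itv.
- exact: lam_out.
Qed.

Lemma measurable_leb d (X : measurableType d) (f g : X -> R) :
  measurable_fun setT f -> measurable_fun setT g ->
  measurable_fun setT (fun x => (f x <= g x)%R%:R : R).
Proof.
move=> mf mg; apply: (@measurableT_comp _ _ _ _ _ _ (fun b : bool => b%:R : R)) => //.
exact: measurable_fun_ler.
Qed.

Lemma continuous_measurable_R (f : R -> R) : continuous f -> measurable_fun setT f.
Proof. exact: continuous_measurable_fun. Qed.

(** The upper end [t] moves from the domain of integration into the integrand. Running integrals
    thereby become integrals against one fixed measure, to which Fubini and the kernel formalism
    apply. *)
Lemma prim_lam (f : R -> R) (M t T : R) : continuous f -> (forall s, `|f s| <= M) ->
  0 <= t <= T -> prim f t = \int[lam T]_s ((s <= t)%R%:R * f s).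
Proof.
move=> cf fM /andP[t0 tT].
rewrite Rintegral_lam; last first.
  apply: (@bounded_integrable _ _ _ _ _ M) => [|s].
    apply: measurable_funM; last exact: continuous_measurable_R.
    exact: measurable_leb.
  by rewrite normrM normr_nat (le_trans _ (fM s))// ler_piMl// lern1 leq_b1.
rewrite /prim (_ : [set` `[0, t]] = [set` `[0, T]] `&` [set` `]-oo, t]]).
  rewrite Rintegral_mkcondr; apply: eq_Rintegral => s _.
  by rewrite patchE mem_setE in_itv /=; case: (s <= t); rewrite ?mul1r ?mul0r.
apply/seteqP; split => s /=; rewrite !in_itv /=.
  by move=> /andP[-> st]; rewrite st (le_trans st tT).
by move=> [/andP[-> _] ->].
Qed.

End time_measure.

Section real_integrable.
Context d (X : measurableType d) (R : realType) (m : {measure set X -> \bar R}).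
Implicit Types f g : X -> R.

Definition rint f := m.-integrable setT (EFin \o f).

Lemma rintD f g : rint f -> rint g -> rint (fun x => f x + g x).
Proof. by move=> If Ig; have := integrableD measurableT If Ig. Qed.

Lemma rintB f g : rint f -> rint g -> rint (fun x => f x - g x).
Proof. by move=> If Ig; have := integrableB measurableT If Ig. Qed.

Lemma rintZ (k : R) f : rint f -> rint (fun x => k * f x).
Proof. by move=> If; have := integrableZl measurableT k If. Qed.

Lemma rint_mfun f : rint f -> measurable_fun setT f.
Proof. by move=> /integrableP[/measurable_EFinP]. Qed.

Lemma rint_le f g : measurable_fun setT f -> (forall x, `|f x| <= g x) -> rint g -> rint f.
Proof.
move=> mf fg; apply: le_integrable => //; first exact/measurable_EFinP.
by move=> x _ /=; rewrite lee_fin (le_trans (fg x))// ler_norm.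
Qed.

Lemma rint_abs f : rint f -> rint (fun x => `|f x|).
Proof.
move=> If; apply: (le_integrable measurableT _ _ If).
  by apply/measurable_EFinP; apply: measurableT_comp => //; exact: rint_mfun.
by move=> x _ /=; rewrite lee_fin normr_id.
Qed.

Lemma rint_eq f g : f =1 g -> rint f -> rint g.
Proof. by move=> /funext ->. Qed.

Lemma rint_sum (I : Type) (s : seq I) (F : I -> X -> R) :
  (forall i, rint (F i)) -> rint (fun x => \sum_(i <- s) F i x).
Proof.
move=> IF; elim: s => [|i s IH].
  apply: (@rint_eq (fun=> 0)) => [x|]; first by rewrite big_nil.
  exact: integrable0.
by apply: (@rint_eq (fun x => F i x + \sum_(i <- s) F i x)) => [x|];
  [rewrite big_cons|apply: rintD].
Qed.

Lemma Rintegral_sum (I : Type) (s : seq I) (F : I -> X -> R) :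
  (forall i, rint (F i)) ->
  \int[m]_x (\sum_(i <- s) F i x) = \sum_(i <- s) \int[m]_x F i x.
Proof.
move=> IF; elim: s => [|i s IH].
  by under eq_Rintegral do rewrite big_nil; rewrite big_nil Rintegral_cst// mul0r.
under eq_Rintegral do rewrite big_cons.
by rewrite RintegralD// ?big_cons ?IH//; [exact: IF|exact: rint_sum].
Qed.

Lemma Rintegral_EFin f : rint f -> (\int[m]_x f x)%:E = (\int[m]_x (f x)%:E)%E.
Proof. by move=> If; rewrite /Rintegral fineK//; exact: integrable_fin_num. Qed.

Lemma normr_Rintegral_le f g : rint f -> rint g -> (forall x, `|f x| <= g x) ->
  `|\int[m]_x f x| <= \int[m]_x g x.
Proof.
move=> If Ig fg; rewrite (le_trans (le_normr_Rintegral _ If))//.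
by apply: le_Rintegral => //; exact: rint_abs.
Qed.

Lemma rint_dominated_cvg (f_ : nat -> X -> R) f g :
  (forall n, measurable_fun setT (f_ n)) -> (forall x, f_ ^~ x @ \oo --> f x) ->
  rint g -> (forall n x, `|f_ n x| <= g x) ->
  (\int[m]_x f_ n x) @[n --> \oo] --> \int[m]_x f x.
Proof.
move=> mf cf Ig fg.
have mfl : measurable_fun setT f by apply: measurable_fun_cvg mf _ => x _; exact: cf.
have If : rint f.
  apply: rint_le Ig => // x.
  have c : `|f_ n x| @[n --> \oo] --> `|f x| by apply: cvg_norm; exact: cf.
  rewrite -(cvg_lim _ c)//; apply: limr_le; first by apply/cvg_ex; exists `|f x|.
  by apply: nearW => n; exact: fg.
apply: fine_cvg; rewrite fineK; last exact: integrable_fin_num.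
apply: (@dominated_cvg _ _ _ m _ _ (fun n x => (f_ n x)%:E) _ (EFin \o g)) => //.
- by move=> n; exact/measurable_EFinP.
- by move=> x _; apply: cvg_EFin; [exact: nearW|exact: cf].
- by move=> n x _; rewrite /= lee_fin fg.
Qed.

End real_integrable.

Section probability_integrable.
Context d (X : measurableType d) (R : realType) (P : probability X R).

Lemma rint_bounded (f : X -> R) (M : R) :
  measurable_fun setT f -> (forall x, `|f x| <= M) -> rint P f.
Proof. exact: bounded_integrable. Qed.

Lemma rint_cst (c : R) : rint P (fun=> c).
Proof. by apply: (@rint_bounded _ `|c|) => //=. Qed.

Lemma probability_cst (c : R) : \int[P]_x c = c.
Proof. by rewrite Rintegral_cst //= (@probability_setT _ _ _ P) mulr1. Qed.

Lemma probability_bound (f : X -> R) (M : R) :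
  measurable_fun setT f -> (forall x, `|f x| <= M) -> `|\int[P]_x f x| <= M.
Proof.
by move=> mf fM; have := Rintegral_bound P mf fM; rewrite /= (@probability_setT _ _ _ P) mulr1.
Qed.

Lemma rint_exp (f : X -> R) (p q : nat) : (p <= q)%N -> measurable_fun setT f ->
  rint P (fun x => `|f x| ^+ q) -> rint P (fun x => f x ^+ p).
Proof.
move=> pq mf Iq; apply: (@rint_le _ _ _ _ _ (fun x => 1 + `|f x| ^+ q)).
- exact: measurable_funX.
- move=> x; rewrite normrX; have [f1|f1] := leP `|f x| 1.
    apply: (@le_trans _ _ 1); first by rewrite exprn_ile1.
    by rewrite lerDl exprn_ge0.
  apply: (@le_trans _ _ (`|f x| ^+ q)); last by rewrite lerDr.
  by apply: ler_weXn2l => //; exact: ltW.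
- by apply: rintD => //; exact: rint_cst.
Qed.

End probability_integrable.

(** * Sums of independent variables *)

Section independent_sums.
Context d d' (T : measurableType d) (T' : measurableType d') (R : realType).
Variables (P : probability T R) (h : probability T' R).
Variable X : nat -> {RV P >-> T'}.
Hypothesis iX : mutually_independent X.
Hypothesis dX : identically_distributed X h.
Variable f : {mfun T' >-> R}.

Definition psum (n : nat) (a : T) : R := \sum_(j < n) f (X j a).

Lemma measurable_psum n : measurable_fun setT (psum n).
Proof.
apply: measurable_sum => j; apply: measurableT_comp => //.
Qed.

HB.instance Definition _ n :=
  isMeasurableFun.Build _ _ _ _ (psum n) (measurable_psum n).

Definition psum_next (n : nat) (a : T) : R * T' := (psum n a, X n a).

Lemma measurable_psum_next n : measurable_fun setT (psum_next n).
Proof. by apply/measurable_fun_pairP; split; [exact: measurable_psum|]. Qed.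

HB.instance Definition _ n :=
  isMeasurableFun.Build _ _ _ _ (psum_next n) (measurable_psum_next n).

Let XB j B : measurable B -> P (X j @^-1` B) = h B.
Proof. by move=> mB; have := dX j mB. Qed.

Let mcap (J : seq nat) (B : nat -> set T') : (forall j, measurable (B j)) ->
  measurable (\bigcap_(j in [set` J]) (X j @^-1` B j)).
Proof.
move=> mB; apply: bigcap_measurableType => // j _.
by rewrite -[X in measurable X]setTI; exact: measurable_funP.
Qed.

Let cap1 n (B : set T') :
  \bigcap_(j in [set` [:: n]]) (X j @^-1` B) = X n @^-1` B.
Proof.
apply/seteqP; split => a.
  by move=> H; apply: (H n); rewrite /= inE.
by move=> XB' j /=; rewrite inE => /eqP ->.
Qed.

Let mscale_prod (m1 : probability R R) (r : {nonneg R}) (D : set (R * T')) :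
  measurable D -> (m1 \x mscale r h)%E D = (r%:num%:E * (m1 \x h) D)%E.
Proof.
move=> mD.
rewrite (product_measure_unique (m1 := m1) (m2 := mscale r h)
  (m' := mscale r (m1 \x h)%E)) // => A B mA mB.
by rewrite /= /mscale /= product_measure1E// muleCA.
Qed.

(** The hypothesis speaks only of events in the individual [X j]. That the partial sum is
    independent of the later variables is proved for all finite families [J] of later indices at
    once, because the step from n to n + 1 adds the index n to the family. Rectangles suffice, by
    uniqueness of product measures. *)
Let psum_indep n (A : set R) (J : seq nat) (B : nat -> set T') : measurable A ->
  uniq J -> all (leq n) J -> (forall j, measurable (B j)) ->
  P (psum n @^-1` A `&` \bigcap_(j in [set` J]) (X j @^-1` B j)) =
  (P (psum n @^-1` A) * \prod_(j <- J) h (B j))%E.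
Proof.
elim: n A J B => [|n IH] A J B mA uJ nJ mB.
  have capE : P (\bigcap_(j in [set` J]) (X j @^-1` B j)) = (\prod_(j <- J) h (B j))%E.
    by rewrite iX//; apply: eq_bigr => j _; rewrite XB.
  have [A0|A0] := pselect (A 0).
    have -> : psum 0 @^-1` A = setT.
      by apply/seteqP; split => // a _; rewrite /= /psum big_ord0.
    by rewrite setTI probability_setT mul1e.
  have -> : psum 0 @^-1` A = set0.
    by apply/seteqP; split => // a; rewrite /= /psum big_ord0.
  by rewrite set0I measure0 mul0e.
pose E := \bigcap_(j in [set` J]) (X j @^-1` B j).
have mE : measurable E by exact: mcap.
have PE : P E = (\prod_(j <- J) h (B j))%E.
  by rewrite iX//; apply: eq_bigr => j _; rewrite XB.
have r0 : 0 <= fine (P E) by rewrite fine_ge0.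
(* The event [E] is kept as a factor P E scaling the measure [h], instead of being conditioned on,
   so that the case P E = 0 needs no separate argument. *)
pose r := NngNum r0.
have rE : r%:num%:E = P E by rewrite /r /= fineK// fin_num_measure.
pose D := [set z : R * T' | A (z.1 + f z.2)].
have mD : measurable D.
  rewrite (_ : D = setT `&` (fun z : R * T' => z.1 + f z.2) @^-1` A) ?setTI//.
  rewrite -[X in measurable X]setTI.
  have H : measurable_fun setT (fun z : R * T' => z.1 + f z.2).
    by apply: measurable_funD => //; apply: measurableT_comp.
  exact: H.
have SE : psum n.+1 @^-1` A = psum_next n @^-1` D.
  by apply/seteqP; split => a; rewrite /= /psum big_ord_recr.
have nJn j : j \in J -> (n < j)%N by move=> jJ; exact: (allP nJ).
have IH2 A' B' : measurable A' -> measurable B' ->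
    P (psum n @^-1` A' `&` (X n @^-1` B') `&` E) = (P (psum n @^-1` A') * (h B' * P E))%E.
  move=> mA' mB'.
  pose B2 j := if j == n then B' else B j.
  have -> : psum n @^-1` A' `&` (X n @^-1` B') `&` E =
     psum n @^-1` A' `&` \bigcap_(j in [set` n :: J]) (X j @^-1` B2 j).
    rewrite -setIA; congr (_ `&` _); apply/seteqP; split => a.
      move=> [XB' Ea] j /=; rewrite inE /B2; case: eqVneq => [-> //|_ /= jJ].
      exact: Ea.
    move=> H; split.
      by have := H n; rewrite /= /B2 eqxx; apply; rewrite inE eqxx.
    move=> j /= jJ; have := H j; rewrite /= /B2; case: eqVneq => [jn|_].
      by have := nJn _ jJ; rewrite jn ltnn.
    by apply; rewrite inE jJ orbT.
  rewrite IH//.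
  - rewrite big_cons /B2 eqxx PE; congr (_ * (_ * _))%E.
    apply: eq_big_seq => j jJ; case: eqVneq => // jn.
    by have := nJn _ jJ; rewrite jn ltnn.
  - by rewrite /= uJ andbT; apply/negP => /nJn; rewrite ltnn.
  - by rewrite /= leqnn; apply/allP => j /nJn /ltnW.
  - by move=> j; rewrite /B2; case: ifP.
have joint : P (psum_next n @^-1` D `&` E) = (P E * (distribution P (psum n) \x h) D)%E.
  rewrite -rE -mscale_prod//.
  rewrite (product_measure_unique (m1 := distribution P (psum n)) (m2 := mscale r h)
    (m' := pushforward (mrestr P mE) (psum_next n))) //.
  move=> A' B' mA' mB'; rewrite /pushforward /mrestr /mscale.
  by have := IH2 _ _ mA' mB'; rewrite -rE [(h B' * _)%E]muleC; exact.
have jointT : P (psum_next n @^-1` D) = ((distribution P (psum n) \x h) D)%E.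
  rewrite (product_measure_unique (m1 := distribution P (psum n)) (m2 := h)
    (m' := distribution P (psum_next n))) //.
  move=> A' B' mA' mB'; rewrite /distribution /pushforward.
  have := IH A' [:: n] (fun=> B') mA'; rewrite big_seq1 cap1 /= leqnn.
  by apply.
by rewrite SE joint jointT PE muleC.
Qed.

Lemma psum_next_law n D : measurable D ->
  distribution P (psum_next n) D = ((distribution P (psum n) \x h) D)%E.
Proof.
move=> mD.
rewrite (product_measure_unique (m1 := distribution P (psum n)) (m2 := h)
    (m' := distribution P (psum_next n))) //.
move=> A' B' mA' mB'; rewrite /distribution /pushforward.
have := @psum_indep n A' [:: n] (fun=> B') mA'; rewrite big_seq1 cap1 /= leqnn.
by apply.
Qed.

Lemma psum_next_prod n (phi : R -> R) (psi : T' -> R) :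
  measurable_fun setT phi -> rint P (fun a => phi (psum n a)) -> rint h psi ->
  rint P (fun a => phi (psum n a) * psi (X n a)) /\
  \int[P]_a (phi (psum n a) * psi (X n a)) =
    (\int[P]_a phi (psum n a)) * \int[h]_x psi x.
Proof.
move=> mphi Iphi Ipsi.
have mpsi := rint_mfun Ipsi.
pose F (z : R * T') := (phi z.1 * psi z.2)%:E.
have mF : measurable_fun setT F.
  by apply/measurable_EFinP; apply: measurable_funM; apply: measurableT_comp.
pose nu : {measure set (R * T') -> \bar R} := (distribution P (psum n) \x h)%E.
have nuE A : measurable A -> nu A = distribution P (psum_next n) A.
  by move=> mA; rewrite psum_next_law.
have tr (G : R * T' -> \bar R) :
    (\int[nu]_z G z = \int[distribution P (psum_next n)]_z G z)%E.
  by apply: eq_measure_integral => A mA _; exact: nuE.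
have IF : nu.-integrable setT F.
  apply/integrable12ltyP => //.
  rewrite /F /=.
  have mpsi' : measurable_fun setT (fun y => `|psi y|%:E).
    by apply/measurable_EFinP; apply: measurableT_comp.
  have mphi' : measurable_fun setT (fun y => `|phi y|%:E).
    by apply/measurable_EFinP; apply: measurableT_comp.
  under eq_integral => x _.
    under eq_integral => y _ do rewrite normrM EFinM.
    rewrite ge0_integralZl//.
    over.
  rewrite ge0_integralZr//; last exact: integral_ge0.
  rewrite (@ge0_integral_distribution _ _ _ _ _ P (psum n) (fun x => `|phi x|%:E))//.
  have /integrableP[_ i1] := Iphi.
  have /integrableP[_ i2] := Ipsi.
  apply: lte_mul_pinfty => //.
    by apply: integral_ge0 => //=.
  by rewrite ge0_fin_numE//; apply: integral_ge0 => //=.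
have IP : P.-integrable setT (F \o psum_next n).
  apply/integrableP; split; first by apply: measurableT_comp => //; exact: measurable_psum_next.
  rewrite -(@ge0_integral_distribution _ _ _ _ _ P (psum_next n) (abse \o F)) //;
    try exact: measurableT_comp; try by move=> z /=.
  by rewrite -tr; case/integrableP : IF.
split; first exact: IP.
have E1 : (\int[P]_a (phi (psum n a) * psi (X n a))%:E =
    \int[distribution P (psum n)]_x \int[h]_y (phi x * psi y)%:E)%E.
  rewrite -[LHS](@integral_distribution _ _ _ _ _ P (psum_next n) F)// -tr.
  by rewrite -(integral12_prod_meas1 IF).
have Idphi : (distribution P (psum n)).-integrable setT (EFin \o phi).
  by apply: integrable_pushforward => //; exact/measurable_EFinP.
rewrite [LHS]/Rintegral E1.
under eq_integral => x _.
  under eq_integral do rewrite EFinM.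
  rewrite integralZl// -Rintegral_EFin//.
  over.
rewrite /= integralZr// fineM//; last exact: integrable_fin_num.
congr (fine _ * _).
by rewrite (@integral_distribution _ _ _ _ _ P (psum n) (EFin \o phi))//; exact/measurable_EFinP.
Qed.

Lemma psum_binomial n (p : nat) :
  (forall q, (q <= p)%N -> rint P (fun a => psum n a ^+ q)) ->
  (forall q, (q <= p)%N -> rint h (fun x => f x ^+ q)) ->
  rint P (fun a => psum n.+1 a ^+ p) /\
  \int[P]_a (psum n.+1 a ^+ p) = \sum_(i < p.+1)
     ((\int[P]_a (psum n a ^+ (p - i))) * \int[h]_x (f x ^+ i)) *+ 'C(p, i).
Proof.
move=> IS If.
have E a : \sum_(i < p.+1) ('C(p, i)%:R * (psum n a ^+ (p - i) * f (X n a) ^+ i)) =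
    psum n.+1 a ^+ p.
  have -> : psum n.+1 a = psum n a + f (X n a) by rewrite /psum big_ord_recr.
  by rewrite exprDn; apply: eq_bigr => i _; rewrite mulr_natl.
have pr (i : 'I_p.+1) := @psum_next_prod n (fun s => s ^+ (p - i)) (fun x => f x ^+ i)
   (exprn_measurable _) (IS _ (leq_subr _ _)) (If _ (ltn_ord i : (i <= p)%N)).
have Ii (i : 'I_p.+1) : rint P (fun a => 'C(p, i)%:R * (psum n a ^+ (p - i) * f (X n a) ^+ i)).
  by apply: rintZ; case: (pr i).
split; first by apply: (rint_eq E); exact: rint_sum.
rewrite -(eq_Rintegral _ (fun a _ => E a)) Rintegral_sum//.
apply: eq_bigr => i _; case: (pr i) => I1 E1.
by rewrite RintegralZl// E1 mulr_natl.
Qed.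

(** In the binomial recursion centring removes every term that contains a first moment, so the
    fourth moment grows by 6 n v^2 + M4 at step n, with v and M4 the second and fourth moments of
    [f]. This is absorbed by 3 n^2 v^2 + n M4, as 3 (n+1)^2 - 3 n^2 = 6 n + 3. *)
Lemma psum_moments n : rint h (fun x => f x ^+ 4) -> \int[h]_x f x = 0 ->
  [/\ rint P (fun a => psum n a ^+ 4), \int[P]_a psum n a = 0,
     \int[P]_a (psum n a ^+ 2) = n%:R * \int[h]_x (f x ^+ 2) &
     \int[P]_a (psum n a ^+ 4) <=
       3 * n%:R ^+ 2 * (\int[h]_x (f x ^+ 2)) ^+ 2 + n%:R * \int[h]_x (f x ^+ 4)].
Proof.
move=> I4 E0.
have even4 (x : R) : `|x| ^+ 4 = x ^+ 4 by rewrite -normrX ger0_norm ?exprn_even_ge0.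
have If q : (q <= 4)%N -> rint h (fun x => f x ^+ q).
  move=> q4; apply: (rint_exp q4) => //.
  by apply: rint_eq I4 => x /=; rewrite even4.
have p1 (Y : Type) (g : Y -> R) : (fun y => g y ^+ 1) = g by apply/funext => y; rewrite expr1.
elim: n => [|n [IS S1 S2 S4]].
  have E a : psum 0 a = 0 by rewrite /psum big_ord0.
  split.
  - by apply: (@rint_eq _ _ _ _ (fun=> 0)) => [a|]; [rewrite E expr0n|exact: rint_cst].
  - by under eq_Rintegral do rewrite E; rewrite probability_cst.
  - by under eq_Rintegral do rewrite E expr0n /=; rewrite probability_cst mul0r.
  - under eq_Rintegral do rewrite E expr0n /=.
    by rewrite probability_cst expr0n /= mulr0 !mul0r addr0.
have IP q : (q <= 4)%N -> rint P (fun a => psum n a ^+ q).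
  move=> q4; apply: (rint_exp q4); first exact: measurable_psum.
  by apply: rint_eq IS => a /=; rewrite even4.
pose MS q := \int[P]_a (psum n a ^+ q).
pose MF q := \int[h]_x (f x ^+ q).
have bin p : (p <= 4)%N -> rint P (fun a => psum n.+1 a ^+ p) /\
    \int[P]_a (psum n.+1 a ^+ p) = \sum_(i < p.+1) (MS (p - i)%N * MF i) *+ 'C(p, i).
  move=> p4; apply: psum_binomial => q qp.
    exact: IP (leq_trans qp p4).
  exact: If (leq_trans qp p4).
have MS0 : MS 0 = 1 by rewrite /MS; under eq_Rintegral do rewrite expr0; rewrite probability_cst.
have MF0 : MF 0 = 1 by rewrite /MF; under eq_Rintegral do rewrite expr0; rewrite probability_cst.
have MS1 : MS 1 = 0 by rewrite /MS p1.
have MF1 : MF 1 = 0 by rewrite /MF p1.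
have B1 : \int[P]_a (psum n.+1 a ^+ 1) = (MS 1 * MF 0) *+ 1 + ((MS 0 * MF 1) *+ 1 + 0).
  by have [_ ->] := bin 1%N isT; rewrite !big_ord_recl big_ord0.
have B2 : \int[P]_a (psum n.+1 a ^+ 2) = (MS 2 * MF 0) *+ 1 +
    ((MS 1 * MF 1) *+ 2 + ((MS 0 * MF 2) *+ 1 + 0)).
  by have [_ ->] := bin 2%N isT; rewrite !big_ord_recl big_ord0.
have B4 : \int[P]_a (psum n.+1 a ^+ 4) = (MS 4 * MF 0) *+ 1 +
    ((MS 3 * MF 1) *+ 4 + ((MS 2 * MF 2) *+ 6 + ((MS 1 * MF 3) *+ 4 + ((MS 0 * MF 4) *+ 1 + 0)))).
  by have [_ ->] := bin 4%N isT; rewrite !big_ord_recl big_ord0.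
have [I4' _] := bin 4%N isT.
rewrite -/(MS 2) -/(MS 4) -/(MF 2) -/(MF 4) in S2 S4 *.
split => //.
- by rewrite -(p1 _ (psum n.+1)) B1 MS1 MF1 mul0r mulr0 !addr0.
- by rewrite B2 MS0 MF0 MS1 S2 -[n.+1]addn1 natrD; ring.
rewrite B4 MS0 MF0 MS1 MF1 S2 -[n.+1]addn1 natrD.
have : 0 <= MF 2 ^+ 2 by exact: sqr_ge0.
have : 0 <= n%:R :> R by [].
move: S4; set N := n%:R; set M2 := MF 2; set M4 := MF 4; set A := MS 4.
move=> S4 N0 M0.
have -> : A * 1 *+ 1 + (MS 3%N * 0 *+ 4 + (N * M2 * M2 *+ 6 +
   (0 * MF 3%N *+ 4 + (1 * M4 *+ 1 + 0)))) = A + 6 * N * M2 ^+ 2 + M4 by ring.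
apply: (@le_trans _ _ (3 * N ^+ 2 * M2 ^+ 2 + N * M4 + 6 * N * M2 ^+ 2 + M4)).
  by rewrite !lerD2r.
have -> : 3 * (N + 1) ^+ 2 * M2 ^+ 2 + (N + 1) * M4 =
  3 * N ^+ 2 * M2 ^+ 2 + N * M4 + 6 * N * M2 ^+ 2 + M4 + 3 * M2 ^+ 2 by ring.
by rewrite lerDl mulr_ge0.
Qed.

(* Compares the n-th power of the characteristic value E exp(i f) with that of a real w. *)
Lemma psum_cos_sin n (w : R) : 0 <= w <= 1 ->
  `|\int[P]_a cos (psum n a) - w ^+ n| + `|\int[P]_a sin (psum n a)| <=
  n%:R * (`|\int[h]_x cos (f x) - w| + 2 * `|\int[h]_x sin (f x)|).
Proof.
move=> /andP[w0 w1].
have mc : measurable_fun setT (@cos R) by apply: continuous_measurable_fun; exact: continuous_cos.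
have ms : measurable_fun setT (@sin R) by apply: continuous_measurable_fun; exact: continuous_sin.
have bp (mY : measure_display) (TY : measurableType mY) (Q : probability TY R)
   (g : TY -> R) (tr : R -> R) : measurable_fun setT g -> measurable_fun setT tr ->
   (forall x, `|tr x| <= 1) -> rint Q (fun y => tr (g y)).
  by move=> mg mtr tr1; apply: (@rint_bounded _ _ _ _ _ 1) => //; apply: measurableT_comp.
elim: n => [|n IH].
  have E a : psum 0 a = 0 by rewrite /psum big_ord0.
  under eq_Rintegral do rewrite E cos0.
  under [X in _ + `|X|]eq_Rintegral do rewrite E sin0.
  by rewrite !probability_cst expr0 subrr normr0 mul0r addr0.
have E a : psum n.+1 a = psum n a + f (X n a) by rewrite /psum big_ord_recr.
have mS := measurable_psum n.
have Ic := bp _ _ P _ _ mS mc (@cos_max R).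
have Is := bp _ _ P _ _ mS ms (@sin_max R).
have mf : measurable_fun setT f by [].
have Jc := bp _ _ h _ _ mf mc (@cos_max R).
have Js := bp _ _ h _ _ mf ms (@sin_max R).
have [Icc Ecc] := psum_next_prod mc Ic Jc.
have [Iss Ess] := psum_next_prod ms Is Js.
have [Ics Ecs] := psum_next_prod mc Ic Js.
have [Isc Esc] := psum_next_prod ms Is Jc.
have -> : \int[P]_a cos (psum n.+1 a) = \int[P]_a cos (psum n a) * \int[h]_x cos (f x)
   - \int[P]_a sin (psum n a) * \int[h]_x sin (f x).
  by under eq_Rintegral do rewrite E cosD; rewrite RintegralB// Ecc Ess.
have -> : \int[P]_a sin (psum n.+1 a) = \int[P]_a sin (psum n a) * \int[h]_x cos (f x)
   + \int[P]_a cos (psum n a) * \int[h]_x sin (f x).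
  by under eq_Rintegral do rewrite E sinD; rewrite RintegralD// Esc Ecs.
have C1 : `|\int[P]_a cos (psum n a)| <= 1.
  by apply: probability_bound => [|x]; [apply: measurableT_comp|exact: cos_max].
have S1 : `|\int[P]_a sin (psum n a)| <= 1.
  by apply: probability_bound => [|x]; [apply: measurableT_comp|exact: sin_max].
have c1 : `|\int[h]_x cos (f x)| <= 1.
  by apply: probability_bound => [|x]; [apply: measurableT_comp|exact: cos_max].
move: IH C1 S1 c1.
set C := \int[P]_a cos _; set S := \int[P]_a sin _.
set c := \int[h]_x cos _; set s := \int[h]_x sin _ => IH C1 S1 c1.
(* One factor is exchanged at a time. The sine mean [s] enters once through the cosine and once
   through the sine of the sum, which explains its coefficient 2 in the bound. *)
have -> : C * c - S * s - w ^+ n.+1 = C * (c - w) + w * (C - w ^+ n) - S * s.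
  by rewrite exprS; ring.
have H1 : `|C * (c - w) + w * (C - w ^+ n) - S * s| <= `|c - w| + `|C - w ^+ n| + `|s|.
  apply: (le_trans (ler_normB _ _)); apply: lerD; last by rewrite normrM ler_piMl.
  apply: (le_trans (ler_normD _ _)); apply: lerD; first by rewrite normrM ler_piMl.
  by rewrite normrM ler_piMl// ger0_norm.
have H2 : `|S * c + C * s| <= `|S| + `|s|.
  apply: (le_trans (ler_normD _ _)); apply: lerD; first by rewrite normrM ler_piMr.
  by rewrite normrM ler_piMl.
move: IH; rewrite -[n.+1]addn1 natrD mulrDl; lra.
Qed.

End independent_sums.

Section preliminaries.
Context (R : realType).

Lemma mfun_bundle (d' : measure_display) (Y : measurableType d') (f : Y -> R) :
  measurable_fun setT f -> exists g : {mfun Y >-> R}, forall x, g x = f x.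
Proof.
move=> mf.
pose H := isMeasurableFun.Build _ _ _ _ f mf.
by exists (HB.pack_for {mfun Y >-> R} f H).
Qed.

Lemma expRN_bounds (x : R) : 0 <= x -> `|expR (- x) - (1 - x)| <= x ^+ 2.
Proof.
move=> x0; have H1 := expR_ge1Dx (- x); have H2 := expR_ge1Dx x.
have : expR (- x) <= (1 + x)^-1 by rewrite expRN lef_pV2 ?posrE ?expR_gt0 ?ltr_wpDr.
have : (1 + x)^-1 <= 1 - x + x ^+ 2.
  rewrite -[leLHS]mul1r ler_pdivrMr ?ltr_wpDr//.
  have : 0 <= x ^+ 3 by rewrite exprn_ge0.
  by rewrite (_ : (1 - x + x ^+ 2) * (1 + x) = 1 + x ^+ 3); [lra|ring].
by move=> H3 H4; rewrite ger0_norm; lra.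
Qed.

Lemma sqrtN_cvg : (Num.sqrt n.+1%:R)^-1 @[n --> \oo] --> (0 : R).
Proof.
have -> : (fun n : nat => (Num.sqrt n.+1%:R)^-1 : R) = fun n => Num.sqrt (n.+1%:R^-1).
  by apply/funext => n; rewrite sqrtrV.
rewrite -[X in _ --> X]sqrtr0.
suff h0 : (fun n : nat => n.+1%:R^-1 : R) @ \oo --> (0 : R).
  exact: (cvg_comp _ _ h0 (@sqrt_continuous R 0)).
exact: cvg_harmonic.
Qed.

Lemma sum_inv_sqr (n : nat) : \sum_(k < n) (k.+1%:R ^+ 2)^-1 <= 2 :> R.
Proof.
(* The sharper bound 2 - 1/(n+1) telescopes, and so is stable under induction. *)
suff : \sum_(k < n.+1) (k.+1%:R ^+ 2)^-1 <= 2 - n.+1%:R^-1 :> R.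
  rewrite big_ord_recr /=; have : 0 <= (n.+1%:R ^+ 2)^-1 :> R by rewrite invr_ge0 exprn_ge0.
  have : 0 <= n.+1%:R^-1 :> R by rewrite invr_ge0.
  by move=> a b c; apply: (le_trans _ (le_trans c _)); [rewrite lerDl|rewrite lerBlDr lerDl].
elim: n => [|n IH]; first by rewrite big_ord1 expr1n invr1; lra.
rewrite big_ord_recr /=; apply: (le_trans (lerD IH (lexx _))).
have -> : n.+2%:R = n.+1%:R + 1 :> R by rewrite -natr1.
have n0 : 0 < n.+1%:R :> R by [].
set m := n.+1%:R in n0 *.
have m1 : 0 < m + 1 by rewrite addr_gt0.
rewrite -subr_ge0.
have -> : 2 - (m + 1)^-1 - (2 - m^-1 + ((m + 1) ^+ 2)^-1) = (m * (m + 1) ^+ 2)^-1.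
  have key (x : R) : x != 0 -> x + 1 != 0 ->
      2 - (x + 1)^-1 - (2 - x^-1 + ((x + 1) ^+ 2)^-1) = (x * (x + 1) ^+ 2)^-1.
    by move=> a b; field; apply/andP; split.
  by rewrite key ?gt_eqF.
by rewrite invr_ge0 mulr_ge0 ?exprn_ge0 ?(ltW n0) ?(ltW m1).
Qed.

End preliminaries.

(** * Almost sure convergence and the central limit theorem *)

Section almost_sure.
Context d (T : measurableType d) (R : realType) (P : probability T R).

(** The series of the [z n] has expectation at most 2 C, hence is finite almost surely, and the
    terms of a convergent series tend to 0. This takes the place of a Borel-Cantelli argument. *)
Lemma ae_cvg0 (z : nat -> T -> R) (C : R) : (forall n, measurable_fun setT (z n)) ->
  (forall n a, 0 <= z n a) ->
  (forall n, (\int[P]_a (z n a)%:E <= (C / n.+1%:R ^+ 2)%:E)%E) ->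
  {ae P, forall a, z n a @[n --> \oo] --> 0}.
Proof.
move=> mz z0 zC.
pose F a := (\sum_(0 <= n <oo) (z n a)%:E)%E.
have mzE n : measurable_fun setT (fun a => (z n a)%:E) by exact/measurable_EFinP.
have IF : (\int[P]_a F a <= (C * 2)%:E)%E.
  rewrite integral_nneseries//; last by move=> n a _; rewrite lee_fin.
  apply: lime_le; first by apply: is_cvg_nneseries => n _ _; apply: integral_ge0 => a _; rewrite lee_fin.
  apply: nearW => n; rewrite big_mkord.
  have C0 : 0 <= C.
    have H : (0 <= \int[P]_a (z 0%N a)%:E)%E by apply: integral_ge0 => a _; rewrite lee_fin.
    by have := le_trans H (zC 0%N); rewrite expr1n divr1 lee_fin.
  apply: (@le_trans _ _ (\sum_(k < n) (C / k.+1%:R ^+ 2)%:E)%E); first exact: lee_sum.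
  by rewrite sumEFin lee_fin -mulr_sumr ler_wpM2l// sum_inv_sqr.
have F0 a : (0 <= F a)%E by apply: nneseries_ge0 => n _ _; rewrite lee_fin.
have mF : measurable_fun setT F by apply: ge0_emeasurable_sum => // n a _ _; rewrite lee_fin.
have : P.-integrable setT F.
  apply/integrableP; split => //.
  under eq_integral do rewrite gee0_abs//.
  by apply: le_lt_trans IF _; rewrite ltry.
move=> /(integrable_ae measurableT).
apply: filterS => a /(_ I) Fa.
apply: cvg_series_cvg_0; apply: nondecreasing_is_cvgn.
  by apply/nondecreasing_seqP => n; rewrite /series /= big_nat_recr //= lerDl.
exists (fine (F a)) => _ [n _ <-].
rewrite -lee_fin fineK// /series /= -sumEFin.
by apply: nneseries_lim_ge => m _ _; rewrite lee_fin.
Qed.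

End almost_sure.

Section central_limit.
Context d d' (T : measurableType d) (T' : measurableType d') (R : realType).
Variables (P : probability T R) (h : probability T' R).
Variable X : nat -> {RV P >-> T'}.
Hypothesis iX : mutually_independent X.
Hypothesis dX : identically_distributed X h.

(** Only the cosine of the normalized sum is treated, at frequency 1. Other frequencies, and linear
    combinations of two variables, are obtained by changing [f]. *)
Lemma cos_clt (f : T' -> R) : measurable_fun setT f ->
  rint h (fun x => f x ^+ 2) -> \int[h]_x f x = 0 ->
  \int[P]_a cos ((Num.sqrt n.+1%:R)^-1 * \sum_(j < n.+1) f (X j a)) @[n --> \oo] -->
  expR (- (\int[h]_x (f x ^+ 2) / 2)).
Proof.
move=> mf If2 f0.
set v := \int[h]_x (f x ^+ 2).
have v0 : 0 <= v by apply: Rintegral_ge0 => x _; exact: sqr_ge0.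
have If : rint h f.
  have := @rint_exp _ _ _ h f 1 2 isT mf.
  rewrite (_ : (fun x => f x ^+ 1) = f); last by apply/funext => x; rewrite expr1.
  by apply; apply: rint_eq If2 => x; rewrite real_normK ?num_real.
pose k (n : nat) : R := (Num.sqrt n.+1%:R)^-1.
have kk n : k n ^+ 2 = n.+1%:R^-1 by rewrite /k exprVn sqr_sqrtr.
have nk n : n.+1%:R * k n ^+ 2 = 1 by rewrite kk mulfV.
have k0 n : 0 <= k n by rewrite invr_ge0 sqrtr_ge0.
have mkf n : measurable_fun setT (fun x => k n * f x) by apply: measurable_funM.
have mc : measurable_fun setT (@cos R) by apply: continuous_measurable_fun; exact: continuous_cos.
have ms : measurable_fun setT (@sin R) by apply: continuous_measurable_fun; exact: continuous_sin.
have Icos n : rint h (fun x => cos (k n * f x)).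
  apply: (@rint_bounded _ _ _ _ _ 1) => [|x]; last exact: cos_max.
  exact: (measurableT_comp mc (mkf n)).
have Isin n : rint h (fun x => sin (k n * f x)).
  apply: (@rint_bounded _ _ _ _ _ 1) => [|x]; last exact: sin_max.
  exact: (measurableT_comp ms (mkf n)).
(* [u] and [s] are n + 1 times the Taylor remainders of the cosine and of the sine. Their integrals
   tend to 0 by dominated convergence, with f^2 as dominating function. The linear term of the sine
   contributes nothing because [f] is centred. *)
pose u n (x : T') := n.+1%:R * (cos (k n * f x) - 1 + (k n * f x) ^+ 2 / 2).
pose s n (x : T') := n.+1%:R * (sin (k n * f x) - k n * f x).
have dom (g : R -> R) (x : T') n : `|g (k n * f x)| <= (k n * f x) ^+ 2 ->
    `|n.+1%:R * g (k n * f x)| <= f x ^+ 2.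
  move=> gb; rewrite normrM ger0_norm//.
  apply: (le_trans (ler_wpM2l _ gb)) => //.
  by rewrite exprMn mulrA nk mul1r.
have lim (g : R -> R) (x : T') : (forall y, `|g y| <= `|y| ^+ 3) ->
    n.+1%:R * g (k n * f x) @[n --> \oo] --> (0 : R).
  move=> gb.
  apply: norm_cvg0.
  apply: (@squeeze_cvgr _ _ _ _ (fun=> 0) (fun n => k n * `|f x| ^+ 3)).
  - apply: nearW => n; rewrite normr_ge0 /= normrM ger0_norm//.
    apply: (le_trans (ler_wpM2l _ (gb _))) => //.
    rewrite normrM (ger0_norm (k0 n)).
    have -> : n.+1%:R * (k n * `|f x|) ^+ 3 = (n.+1%:R * k n ^+ 2) * (k n * `|f x| ^+ 3) by ring.
    by rewrite nk mul1r.
  - exact: cvg_cst.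
  - rewrite -[X in _ --> X](mul0r (`|f x| ^+ 3)); apply: cvgM; last exact: cvg_cst.
    exact: sqrtN_cvg.
have Lu : \int[h]_x u n x @[n --> \oo] --> (0 : R).
  rewrite -[X in _ --> X](@probability_cst _ _ _ h).
  apply: (rint_dominated_cvg (g := fun x => f x ^+ 2)) => //.
  - move=> n; apply: measurable_funM => //; apply: measurable_funD.
      by apply: measurable_funB => //; exact: (measurableT_comp mc (mkf n)).
    by apply: measurable_funM => //; exact: measurable_funX.
  - by move=> x; apply: (lim (fun y => cos y - 1 + y ^+ 2 / 2)) => y; exact: cos_bound3.
  - by move=> n x; apply: (dom (fun y => cos y - 1 + y ^+ 2 / 2)); exact: cos_bound2'.
have Ls : \int[h]_x s n x @[n --> \oo] --> (0 : R).
  rewrite -[X in _ --> X](@probability_cst _ _ _ h).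
  apply: (rint_dominated_cvg (g := fun x => f x ^+ 2)) => //.
  - move=> n; apply: measurable_funM => //; apply: measurable_funB => //.
    exact: (measurableT_comp ms (mkf n)).
  - by move=> x; apply: (lim (fun y => sin y - y)) => y; exact: sin_bound3.
  - by move=> n x; apply: (dom (fun y => sin y - y)); exact: sin_bound2.
have Es n : \int[h]_x s n x = n.+1%:R * \int[h]_x sin (k n * f x).
  rewrite /s RintegralZl//; last by apply: rintB => //; exact: rintZ.
  have Ikf : rint h (fun x => k n * f x) by exact: rintZ.
  by rewrite (RintegralB measurableT (Isin n) Ikf) RintegralZl// f0 mulr0 subr0.
have Eu n : \int[h]_x u n x = n.+1%:R * (\int[h]_x cos (k n * f x) - 1) + v / 2.
  have Iq : rint h (fun x => (k n * f x) ^+ 2 / 2).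
    by apply: rint_eq (rintZ (k n ^+ 2 / 2) If2) => x /=; rewrite exprMn; ring.
  rewrite /u RintegralZl//; last first.
    by apply: rintD => //; apply: rintB => //; exact: rint_cst.
  rewrite RintegralD//; last by apply: rintB => //; exact: rint_cst.
  rewrite (RintegralB measurableT (Icos n) (rint_cst h 1)).
  rewrite probability_cst mulrDr; congr (_ + _).
  rewrite (_ : \int[h]_x ((k n * f x) ^+ 2 / 2) = k n ^+ 2 / 2 * v); last first.
    rewrite -RintegralZl//; apply: eq_Rintegral => x _; rewrite exprMn; ring.
  have -> : n.+1%:R * (k n ^+ 2 / 2 * v) = n.+1%:R * k n ^+ 2 * (v / 2) by ring.
  by rewrite nk mul1r.
(* The (n+1)-st root of the Gaussian limit. It lies in [0, 1], so [psum_cos_sin] compares the cosine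
   mean with the limit itself. *)
pose w (n : nat) : R := expR (- (v / 2 / n.+1%:R)).
have w01 n : 0 <= w n <= 1.
  rewrite expR_ge0 /= -expR0 ler_expR oppr_le0 divr_ge0// divr_ge0//.
have wn n : w n ^+ n.+1 = expR (- (v / 2)).
  rewrite /w -expRM_natl; congr expR; rewrite mulrN -mulr_natl mulrCA mulfV ?mulr1//.
have ww n : n.+1%:R * `|1 - v / 2 / n.+1%:R - w n| <= (v / 2) ^+ 2 / n.+1%:R.
  rewrite distrC; apply: (le_trans (ler_wpM2l _ (expRN_bounds _))) => //.
    by rewrite divr_ge0// divr_ge0.
  have E (m y : R) : m != 0 -> m * (y / m) ^+ 2 = y ^+ 2 / m by move=> m0; field.
  by rewrite E.
apply/cvgrPdist_le => e e0.
apply: (filterS (P := [set n | n.+1%:R * (`|\int[h]_x cos (k n * f x) - w n|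
   + 2 * `|\int[h]_x sin (k n * f x)|) <= e])).
  move=> n /= ne.
  have [g gE] := mfun_bundle (mkf n).
  have := psum_cos_sin iX dX g n.+1 (w01 n).
  rewrite wn.
  have -> : \int[P]_a cos (psum X g n.+1 a) =
      \int[P]_a cos (k n * \sum_(j < n.+1) f (X j a)).
    apply: eq_Rintegral => a _; congr cos; rewrite /psum mulr_sumr.
    by apply: eq_bigr => j _; rewrite gE.
  have -> : \int[h]_x cos (g x) = \int[h]_x cos (k n * f x).
    by apply: eq_Rintegral => x _; rewrite gE.
  have -> : \int[h]_x sin (g x) = \int[h]_x sin (k n * f x).
    by apply: eq_Rintegral => x _; rewrite gE.
  move=> H; rewrite distrC; apply: le_trans ne; apply: le_trans H.
  by rewrite lerDl.
pose B n := `|\int[h]_x u n x| + (v / 2) ^+ 2 / n.+1%:R + 2 * `|\int[h]_x s n x|.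
have Bc : B n @[n --> \oo] --> (0 : R).
  suff : B n @[n --> \oo] --> (`|0 : R| + (v / 2) ^+ 2 * 0 + 2 * `|0 : R| : R).
    by rewrite normr0 !mulr0 !addr0.
  apply: cvgD; first apply: cvgD.
  - exact: (cvg_norm (V := R^o)).
  - by apply: cvgM; [exact: cvg_cst|exact: cvg_harmonic].
  - by apply: cvgM; [exact: cvg_cst|exact: (cvg_norm (V := R^o))].
move/cvgrPdist_le : Bc => /(_ _ e0); apply: filterS => n /=.
rewrite sub0r normrN => Be; apply: le_trans (le_trans (ler_norm _) Be).
rewrite /B Eu Es normrM (ger0_norm (ler0n _ _)).
rewrite mulrDr [n.+1%:R * (2 * _)]mulrCA lerD2r.
apply: le_trans (lerD (lexx _) (ww n)).
rewrite -[X in X * `|_ - _ |](@ger0_norm _ n.+1%:R)// -normrM.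
rewrite -[X in _ + X * `|_|](@ger0_norm _ n.+1%:R)// -normrM.
apply: le_trans (ler_normD _ _).
rewrite le_eqVlt; apply/orP; left; apply/eqP; congr `|_|.
have : n.+1%:R != 0 :> R by [].
by move=> n0; field.
Qed.

End central_limit.

(** * Gaussian limits *)

Section derivative_zero.
Context (R : realType).

Lemma isd_continuous (f df : R -> R) : (forall s, isd f s (df s)) -> continuous f.
Proof.
move=> fd s; apply: differentiable_continuous; apply/derivable1_diffP.
by case: (fd s).
Qed.

Lemma isd0_cst (f : R -> R) : (forall s, isd f s 0) -> forall a b, f a = f b.
Proof.
move=> fd a b; wlog ab : a b / a <= b.
  by move=> H; have [/H|/ltW/H ->] := leP a b.
apply/eqP; rewrite eq_sym -subr_eq0 -normr_le0 -(mul0r (b - a)).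
apply: (@derive_bound R f (fun=> 0) 0 a b ab (isd_continuous fd)) => s _ //.
by rewrite normr0.
Qed.

End derivative_zero.

Section gaussian.
Context (R : realType).
Notation mu := (@lebesgue_measure R).
Let p (x : R) : R := normal_pdf 0 1 x.
Let c : R := normal_peak 1.

Lemma normal_pdf01E (x : R) : normal_pdf 0 1 x = c * expR (- (x ^+ 2 / 2)) :> R.
Proof.
rewrite normal_pdfE ?oner_neq0// /normal_fun subr0 expr1n; congr (_ * expR _).
by rewrite mulNr.
Qed.

Let c0 : 0 < c. Proof. by rewrite normal_peak_gt0// oner_neq0. Qed.

Let p0 x : 0 <= p x. Proof. exact: normal_pdf_ge0. Qed.

Lemma isd_normal_pdf (x : R) : isd (normal_pdf 0 1) x (- x * normal_pdf 0 1 x).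
Proof.
have -> : normal_pdf 0 1 = fun x : R => c * expR (- (x ^+ 2 / 2)).
  by apply/funext => y; exact: normal_pdf01E.
apply: isd_eq.
  apply: isdM; first exact: isd_cst.
  apply: (@isd_comp _ (fun x : R => - (x ^+ 2 / 2)) expR); first exact: isd_expR.
  apply: isdN; apply: (@isdM _ (fun x : R => x ^+ 2)); last exact: isd_cst.
  by apply: isdM; exact: isd_id.
by rewrite /=; field.
Qed.

Let cp : continuous p. Proof. exact: continuous_normal_pdf (oner_neq0 R). Qed.

Let Ip : rint mu p.
Proof. exact: integrable_normal_pdf. Qed.

(** Domination by a multiple of the normal density of standard deviation 2. It rests on |x| <= 2
    exp(3 x^2 / 8), where 3/8 = 1/2 - 1/8 is the difference of the two Gaussian exponents. *)
Let Ixp : rint mu (fun x => `|x| * p x).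
Proof.
pose k : R := 2 * c / normal_peak 2.
have k2 : 0 < normal_peak 2 :> R by rewrite normal_peak_gt0// pnatr_eq0.
apply: (rint_le (g := fun x : measurableTypeR R => k * normal_pdf 0 2 x)).
- by apply: continuous_measurable_fun; apply: contM => //; apply: cont_abs; exact: cont_id.
- move=> x; rewrite ger0_norm ?mulr_ge0// /p normal_pdf01E.
  have -> : k * normal_pdf 0 2 x = c * (2 * expR (- x ^+ 2 / (2 ^+ 2 *+ 2))).
    rewrite normal_pdfE ?pnatr_eq0// /k /normal_fun subr0.
    by move: (normal_peak 2) (expR _) k2 => A B A0; field; rewrite gt_eqF.
  rewrite mulrCA ler_pM2l//.
  have -> : - (x ^+ 2 / 2) = - (3 / 8 * x ^+ 2) + - x ^+ 2 / (2 ^+ 2 *+ 2).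
    by rewrite -mulr_natr; field.
  rewrite expRD mulrA ler_pM2r ?expR_gt0// expRN ler_pdivrMr ?expR_gt0//.
  apply: (@le_trans _ _ (2 * (1 + 3 / 8 * x ^+ 2))); last first.
    by rewrite ler_pM2l// expR_ge1Dx.
  have : 0 <= (`|x| - 2) ^+ 2 by exact: sqr_ge0.
  have : 0 <= `|x| ^+ 2 by exact: sqr_ge0.
  rewrite -[x ^+ 2]real_normK ?num_real// sqrrB -mulr_natr; lra.
- by apply: rintZ; exact: integrable_normal_pdf.
Qed.

Let mfe (f : R -> R) : continuous f -> measurable_fun setT f.
Proof. exact: continuous_measurable_fun. Qed.

Variable v : R.

Let F (t : R) : R := \int[mu]_x (cos (t * x + v) * p x).

Let cl (f : R -> R) (t : R) : continuous f -> continuous (fun x : R => f (t * x + v)).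
Proof.
move=> cf; apply: (@cont_comp _ (fun x => t * x + v) f) => //.
by apply: contD; [apply: contM; [exact: cont_cst|exact: cont_id]|exact: cont_cst].
Qed.

Let Icos t : rint mu (fun x => cos (t * x + v) * p x).
Proof.
apply: (rint_le _ _ Ip).
  by apply: mfe; apply: contM => //; apply: cl; exact: continuous_cos.
by move=> x; rewrite normrM (ger0_norm (p0 x)) ler_piMl// cos_max.
Qed.

Let Ixsin t : rint mu (fun x => x * sin (t * x + v) * p x).
Proof.
apply: (rint_le _ _ Ixp).
  apply: mfe; apply: contM => //; apply: contM; first exact: cont_id.
  by apply: cl; exact: continuous_sin.
move=> x; rewrite !normrM (ger0_norm (p0 x)) ler_wpM2r//.
by rewrite ler_piMr// sin_max.
Qed.

Let isd_line (f g : R -> R) (t x : R) : (forall y, isd f y (g y)) ->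
  isd (fun s => f (s * x + v)) t (x * g (t * x + v)).
Proof.
move=> fg; apply: isd_eq.
  apply: (@isd_comp _ (fun s : R => s * x + v) f); first exact: fg.
  by apply: isdD; [apply: isdM; [exact: isd_id|exact: isd_cst]|exact: isd_cst].
by rewrite /=; ring.
Qed.

Let isd_F t : isd F t (- \int[mu]_x (x * sin (t * x + v) * p x)).
Proof.
have fd (s x : R) : isd (fun s : R => cos (s * x + v) * p x) s (- (x * sin (s * x + v) * p x)).
  apply: isd_eq.
    apply: isdM; last exact: isd_cst.
    by apply: isd_line => y; exact: isd_cos.
  by rewrite /=; ring.
have pE (s x : R) : partial1of2 (fun s x : R => cos (s * x + v) * p x) s x = - (x * sin (s * x + v) * p x).
  by rewrite /partial1of2 derive1E; have [_ ->] := fd s x.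
have It : (`]t - 1, t + 1[%classic : set R) t.
  by rewrite /= in_itv /= ltrBlDr !ltrDl !ltr01.
have intf (s : R) : `]t - 1, t + 1[%classic s -> mu.-integrable setT (EFin \o (fun x => cos (s * x + v) * p x)).
  by move=> _; exact: Icos.
have der (s x : R) : `]t - 1, t + 1[%classic s -> [set: R] x ->
   derivable (fun s : R => cos (s * x + v) * p x) s 1.
  by move=> _ _; case: (fd s x).
have G0 (x : R) : 0 <= `|x| * p x by rewrite mulr_ge0.
have ub (s x : R) : `]t - 1, t + 1[%classic s -> [set: R] x ->
   `|partial1of2 (fun s x : R => cos (s * x + v) * p x) s x| <= `|x| * p x.
  move=> _ _; rewrite pE normrN !normrM (ger0_norm (p0 x)) ler_wpM2r//.
  by rewrite ler_piMr// sin_max.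
have D1 := derivable_under_integral measurableT It intf der G0 Ixp ub.
have D2 := differentiation_under_integral measurableT It intf der G0 Ixp ub.
apply: DeriveDef; first exact: D1.
rewrite -derive1E D2; under eq_Rintegral do rewrite pE.
rewrite (_ : (fun x => - (x * sin (t * x + v) * p x)) = fun x => -1 * (x * sin (t * x + v) * p x)).
  by rewrite RintegralZl// ?mulN1r//; exact: Ixsin.
by apply/funext => x; rewrite mulN1r.
Qed.

(** Integration by parts with p' = - x p. It is carried out on [-n-1, n+1], where the boundary terms
    are at most c/(n+1), and passes to the limit by dominated convergence. *)
Let parts t : \int[mu]_x (x * sin (t * x + v) * p x) = t * F t.
Proof.
pose H x := p x * sin (t * x + v).
pose H' x := t * (cos (t * x + v) * p x) - x * sin (t * x + v) * p x.
have dH x : isd H x (H' x).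
  apply: isd_eq.
    apply: isdM; first exact: isd_normal_pdf.
    apply: (@isd_comp _ (fun x => t * x + v) sin); first exact: isd_sin.
    by apply: isdD; [apply: isdM; [exact: isd_cst|exact: isd_id]|exact: isd_cst].
  by rewrite /H' /= -/(p x); ring.
have cH : continuous H.
  by apply: contM => //; apply: cl; exact: continuous_sin.
have cH' : continuous H'.
  apply: contB; apply: contM => //; first exact: cont_cst.
    by apply: contM => //; apply: cl; exact: continuous_cos.
  by apply: contM; [exact: cont_id|apply: cl; exact: continuous_sin].
have IH' : rint mu H' by apply: rintB; [apply: rintZ; exact: Icos|exact: Ixsin].
pose h_ (n : nat) : measurableTypeR R -> R := H' \_ `[- n.+1%:R, n.+1%:R].
have lim1 : (\int[mu]_x h_ n x) @[n --> \oo] --> \int[mu]_x H' x.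
  apply: (@rint_dominated_cvg _ (measurableTypeR R) R mu h_ H' (fun x => `|H' x|)).
  - move=> n; apply/(measurable_restrictT _ _).1 => //.
    exact: measurable_funS (mfe cH').
  - move=> x; apply: (cvg_near_cst (H' x)).
    near=> n; rewrite /h_ patchE mem_setE in_itv /= -ler_norml.
    suff -> : `|x| <= n.+1%:R by [].
    near: n; exists (Num.trunc `|x|) => // n /= xn.
    by rewrite ltW// (lt_le_trans (truncnS_gt _))// ler_nat.
  - exact: rint_abs.
  - by move=> n x; rewrite /h_ patchE; case: ifP => //; rewrite normr0.
have hE n : \int[mu]_x h_ n x = H n.+1%:R - H (- n.+1%:R).
  rewrite /h_ -Rintegral_mkcond /Rintegral (@continuous_FTC2 _ H' H)//.
  - by rewrite -subr_gt0 opprK addr_gt0.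
  - exact: continuous_subspaceT.
  - split; first by move=> x _; case: (dH x).
      by apply: cvg_at_right_filter; exact: cH.
    by apply: cvg_at_left_filter; exact: cH.
  - by move=> x _; rewrite derive1E; case: (dH x).
have Hb n (x : R) : `|x| = n.+1%:R -> `|H x| <= c * n.+1%:R^-1.
  move=> xn; rewrite /H normrM (ger0_norm (p0 x)).
  apply: (@le_trans _ _ (p x)); first by rewrite ler_piMr// sin_max.
  rewrite /p normal_pdf01E ler_pM2l// expRN lef_pV2 ?posrE ?expR_gt0//.
  apply: le_trans (expR_ge1Dx _).
  rewrite -real_normK ?num_real// xn.
  have : 0 <= (n.+1%:R - 1) ^+ 2 :> R by exact: sqr_ge0.
  rewrite sqrrB expr1n mulr1 -mulr_natr; lra.
have lim2 : (\int[mu]_x h_ n x) @[n --> \oo] --> (0 : R).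
  apply: norm_cvg0; apply: (@squeeze_cvgr _ _ _ _ (fun=> 0) (fun n => c * n.+1%:R^-1 + c * n.+1%:R^-1)).
  - apply: nearW => n; rewrite normr_ge0 /= hE (le_trans (ler_normB _ _))// lerD//.
      by apply: Hb; rewrite ger0_norm.
    by apply: Hb; rewrite normrN ger0_norm.
  - exact: cvg_cst.
  - suff : (c * n.+1%:R^-1 + c * n.+1%:R^-1) @[n --> \oo] --> (c * 0 + c * 0 : R).
      by rewrite mulr0 addr0.
    by apply: cvgD; apply: cvgM; (exact: cvg_cst || exact: cvg_harmonic).
have : \int[mu]_x H' x = 0 by rewrite -(cvg_lim _ lim1)// (cvg_lim _ lim2).
rewrite /H' RintegralB//; last 2 first.
- by apply: rintZ; exact: Icos.
- exact: Ixsin.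
rewrite RintegralZl//; last exact: Icos.
by move=> /eqP; rewrite subr_eq0 => /eqP <-.
Unshelve. all: by end_near. Qed.

(** [F] satisfies F' = - t F, so F(t) exp(t^2/2) is constant. The free phase [v] later allows a
    planar Gaussian to be integrated one coordinate at a time without any sine integral. *)
Lemma integral_cos_normal_pdf (t : R) :
  \int[mu]_x (cos (t * x + v) * normal_pdf 0 1 x) = cos v * expR (- (t ^+ 2 / 2)).
Proof.
rewrite -/(F t).
pose E (s : R) := expR (s ^+ 2 / 2).
have dE s : isd E s (s * E s).
  apply: isd_eq.
    apply: (@isd_comp _ (fun x : R => x ^+ 2 / 2) expR); first exact: isd_expR.
    apply: (@isdM _ (fun x : R => x ^+ 2)); last exact: isd_cst.
    by apply: isdM; exact: isd_id.
  by rewrite /E /=; field.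
have W1 (s : R) : isd (fun s => F s * E s) s 0.
  apply: isd_eq; first by apply: isdM; [exact: isd_F|exact: dE].
  by rewrite parts; ring.
have W : F t * E t = F 0 * E 0 := isd0_cst W1 t 0.
have F0 : F 0 = cos v.
  rewrite /F; under eq_Rintegral do rewrite mul0r add0r.
  by rewrite RintegralZl// /Rintegral integral_normal_pdf mulr1.
have Et : E t != 0 by rewrite gt_eqF ?expR_gt0.
rewrite expRN -/(E t) -[LHS]mulr1 -(mulfV Et) mulrA W F0.
by rewrite /E expr0n /= mul0r expR0 mulr1.
Qed.

Lemma Rintegral_normal_prob (f : R -> R) : rint (normal_prob 0 1) f ->
  \int[normal_prob 0 1]_x f x = \int[mu]_x (f x * normal_pdf 0 1 x).
Proof.
move=> If; rewrite /Rintegral; congr fine.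
have dom : normal_prob 0 1 `<< mu := normal_prob_dominates 0 1.
rewrite -(Radon_Nikodym_change_of_variables dom measurableT If).
have mfi : measurable_fun setT (EFin \o f) by case/integrableP : If.
have mp : measurable_fun setT (fun x => (normal_pdf 0 1 x)%:E : \bar R).
  by apply/measurable_EFinP; exact: measurable_normal_pdf.
under [RHS]eq_integral do rewrite EFinM.
apply: ae_eq_integral => //.
- by apply: emeasurable_funM.
- by apply: emeasurable_funM.
apply: ae_eqe_mul2l.
apply: integral_ae_eq => //; first exact: Radon_Nikodym_integrable.
by move=> A _ mA; rewrite -Radon_Nikodym_integral.
Qed.

Lemma integral_cos_normal (t : R) : \int[normal_prob 0 1]_x cos (t * x + v) = cos v * expR (- (t ^+ 2 / 2)).
Proof.
rewrite Rintegral_normal_prob ?integral_cos_normal_pdf//.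
apply: (@rint_bounded _ _ _ _ _ 1) => [|x]; last exact: cos_max.
by apply: mfe; apply: cl; exact: continuous_cos.
Qed.

End gaussian.

(** * Moment method on [0, 1] by Bernstein polynomials *)

Section bernstein.
Context (R : realType).

(** Evaluated at w, this is the expectation of f(S) for S binomial with m trials and success
    probability w. Conditioning on one trial, instead of summing over binomial coefficients, makes
    each property an induction on m. *)
Fixpoint bernstein (m : nat) (f : nat -> R) : {poly R} :=
  if m is m'.+1 then 'X * bernstein m' (fun k => f k.+1) + (1 - 'X) * bernstein m' f
  else (f 0%N)%:P.

Lemma bernsteinS m f (w : R) : (bernstein m.+1 f).[w] =
  w * (bernstein m (fun k => f k.+1)).[w] + (1 - w) * (bernstein m f).[w].
Proof. by rewrite /= !hornerE. Qed.

Lemma le_bernstein m (f g : nat -> R) (w : R) : 0 <= w <= 1 ->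
  (forall k, f k <= g k) -> (bernstein m f).[w] <= (bernstein m g).[w].
Proof.
move=> /andP[w0 w1]; elim: m f g => [|m IH] f g fg; first by rewrite /= !hornerC.
by rewrite !bernsteinS lerD// ler_wpM2l ?subr_ge0// IH.
Qed.

Lemma bernstein_cst m (a w : R) : (bernstein m (fun=> a)).[w] = a.
Proof. by elim: m => [|m IH]; rewrite ?bernsteinS ?IH /= ?hornerC//; ring. Qed.

Lemma bernstein_lin m (f : nat -> R) (a b w : R) :
  (bernstein m (fun k => a * f k + b)).[w] = a * (bernstein m f).[w] + b.
Proof.
elim: m f => [|m IH] f; first by rewrite /= !hornerC.
by rewrite !bernsteinS !IH; ring.
Qed.

(** Squared bias plus the binomial variance m w (1 - w). The centre [a] is left free because the
    recursion shifts it by 1. *)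
Lemma bernstein_sqr m (a w : R) :
  (bernstein m (fun k => (k%:R - a) ^+ 2)).[w] = (m%:R * w - a) ^+ 2 + m%:R * w * (1 - w).
Proof.
elim: m a => [|m IH] a; first by rewrite /= hornerC; ring.
rewrite bernsteinS IH.
have -> : (fun k => (k.+1%:R - a) ^+ 2) = (fun k => (k%:R - (a - 1)) ^+ 2) :> (nat -> R).
  by apply/funext => k; rewrite -natr1; ring.
by rewrite IH -natr1; ring.
Qed.

(* Chebyshev's inequality for the binomial law, in Bernstein form. *)
Lemma bernstein_tail m (f : nat -> R) (w e : R) : (0 < m)%N -> 0 <= w <= 1 -> 0 < e ->
  (forall k, f k <= 1) -> (forall k, `|k%:R - m%:R * w| < m%:R * e -> f k <= 0) ->
  (bernstein m f).[w] <= (m%:R * e ^+ 2)^-1.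
Proof.
move=> m0 w01 e0 f1 f0.
have M0 : 0 < m%:R :> R by rewrite ltr0n.
have me : 0 < (m%:R * e) ^+ 2 by rewrite exprn_gt0// mulr_gt0.
apply: (@le_trans _ _ (bernstein m (fun k => ((m%:R * e) ^+ 2)^-1 * (k%:R - m%:R * w) ^+ 2 + 0)).[w]).
  apply: le_bernstein => // k; rewrite addr0.
  have [/f0 fk|ke] := ltP `|k%:R - m%:R * w| (m%:R * e).
    by apply: (le_trans fk); rewrite mulr_ge0 ?sqr_ge0// invr_ge0 ltW.
  apply: (le_trans (f1 k)); rewrite mulrC ler_pdivlMr// mul1r.
  rewrite -[leRHS]real_normK ?num_real// ler_sqr ?nnegrE//.
  by rewrite mulr_ge0// ltW.
rewrite bernstein_lin addr0 bernstein_sqr subrr expr0n add0r /=.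
case/andP: w01 => w0 w1.
have -> : (m%:R * e ^+ 2)^-1 = ((m%:R * e) ^+ 2)^-1 * m%:R.
  by move: M0 e0; move: (m%:R : R) => M M0 e0; field; rewrite ?gt_eqF.
rewrite ler_pM2l ?invr_gt0// -mulrA ler_piMr ?ltW//; nra.
Qed.

(* Approximates the indicator function of ]c, 1] on [0, 1]. *)
Definition step_poly (m : nat) (c : R) : {poly R} := bernstein m (fun k => (m%:R * c < k%:R)%R%:R).

Lemma step_poly_bounds m (c w : R) : 0 <= w <= 1 -> 0 <= (step_poly m c).[w] <= 1.
Proof.
move=> w01; apply/andP; split.
  rewrite -[leLHS](bernstein_cst m 0 w); apply: le_bernstein => // k.
rewrite -[leRHS](bernstein_cst m 1 w); apply: le_bernstein => // k.
by rewrite lern1 leq_b1.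
Qed.

Lemma step_poly_ge m (c w e : R) : (0 < m)%N -> 0 <= w <= 1 -> 0 < e ->
  (c + e < w)%R%:R - (m%:R * e ^+ 2)^-1 <= (step_poly m c).[w].
Proof.
move=> m0 w01 e0; have M0 : 0 < m%:R :> R by rewrite ltr0n.
have [cew|wce] := boolP (c + e < w); last first.
  have /andP[H _] := step_poly_bounds m c w01; apply: le_trans H.
  by rewrite sub0r oppr_le0 invr_ge0 mulr_ge0 ?sqr_ge0.
have := @bernstein_tail m (fun k => -1 * (m%:R * c < k%:R)%R%:R + 1) w e m0 w01 e0.
rewrite bernstein_lin -/(step_poly m c) => H.
rewrite lerBlDr -lerBlDl /=; apply: le_trans (H _ _).
- by rewrite mulN1r addrC.
- by move=> k; case: (_ < _); rewrite /= ?mulr1 ?mulr0; lra.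
move=> k; rewrite ltr_norml => /andP[k1 k2].
have -> : m%:R * c < k%:R.
  have : m%:R * (c + e) < m%:R * w by rewrite ltr_pM2l.
  by rewrite mulrDr; move: k1; lra.
by rewrite mulr1; lra.
Qed.

Lemma step_poly_le m (c w e : R) : (0 < m)%N -> 0 <= w <= 1 -> 0 < e ->
  (step_poly m c).[w] <= (c - e < w)%R%:R + (m%:R * e ^+ 2)^-1.
Proof.
move=> m0 w01 e0; have M0 : 0 < m%:R :> R by rewrite ltr0n.
have I0 : 0 <= (m%:R * e ^+ 2)^-1 by rewrite invr_ge0 mulr_ge0 ?sqr_ge0.
have [cew|] := boolP (c - e < w).
  by have /andP[_ H] := step_poly_bounds m c w01; rewrite (le_trans H)// lerDl.
rewrite -leNgt => wce; rewrite add0r; apply: bernstein_tail => // k.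
  by rewrite lern1 leq_b1.
rewrite ltr_norml => /andP[k1 k2].
have : m%:R * w <= m%:R * (c - e) by rewrite ler_pM2l.
rewrite mulrBr => H.
by have -> : (m%:R * c < k%:R) = false by apply/negbTE; rewrite -leNgt; lra.
Qed.

End bernstein.

Section boolean_integrals.
Context d (T : measurableType d) (R : realType) (P : probability T R).

Lemma measurable_ltb (f g : T -> R) :
  measurable_fun setT f -> measurable_fun setT g ->
  measurable_fun setT (fun x => (f x < g x)%R%:R : R).
Proof.
move=> mf mg; apply: (@measurableT_comp _ _ _ _ _ _ (fun b : bool => b%:R : R)) => //.
exact: measurable_fun_ltr.
Qed.

Lemma normb_le1 (b : bool) : `|b%:R : R| <= 1.
Proof. by rewrite normr_nat lern1 leq_b1. Qed.

Lemma rint_bool (b : T -> bool) : measurable_fun setT (fun x => (b x)%:R : R) ->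
  rint P (fun x => (b x)%:R).
Proof. by move=> mb; apply: (@rint_bounded _ _ _ _ _ 1) => // x; exact: normb_le1. Qed.

Lemma probability_bool (b : T -> bool) : measurable [set x | b x] ->
  P [set x | b x] = (\int[P]_x (b x)%:R)%:E.
Proof.
move=> mb.
have E : (fun x => (b x)%:R : R) = \1_[set x | b x].
  by apply/funext => x; rewrite indicE; congr (nat_of_bool _)%:R; apply/esym/asboolb.
have mi : measurable_fun setT (fun x => (b x)%:R : R).
  by rewrite E; exact: measurable_indic.
rewrite Rintegral_EFin; last exact: rint_bool.
transitivity (\int[P]_x ((\1_[set x | b x] x : R)%:E))%E.
  by rewrite integral_indic// setIT.
by rewrite -E.
Qed.

End boolean_integrals.

Lemma cvgn_sum (R : realType) (I : Type) (s : seq I) (F : I -> nat -> R) (l : I -> R) :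
  (forall i, F i n @[n --> \oo] --> l i) ->
  (\sum_(i <- s) F i n) @[n --> \oo] --> \sum_(i <- s) l i.
Proof.
move=> Fl; elim: s => [|i s IH].
  by under eq_fun do rewrite big_nil; rewrite big_nil; exact: cvg_cst.
by under eq_fun do rewrite big_cons; rewrite big_cons; apply: cvgD.
Qed.

Section moment_method.
Context d (T : measurableType d) d2 (T2 : measurableType d2) (R : realType).
Variables (P : probability T R) (Q : probability T2 R).
Variables (Wn : nat -> T -> R) (W : T2 -> R).
Hypothesis mWn : forall n, measurable_fun setT (Wn n).
Hypothesis mW : measurable_fun setT W.
Hypothesis Wn01 : forall n a, 0 <= Wn n a <= 1.
Hypothesis W01 : forall a, 0 <= W a <= 1.
Hypothesis moments : forall k : nat,
  (\int[P]_a (Wn n a ^+ k)) @[n --> \oo] --> \int[Q]_a (W a ^+ k).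

Let rint_horner d' (Y : measurableType d') (S : probability Y R) (V : Y -> R) (p : {poly R}) :
  measurable_fun setT V -> (forall a, 0 <= V a <= 1) -> rint S (fun a => p.[V a]) /\
  \int[S]_a p.[V a] = \sum_(i < size p) p`_i * \int[S]_a (V a ^+ i).
Proof.
move=> mV V01.
have Ii (i : nat) : rint S (fun a => V a ^+ i).
  apply: (@rint_bounded _ _ _ _ _ 1) => [|a]; first exact: measurable_funX.
  by case/andP: (V01 a) => v0 v1; rewrite ger0_norm ?exprn_ge0// exprn_ile1.
have Ip (i : 'I_(size p)) : rint S (fun a => p`_i * V a ^+ i) by exact: rintZ.
have E a : \sum_(i < size p) p`_i * V a ^+ i = p.[V a] by rewrite horner_coef.
split; first by apply: (rint_eq E); exact: rint_sum.
rewrite -(eq_Rintegral _ (fun a _ => E a)) Rintegral_sum//.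
by apply: eq_bigr => i _; rewrite RintegralZl//; exact: Ii.
Qed.

Let poly_cvg (p : {poly R}) :
  (\int[P]_a p.[Wn n a]) @[n --> \oo] --> \int[Q]_a p.[W a].
Proof.
have -> : (fun n => \int[P]_a p.[Wn n a]) =
    fun n => \sum_(i < size p) p`_i * \int[P]_a (Wn n a ^+ i).
  by apply/funext => n; exact: (rint_horner P p (mWn n) (Wn01 n)).2.
rewrite (rint_horner Q p mW W01).2.
apply: cvgn_sum => i; apply: cvgM; first exact: cvg_cst.
exact: moments.
Qed.

Let rint_ltb d' (Y : measurableType d') (S : probability Y R) (V : Y -> R) (c : R) :
  measurable_fun setT V -> rint S (fun a => (c < V a)%R%:R).
Proof. by move=> mV; apply: rint_bool; exact: measurable_ltb. Qed.

(** The indicator of values above [c] is squeezed between two polynomials, whose expectations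
    converge by the hypothesis on moments. Letting their thresholds approach [c] closes the gap,
    because the limit law has no atom there. *)
Lemma tail_cvg (c : R) : Q [set a | W a = c] = 0%E ->
  P [set a | c < Wn n a] @[n --> \oo] --> Q [set a | c < W a].
Proof.
move=> c0.
have ms d' (Y : measurableType d') (V : Y -> R) : measurable_fun setT V ->
    measurable [set a | c < V a].
  move=> mV; rewrite (_ : [set a | c < V a] = setT `&` V @^-1` `]c, +oo[).
    exact: mV.
  by apply/seteqP; split => a /=; rewrite in_itv /= andbT //; case.
rewrite probability_bool; last exact: ms.
have -> : (fun n => P [set a | c < Wn n a]) = fun n => (\int[P]_a (c < Wn n a)%R%:R)%:E.
  by apply/funext => n; rewrite probability_bool//; exact: ms.
apply: cvg_EFin; first exact: nearW.
pose q (e : R) := \int[Q]_a (c + e < W a)%R%:R.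
have qle : \int[Q]_a (c <= W a)%R%:R = \int[Q]_a (c < W a)%R%:R.
  have mc : measurable [set a | W a == c].
    rewrite (_ : [set a | W a == c] = setT `&` W @^-1` [set c]).
      by apply: mW => //; exact: measurable_set1.
    by rewrite setTI; apply/seteqP; split => a /= /eqP.
  have mi : measurable_fun setT (fun a => (W a == c)%:R : R).
    rewrite (_ : (fun a => (W a == c)%:R) = \1_[set a | W a == c]).
      exact: measurable_indic.
    by apply/funext => x; rewrite indicE; congr (nat_of_bool _)%:R; apply/esym/asboolb.
  have E a : (c <= W a)%R%:R = (c < W a)%R%:R + (W a == c)%:R :> R.
    by rewrite le_eqVlt eq_sym; case: ltgtP => _ /=; rewrite ?addr0 ?add0r.
  under eq_Rintegral do rewrite E.
  rewrite RintegralD//; [|exact: rint_ltb|exact: rint_bool].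
  suff -> : \int[Q]_a (W a == c)%:R = 0 by rewrite addr0.
  have := probability_bool Q mc.
  rewrite (_ : [set a | W a == c] = [set a | W a = c]); last first.
    by apply/seteqP; split => a /= /eqP.
  by rewrite c0 => -[->].
pose e_ (j : nat) : R := j.+1%:R^-1.
have ej j : 0 < e_ j by rewrite invr_gt0.
have e0 : e_ @ \oo --> (0 : R) by exact: cvg_harmonic.
(* The threshold of the step polynomial is displaced by [e_ j], and [e_ j] is also the tolerance
   within which that polynomial is not controlled; hence the doubled distance from [c]. *)
have qp : q (e_ j + e_ j) @[j --> \oo] --> \int[Q]_a (c < W a)%R%:R.
  apply: (rint_dominated_cvg (g := fun=> 1)) => //; last 2 first.
  - exact: rint_cst.
  - by move=> n x; exact: normb_le1.
  - by move=> n; exact: measurable_ltb.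
  - move=> a; apply: cvg_near_cst.
    have [cW|Wc] := ltP c (W a).
      have h : 0 < (W a - c) / 2 by rewrite divr_gt0 ?subr_gt0.
      near=> j; have -> // : c + (e_ j + e_ j) < W a.
      suff : e_ j < (W a - c) / 2 by lra.
      near: j; exact: (cvgr_lt _ e0).
    apply: nearW => j; have -> // : (c + (e_ j + e_ j) < W a) = false.
    by apply/negbTE; rewrite -leNgt; have := ej j; lra.
have qm : q (- (e_ j + e_ j)) @[j --> \oo] --> \int[Q]_a (c < W a)%R%:R.
  rewrite -qle.
  apply: (rint_dominated_cvg (g := fun=> 1)) => //; last 2 first.
  - exact: rint_cst.
  - by move=> n x; exact: normb_le1.
  - by move=> n; exact: measurable_ltb.
  - move=> a; apply: cvg_near_cst.
    have [cW|Wc] := leP c (W a).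
      by apply: nearW => j; have -> // : c - (e_ j + e_ j) < W a; have := ej j; lra.
    have h : 0 < (c - W a) / 2 by rewrite divr_gt0 ?subr_gt0.
    near=> j; have -> // : (c - (e_ j + e_ j) < W a) = false.
    apply/negbTE; rewrite -leNgt.
    suff : e_ j < (c - W a) / 2 by lra.
    near: j; exact: (cvgr_lt _ e0).
apply/cvgrPdist_le => e e_gt0.
have e4 : 0 < e / 4 by rewrite divr_gt0.
have [j [j1 j2]] : exists j, `|\int[Q]_a (c < W a)%R%:R - q (e_ j + e_ j)| <= e / 4 /\
    `|\int[Q]_a (c < W a)%R%:R - q (- (e_ j + e_ j))| <= e / 4.
  move/cvgrPdist_le : qp => /(_ _ e4) [N1 _ N1P].
  move/cvgrPdist_le : qm => /(_ _ e4) [N2 _ N2P].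
  by exists (maxn N1 N2); split; [apply: N1P|apply: N2P]; rewrite /= ?leq_maxl ?leq_maxr.
have [m m0 meta] : exists2 m : nat, (0 < m)%N & (m%:R * e_ j ^+ 2)^-1 <= e / 4.
  exists (Num.trunc ((e / 4 * e_ j ^+ 2)^-1)).+1 => //.
  have h : 0 < e_ j ^+ 2 by rewrite exprn_gt0.
  rewrite invfM -ler_pdivlMr ?invr_gt0// invrK.
  rewrite -[leRHS]invrK lef_pV2 ?posrE ?invr_gt0 ?mulr_gt0//.
  by rewrite ltW// truncnS_gt.
set eta := (_)^-1 in meta.
have up := @poly_cvg (step_poly m (c - e_ j)).
have lo := @poly_cvg (step_poly m (c + e_ j)).
have bup : \int[Q]_a (step_poly m (c - e_ j)).[W a] <= q (- (e_ j + e_ j)) + eta.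
  rewrite -(probability_cst Q eta) -RintegralD//; [|exact: rint_ltb|exact: rint_cst].
  apply: le_Rintegral => //.
  - by have [] := rint_horner Q (step_poly m (c - e_ j)) mW W01.
  - by apply: rintD; [exact: rint_ltb|exact: rint_cst].
  - by move=> a _; have := step_poly_le (c - e_ j) m0 (W01 a) (ej j); rewrite opprD addrA.
have blo : q (e_ j + e_ j) - eta <= \int[Q]_a (step_poly m (c + e_ j)).[W a].
  rewrite -(probability_cst Q eta) -RintegralB//; [|exact: rint_ltb|exact: rint_cst].
  apply: le_Rintegral => //.
  - by apply: rintB; [exact: rint_ltb|exact: rint_cst].
  - by have [] := rint_horner Q (step_poly m (c + e_ j)) mW W01.
  - by move=> a _; have := step_poly_ge (c + e_ j) m0 (W01 a) (ej j); rewrite addrA.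
have nup n : \int[P]_a (c < Wn n a)%R%:R <= \int[P]_a (step_poly m (c - e_ j)).[Wn n a] + eta.
  rewrite -(probability_cst P eta) -RintegralD//; last exact: rint_cst.
  - apply: le_Rintegral => //.
    + exact: rint_ltb.
    + apply: rintD; last exact: rint_cst.
      by have [] := rint_horner P (step_poly m (c - e_ j)) (mWn n) (Wn01 n).
    + move=> a _; have := step_poly_ge (c - e_ j) m0 (Wn01 n a) (ej j).
      by rewrite subrK lerBlDr.
  - by have [] := rint_horner P (step_poly m (c - e_ j)) (mWn n) (Wn01 n).
have nlo n : \int[P]_a (step_poly m (c + e_ j)).[Wn n a] - eta <= \int[P]_a (c < Wn n a)%R%:R.
  rewrite -(probability_cst P eta) -RintegralB//; last exact: rint_cst.
  - apply: le_Rintegral => //.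
    + apply: rintB; last exact: rint_cst.
      by have [] := rint_horner P (step_poly m (c + e_ j)) (mWn n) (Wn01 n).
    + exact: rint_ltb.
    + move=> a _; have := step_poly_le (c + e_ j) m0 (Wn01 n a) (ej j).
      by rewrite addrK lerBlDr.
  - by have [] := rint_horner P (step_poly m (c + e_ j)) (mWn n) (Wn01 n).
near=> n.
have u1 : `|\int[Q]_a (step_poly m (c - e_ j)).[W a] - \int[P]_a (step_poly m (c - e_ j)).[Wn n a]| <= e / 4.
  near: n; move/cvgrPdist_le : up; exact.
have l1 : `|\int[Q]_a (step_poly m (c + e_ j)).[W a] - \int[P]_a (step_poly m (c + e_ j)).[Wn n a]| <= e / 4.
  near: n; move/cvgrPdist_le : lo; exact.
have := nup n; have := nlo n.
move: u1 l1 j1 j2 bup blo meta; rewrite !ler_norml.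
move=> /andP[a1 a2] /andP[b1 b2] /andP[f1 f2] /andP[g1 g2] h1 h2 h3 h4 h5.
by apply/andP; split; rewrite /=; lra.
Unshelve. all: by end_near. Qed.

End moment_method.

(** * The planar Gaussian law and the quantiles of a squared norm *)

Section gauss2.
Context (R : realType).

(** The standard normal law restated as a probability on [R] itself, so that its square is a
    probability on [R * R]. *)
Definition gauss1 : set R -> \bar R := normal_prob (0 : R) 1.

HB.instance Definition _ := @isMeasure.Build _ R R gauss1
  (measure0 (normal_prob (0 : R) 1)) (measure_ge0 (normal_prob (0 : R) 1))
  (@measure_semi_sigma_additive _ _ _ (normal_prob (0 : R) 1)).

HB.instance Definition _ := @Measure_isProbability.Build _ R R gauss1
  (probability_setT (normal_prob (0 : R) 1)).

Definition gauss2 : set (R * R) -> \bar R := (gauss1 \x gauss1)%E.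

HB.instance Definition _ := Measure.on gauss2.

Lemma gauss2_setT : gauss2 setT = 1%E.
Proof.
have g1 : gauss1 setT = 1%E := @probability_setT _ _ _ gauss1.
rewrite /gauss2 -setXTT product_measure1E//.
by rewrite [X in (X * _)%E]g1 [X in (_ * X)%E]g1 mule1.
Qed.

HB.instance Definition _ := Measure_isProbability.Build _ _ _ gauss2 gauss2_setT.

Lemma continuous_lin2 (x y : R) : measurable_fun setT (fun g : R * R => x * g.1 + y * g.2).
Proof. by apply: measurable_funD; apply: measurable_funM. Qed.

Lemma measurable_cosR : measurable_fun setT (@cos R).
Proof. by apply: continuous_measurable_fun; exact: continuous_cos. Qed.

Lemma measurable_expRR : measurable_fun setT (@expR R).
Proof. by apply: continuous_measurable_fun; exact: continuous_expR. Qed.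

Lemma gauss2_fubini (f : R * R -> R) (M : R) : measurable_fun setT f ->
  (forall z, `|f z| <= M) -> \int[gauss2]_z f z = \int[gauss1]_x \int[gauss1]_y f (x, y).
Proof.
move=> mf fM.
have I := @bounded_integrable_prod R _ _ _ _ gauss1 gauss1 f M mf fM.
rewrite {1}/Rintegral -(integral12_prod_meas1 I) [RHS]/Rintegral; congr fine.
apply: eq_integral => x _; rewrite fineK//.
apply: integrable_fin_num => //.
exact: (bounded_section1 gauss1 mf fM).
Qed.

Lemma gauss1_cos (t v : R) :
  \int[gauss1]_x cos (t * x + v) = cos v * expR (- (t ^+ 2 / 2)).
Proof.
have mid : measurable_fun setT (fun x : measurableTypeR R => x : R).
  by move=> _ A mA; rewrite setTI.
have mc : measurable_fun setT (fun x : R => (cos (t * x + v))%:E).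
  apply/measurable_EFinP; apply: (measurableT_comp measurable_cosR).
  by apply: measurable_funD => //; apply: measurable_funM.
rewrite -(integral_cos_normal v t) /Rintegral; congr fine.
transitivity (\int[pushforward (normal_prob (0 : R) 1) (fun x : measurableTypeR R => x : R)]_x
   (cos (t * x + v))%:E)%E.
  by apply: eq_measure_integral => A mA _.
rewrite integral_pushforward//.
apply: (@rint_bounded _ _ _ (normal_prob (0 : R) 1) _ 1) => [|x]; last exact: cos_max.
exact/measurable_EFinP.
Qed.

Lemma gauss2_cos (x y : R) :
  \int[gauss2]_g cos (x * g.1 + y * g.2) = expR (- ((x ^+ 2 + y ^+ 2) / 2)).
Proof.
rewrite (@gauss2_fubini _ 1); last by move=> z; exact: cos_max.
  under eq_Rintegral => g1 _.
    under eq_Rintegral do rewrite /= addrC.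
    rewrite gauss1_cos.
    over.
  have cc : rint gauss1 (fun g => cos (x * g)).
    apply: (@rint_bounded _ _ _ _ _ 1) => [|g]; last exact: cos_max.
    by apply: (measurableT_comp measurable_cosR); apply: measurable_funM.
  rewrite RintegralZr//.
  under eq_Rintegral do rewrite -[x * _]addr0.
  by rewrite gauss1_cos cos0 mul1r -expRD; congr expR; ring.
by apply: (measurableT_comp measurable_cosR); exact: continuous_lin2.
Qed.

Lemma gauss1_quadratic_null (a b s : R) : a != 0 ->
  gauss1 [set x : R | (a * x + b) ^+ 2 = s] = 0%E.
Proof.
move=> a0.
have sub : [set x : R | (a * x + b) ^+ 2 = s] `<=`
    [set (Num.sqrt s - b) / a] `|` [set (- Num.sqrt s - b) / a].
  move=> x /= E.
  have : `|a * x + b| = Num.sqrt s by rewrite -E sqrtr_sqr.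
  case: (ger0P (a * x + b)) => _ H; [left|right]; rewrite /= -H; field => //.
have null : gauss1 ([set (Num.sqrt s - b) / a] `|` [set (- Num.sqrt s - b) / a]) = 0%E.
  have dom := normal_prob_dominates (0 : R) 1.
  apply: (null_content_dominatesP _ _).1 dom _ _ _.
    by apply: measurableU; exact: measurable_set1.
  apply/eqP; rewrite -measure_le0; apply: (le_trans (measureU2 _ _ _)) => //.
  by rewrite [X in (X + _)%E](lebesgue_measure_set1 _) [X in (_ + X)%E](lebesgue_measure_set1 _) adde0.
apply: (subset_measure0 _ _ sub null).
- rewrite (_ : [set x : R | _] = setT `&` (fun x : R => (a * x + b) ^+ 2) @^-1` [set s]).
    by apply: measurable_funX => //; apply: measurable_funD => //; apply: measurable_funM.
  by rewrite setTI.
- by apply: measurableU; exact: measurable_set1.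
Qed.

Variables (a b c : R).

(** The squared norm of the image of [z] under a lower triangular matrix. By the Cholesky
    factorization every centred Gaussian vector of the plane is such an image of a standard one. *)
Definition gauss_norm2 (z : R * R) : R := (a * z.1) ^+ 2 + (b * z.1 + c * z.2) ^+ 2.

Lemma measurable_gauss_norm2 : measurable_fun setT gauss_norm2.
Proof.
apply: measurable_funD; apply: measurable_funX; first by apply: measurable_funM.
exact: continuous_lin2.
Qed.

Lemma gauss_norm2_ge0 z : 0 <= gauss_norm2 z.
Proof. by rewrite addr_ge0 ?sqr_ge0. Qed.

(** If [c] is nonzero, each section at fixed z.1 is the zero set of a nondegenerate quadratic in
    z.2. If c = 0, the squared norm is (a^2 + b^2) z.1^2, and the level set is a null set of the
    line times the line. *)
Lemma gauss_norm2_null s : [|| a != 0, b != 0 | c != 0] ->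
  gauss2 [set z | gauss_norm2 z = s] = 0%E.
Proof.
move=> abc.
have mS : measurable [set z | gauss_norm2 z = s].
  rewrite (_ : [set z | _] = setT `&` gauss_norm2 @^-1` [set s]).
    by apply: measurable_gauss_norm2.
  by rewrite setTI.
have [c0|c0] := eqVneq c 0; last first.
  transitivity (\int[gauss1]_x (gauss1 \o xsection [set z | gauss_norm2 z = s]) x)%E => //.
  apply: integral0_eq => x _ /=.
  rewrite (_ : xsection _ x = [set y : R | (c * y + b * x) ^+ 2 = s - (a * x) ^+ 2]).
    exact: gauss1_quadratic_null.
  apply/seteqP; split => y; rewrite /xsection /= inE /gauss_norm2 /=.
    by move=> <-; ring.
  by rewrite [c * y + _]addrC => ->; ring.
have k0 : Num.sqrt (a ^+ 2 + b ^+ 2) != 0.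
  rewrite gt_eqF// sqrtr_gt0 lt_neqAle eq_sym addr_ge0 ?sqr_ge0// andbT.
  rewrite paddr_eq0 ?sqr_ge0// !sqrf_eq0 negb_and.
  by move: abc; rewrite c0 eqxx orbF.
rewrite (_ : [set z | _] = [set x : R | (Num.sqrt (a ^+ 2 + b ^+ 2) * x + 0) ^+ 2 = s] `*` setT).
  have mA : measurable [set x : R | (Num.sqrt (a ^+ 2 + b ^+ 2) * x + 0) ^+ 2 = s].
    rewrite (_ : [set x : R | _] = setT `&` (fun x : R => (Num.sqrt (a ^+ 2 + b ^+ 2) * x + 0) ^+ 2) @^-1` [set s]).
      by apply: measurable_funX => //; apply: measurable_funD => //; apply: measurable_funM.
    by rewrite setTI.
  rewrite /gauss2 product_measure1E//.
  by rewrite [X in (X * _)%E](gauss1_quadratic_null _ _ k0) mul0e.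
have E z : gauss_norm2 z = (Num.sqrt (a ^+ 2 + b ^+ 2) * z.1 + 0) ^+ 2.
  rewrite addr0 exprMn sqr_sqrtr ?addr_ge0 ?sqr_ge0// /gauss_norm2 c0; ring.
by apply/seteqP; split => z /=; rewrite E //; case.
Qed.

(** Without atoms the distribution function [G] is continuous, so the supremum of the points where
    it does not exceed p attains the value p. That point is positive because [G] vanishes on
    nonpositive numbers. *)
Lemma gauss_norm2_quantile (p : R) : [|| a != 0, b != 0 | c != 0] -> 0 < p < 1 ->
  exists2 s, 0 < s & gauss2 [set z | gauss_norm2 z < s] = p%:E.
Proof.
move=> abc /andP[p0 p1].
pose G s := \int[gauss2]_z (gauss_norm2 z < s)%R%:R.
have mlt s : measurable_fun setT (fun z => (gauss_norm2 z < s)%R%:R : R).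
  by apply: measurable_ltb => //; exact: measurable_gauss_norm2.
have mle s : measurable_fun setT (fun z => (gauss_norm2 z <= s)%R%:R : R).
  by apply: measurable_leb => //; exact: measurable_gauss_norm2.
have Glt s : rint gauss2 (fun z => (gauss_norm2 z < s)%R%:R) by exact: rint_bool.
have Gmono s t : s <= t -> G s <= G t.
  move=> st; apply: le_Rintegral => //; try exact: Glt.
  move=> z _; rewrite ler_nat; case: ltP => // zs.
  by rewrite (lt_le_trans zs st).
have GE s : gauss2 [set z | gauss_norm2 z < s] = (G s)%:E.
  apply: probability_bool.
  rewrite (_ : [set z | _] = setT `&` gauss_norm2 @^-1` `]-oo, s[).
    exact: measurable_gauss_norm2.
  by rewrite setTI; apply/seteqP; split => z /=; rewrite in_itv.
have Gle s : \int[gauss2]_z (gauss_norm2 z <= s)%R%:R = G s.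
  have E z : (gauss_norm2 z <= s)%R%:R = (gauss_norm2 z < s)%R%:R + (gauss_norm2 z == s)%:R :> R.
    by rewrite le_eqVlt; case: ltgtP => _ /=; rewrite ?addr0 ?add0r.
  have mq : measurable [set z | gauss_norm2 z == s].
    rewrite (_ : [set z | _] = setT `&` gauss_norm2 @^-1` [set s]).
      by apply: measurable_gauss_norm2.
    by rewrite setTI; apply/seteqP; split => z /= /eqP.
  have mi : measurable_fun setT (fun z => (gauss_norm2 z == s)%:R : R).
    rewrite (_ : (fun z => _) = \1_[set z | gauss_norm2 z == s]).
      exact: measurable_indic.
    by apply/funext => x; rewrite indicE; congr (nat_of_bool _)%:R; apply/esym/asboolb.
  under eq_Rintegral do rewrite E.
  rewrite (RintegralD measurableT (Glt s) (rint_bool gauss2 mi)).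
  have := probability_bool gauss2 mq.
  rewrite (_ : [set z | gauss_norm2 z == s] = [set z | gauss_norm2 z = s]); last first.
    by apply/seteqP; split => z /= /eqP.
  move=> H; move: (etrans (esym H) (gauss_norm2_null s abc)) => -[->].
  by rewrite addr0.
pose e_ (j : nat) : R := j.+1%:R^-1.
have ej j : 0 < e_ j by rewrite invr_gt0.
have e0 : e_ @ \oo --> (0 : R) by exact: cvg_harmonic.
have left s : G (s - e_ j) @[j --> \oo] --> G s.
  apply: (rint_dominated_cvg (g := fun=> 1)) => //; last 2 first.
  - exact: rint_cst.
  - by move=> n x; exact: normb_le1.
  - move=> z; apply: cvg_near_cst.
    have [zs|sz] := ltP (gauss_norm2 z) s.
      have h : 0 < s - gauss_norm2 z by rewrite subr_gt0.
      near=> j; have -> // : gauss_norm2 z < s - e_ j.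
      suff : e_ j < s - gauss_norm2 z by lra.
      near: j; exact: (cvgr_lt _ e0).
    apply: nearW => j; have -> // : (gauss_norm2 z < s - e_ j) = false.
    by apply/negbTE; rewrite -leNgt; have := ej j; lra.
have right s : G (s + e_ j) @[j --> \oo] --> G s.
  rewrite -Gle.
  apply: (rint_dominated_cvg (g := fun=> 1)) => //; last 2 first.
  - exact: rint_cst.
  - by move=> n x; exact: normb_le1.
  - move=> z; apply: cvg_near_cst.
    have [zs|sz] := leP (gauss_norm2 z) s.
      by apply: nearW => j; have -> // : gauss_norm2 z < s + e_ j; have := ej j; lra.
    have h : 0 < gauss_norm2 z - s by rewrite subr_gt0.
    near=> j; have -> // : (gauss_norm2 z < s + e_ j) = false.
    apply/negbTE; rewrite -leNgt.
    suff : e_ j < gauss_norm2 z - s by lra.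
    near: j; exact: (cvgr_lt _ e0).
have top : G n%:R @[n --> \oo] --> (1 : R).
  rewrite -[X in _ --> X](@probability_cst _ _ _ gauss2).
  apply: (rint_dominated_cvg (g := fun=> 1)) => //; last 2 first.
  - exact: rint_cst.
  - by move=> n x; exact: normb_le1.
  - move=> z; apply: cvg_near_cst; near=> n.
    suff -> : gauss_norm2 z < n%:R by [].
    near: n; exists (Num.trunc (gauss_norm2 z)).+1 => // n /= zn.
    by rewrite (lt_le_trans (truncnS_gt _))// ler_nat.
have G0 s : s <= 0 -> G s = 0.
  move=> s0; rewrite /G -[RHS](@probability_cst _ _ _ gauss2 0).
  apply: eq_Rintegral => z _; suff -> : (gauss_norm2 z < s) = false by [].
  by apply/negbTE; rewrite -leNgt (le_trans s0)// gauss_norm2_ge0.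
pose S := [set s | G s <= p].
have S0 : S 0 by rewrite /S /= G0// ltW.
have Sub : has_ubound S.
  move/cvgrPdist_lt : top => /(_ (1 - p)); rewrite subr_gt0 => /(_ p1)[n _ /(_ n (leqnn n)) nP].
  exists n%:R => s /= Gs; rewrite leNgt; apply/negP => ns.
  have Gp : G s <= p := Gs.
  have := Gmono _ _ (ltW ns); move: nP; rewrite ltr_norml => /andP[_]; lra.
have hS : has_sup S by split => //; exists 0.
pose s := sup S.
have GS : G s = p.
  apply/eqP; rewrite eq_le; apply/andP; split.
    rewrite -(cvg_lim _ (left s))//; apply: limr_le.
      by apply/cvg_ex; exists (G s); exact: left.
    apply: nearW => j.
    have [t St ts] := sup_adherent (ej j) hS.
    by apply: (le_trans _ St); apply: Gmono; exact: ltW.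
  rewrite -[G s](cvg_lim _ (right s))//; apply: limr_ge.
    by apply/cvg_ex; exists (G s); exact: right.
  apply: nearW => j; rewrite leNgt; apply/negP => /ltW Gp.
  have := ub_le_sup Sub Gp; rewrite -/s; have := ej j; lra.
exists s; last by rewrite GE GS.
by rewrite ltNge; apply/negP => /G0; rewrite GS => p00; rewrite p00 ltxx in p0.
Unshelve. all: by end_near. Qed.

End gauss2.

(** * From characteristic functions to limits of probabilities of discs *)

Section limit_law.
Context d (T : measurableType d) (R : realType) (P : probability T R).
Variables (V1 V2 : nat -> T -> R) (A B C : R).
Hypothesis mV1 : forall n, measurable_fun setT (V1 n).
Hypothesis mV2 : forall n, measurable_fun setT (V2 n).
Let q (u v : R) : R := A * u ^+ 2 + 2 * B * u * v + C * v ^+ 2.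
Hypothesis q0 : forall u v, 0 <= q u v.
Hypothesis charV : forall u v : R,
  (\int[P]_a cos (u * V1 n a + v * V2 n a)) @[n --> \oo] --> expR (- (q u v / 2)).

(** The form [q] is only known to be nonnegative. When the pivot [A] is positive, completing the
    square leaves the Schur complement C - B^2/A; when A = 0, nonnegativity forces B = 0. *)
Let cholesky : exists a b c : R, forall u v, q u v = (a * u + b * v) ^+ 2 + (c * v) ^+ 2.
Proof.
have A0 : 0 <= A by have := q0 1 0; rewrite /q expr1n expr0n /= !mulr0 !addr0 mulr1.
have C0 : 0 <= C by have := q0 0 1; rewrite /q expr1n expr0n /= !mulr0 !mul0r !add0r mulr1.
have [Aeq|An] := eqVneq A 0.
  have B0 : B = 0.
    apply/eqP; apply: contraT => Bn.
    (* This point is chosen so that the form takes the value -1 there. *)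
    have := q0 (- (C + 1) / (2 * B)) 1; rewrite /q Aeq.
    have -> : 0 * (- (C + 1) / (2 * B)) ^+ 2 + 2 * B * (- (C + 1) / (2 * B)) * 1 + C * 1 ^+ 2 = -1.
      by field.
    by rewrite ler0N1.
  exists 0, 0, (Num.sqrt C) => u v.
  by rewrite exprMn sqr_sqrtr// /q Aeq B0; ring.
have Ap : 0 < A by rewrite lt_neqAle eq_sym An.
have D0 : 0 <= C - B ^+ 2 / A.
  have := q0 (- B / A) 1; rewrite /q.
  have -> // : A * (- B / A) ^+ 2 + 2 * B * (- B / A) * 1 + C * 1 ^+ 2 = C - B ^+ 2 / A.
  by field.
have s2 : Num.sqrt A ^+ 2 = A by rewrite sqr_sqrtr.
have sn : Num.sqrt A != 0 by rewrite gt_eqF// sqrtr_gt0.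
exists (Num.sqrt A), (B / Num.sqrt A), (Num.sqrt (C - B ^+ 2 / A)) => u v.
rewrite [in X in _ = _ + X]exprMn sqr_sqrtr// /q -{1}s2.
have -> : B ^+ 2 / A = B ^+ 2 / Num.sqrt A ^+ 2 by rewrite s2.
by field.
Qed.

Let W n a : R := expR (- ((V1 n a ^+ 2 + V2 n a ^+ 2) / 2)).

(* exp(-k |V|^2 / 2) is a Gaussian average of the cosines whose expectations are the
   characteristic function of V, so the moments of exp(-|V|^2 / 2) converge. *)
Lemma limit_quantile :
  ~ (forall s : R, 0 < s -> P [set a | V1 n a ^+ 2 + V2 n a ^+ 2 < s] @[n --> \oo] --> 1%E) ->
  forall p : R, 0 < p < 1 -> exists2 s : R, 0 < s &
    P [set a | V1 n a ^+ 2 + V2 n a ^+ 2 < s] @[n --> \oo] --> p%:E.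
Proof.
have [a [b [c qE]]] := cholesky.
pose Z := gauss_norm2 a b c.
pose WZ z := expR (- (Z z / 2)).
have mZ : measurable_fun setT Z by exact: measurable_gauss_norm2.
have mWZ : measurable_fun setT WZ.
  apply: (measurableT_comp (@measurable_expRR R)); apply: measurableT_comp => //.
  by apply: measurable_funM.
have mN n : measurable_fun setT (fun t => V1 n t ^+ 2 + V2 n t ^+ 2).
  by apply: measurable_funD; exact: measurable_funX.
have mW n : measurable_fun setT (W n).
  apply: (measurableT_comp (@measurable_expRR R)); apply: measurableT_comp => //.
  by apply: measurable_funM.
have exp01 (x : R) : 0 <= x -> 0 <= expR (- (x / 2)) <= 1.
  by move=> x0; rewrite expR_ge0 /= -expR0 ler_expR oppr_le0 divr_ge0.
have W01 n t : 0 <= W n t <= 1 by apply: exp01; rewrite addr_ge0 ?sqr_ge0.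
have WZ01 z : 0 <= WZ z <= 1 by apply: exp01; exact: gauss_norm2_ge0.
have sqk k : Num.sqrt k%:R ^+ 2 = k%:R :> R by rewrite sqr_sqrtr.
have bcos d' (Y : measurableType d') (f : Y -> R) : measurable_fun setT f ->
    measurable_fun setT (fun y => cos (f y)).
  by move=> mf; exact: (measurableT_comp (@measurable_cosR R)).
have mom (k : nat) : (\int[P]_t (W n t ^+ k)) @[n --> \oo] --> \int[@gauss2 R]_z (WZ z ^+ k).
  pose r : R := Num.sqrt k%:R.
  have E1 n : \int[P]_t (W n t ^+ k) =
      \int[@gauss2 R]_g \int[P]_t cos (r * g.1 * V1 n t + r * g.2 * V2 n t).
    rewrite -(@Rintegral_swap R _ _ _ _ P (@gauss2 R)
      (fun z => cos (r * z.2.1 * V1 n z.1 + r * z.2.2 * V2 n z.1)) 1) /=; last 2 first.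
    - apply: bcos; apply: measurable_funD; apply: measurable_funM => //;
        try (by apply: measurableT_comp => //).
      + by apply: measurable_funM => //; apply: measurableT_comp => //.
      + by apply: measurable_funM => //; apply: measurableT_comp => //.
    - by move=> z; exact: cos_max.
    apply: eq_Rintegral => t _.
    under [RHS]eq_Rintegral do rewrite -!mulrA ![_.1 * _]mulrC ![_.2 * _]mulrC !mulrA.
    rewrite gauss2_cos /W -expRM_natl; congr expR; rewrite !exprMn sqk; ring.
  have E2 : \int[@gauss2 R]_z (WZ z ^+ k) = \int[@gauss2 R]_g expR (- (q (r * g.1) (r * g.2) / 2)).
    transitivity (\int[@gauss2 R]_z \int[@gauss2 R]_g
        cos (r * g.1 * (a * z.1) + r * g.2 * (b * z.1 + c * z.2))).
      apply: eq_Rintegral => z _.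
      under [RHS]eq_Rintegral do rewrite -!mulrA ![_.1 * _]mulrC ![_.2 * _]mulrC !mulrA.
      under [RHS]eq_Rintegral => g _.
        rewrite (_ : cos _ = cos (r * (a * z.1) * g.1 + r * (b * z.1 + c * z.2) * g.2)); last first.
          by congr cos; ring.
        over.
      rewrite gauss2_cos /WZ -expRM_natl; congr expR; rewrite /Z /gauss_norm2 !exprMn sqk; ring.
    rewrite (@Rintegral_swap R _ _ _ _ (@gauss2 R) (@gauss2 R)
      (fun z => cos (r * z.2.1 * (a * z.1.1) + r * z.2.2 * (b * z.1.1 + c * z.1.2))) 1) /=; last 2 first.
    - apply: bcos.
      have m11 : measurable_fun setT (fun z : (R * R) * (R * R) => z.1.1) by apply: measurableT_comp.
      have m12 : measurable_fun setT (fun z : (R * R) * (R * R) => z.1.2) by apply: measurableT_comp.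
      have m21 : measurable_fun setT (fun z : (R * R) * (R * R) => z.2.1) by apply: measurableT_comp.
      have m22 : measurable_fun setT (fun z : (R * R) * (R * R) => z.2.2) by apply: measurableT_comp.
      apply: measurable_funD; apply: measurable_funM; try by apply: measurable_funM.
      by apply: measurable_funD; apply: measurable_funM.
    - by move=> z; exact: cos_max.
    apply: eq_Rintegral => g _.
    under eq_Rintegral => z _.
      rewrite (_ : cos _ = cos ((a * (r * g.1) + b * (r * g.2)) * z.1 + (c * (r * g.2)) * z.2)); last first.
        by congr cos; ring.
      over.
    by rewrite gauss2_cos qE.
  rewrite E2; under eq_fun do rewrite E1.
  apply: (rint_dominated_cvg (g := fun=> 1)) => //; last 2 first.
  - exact: rint_cst.
  - move=> n g; apply: probability_bound => [|t]; last exact: cos_max.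
    by apply: bcos; apply: measurable_funD; apply: measurable_funM.
  - move=> n.
    apply: (@Rintegral_prod1 R _ _ _ _ (@gauss2 R) P
      (fun z => cos (r * z.1.1 * V1 n z.2 + r * z.1.2 * V2 n z.2)) 1) => [|z]; last exact: cos_max.
    apply: bcos; apply: measurable_funD; apply: measurable_funM;
      try (by apply: measurableT_comp => //).
    + by apply: measurable_funM => //; apply: measurableT_comp => //.
    + by apply: measurable_funM => //; apply: measurableT_comp => //.
have NW s n : [set t | V1 n t ^+ 2 + V2 n t ^+ 2 < s] = [set t | expR (- (s / 2)) < W n t].
  by apply/seteqP; split => t /=; rewrite /W ltr_expR ltrN2 ltr_pM2r ?invr_gt0.
have ZW s : [set z | Z z < s] = [set z | expR (- (s / 2)) < WZ z].
  by apply/seteqP; split => t /=; rewrite /WZ ltr_expR ltrN2 ltr_pM2r ?invr_gt0.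
have ZWe s : [set z | WZ z = expR (- (s / 2))] = [set z | Z z = s].
  apply/seteqP; split => z /=; rewrite /WZ; last by move=> ->.
  by move=> /expR_inj /oppr_inj /mulIf -> //.
have tail s : @gauss2 R [set z | Z z = s] = 0%E ->
    P [set t | V1 n t ^+ 2 + V2 n t ^+ 2 < s] @[n --> \oo] --> @gauss2 R [set z | Z z < s].
  move=> Zs; under eq_fun do rewrite NW.
  by rewrite ZW; apply: (tail_cvg mW mWZ W01 WZ01 mom); rewrite ZWe.
move=> nondeg p p01.
have [abc|abc] := boolP [|| a != 0, b != 0 | c != 0].
  have [s s0 sp] := gauss_norm2_quantile abc p01.
  by exists s => //; rewrite -sp; apply: tail; exact: gauss_norm2_null.
(* If a, b and c all vanish, the limit law is the point mass at 0, and every disc then has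
   probability tending to 1, which the hypothesis excludes. *)
exfalso; apply: nondeg => s s0.
move: abc; rewrite !negb_or !negbK => /and3P[/eqP a0 /eqP b0 /eqP c0].
have Z0 z : Z z = 0 by rewrite /Z /gauss_norm2 a0 b0 c0; ring.
have -> : 1%E = @gauss2 R [set z | Z z < s].
  rewrite (_ : [set z | Z z < s] = setT); last first.
    by apply/seteqP; split => // z _ /=; rewrite Z0.
  by rewrite gauss2_setT.
apply: tail; rewrite (_ : [set z | Z z = s] = set0) ?measure0//.
by apply/seteqP; split => // z /=; rewrite Z0 => s00; rewrite -s00 ltxx in s0.
Qed.

End limit_law.

Section trigonometric_bounds.
Context (R : realType).

Lemma cos_lip (x y : R) : `|cos x - cos y| <= `|x - y|.
Proof.
wlog yx : x y / y <= x.
  move=> H; have [/H//|/ltW xy] := leP y x.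
  by rewrite distrC [leRHS]distrC; exact: H.
rewrite [leRHS]ger0_norm ?subr_ge0// -[leRHS]mul1r.
apply: (@derive_bound R cos (fun t => - sin t) 1 y x yx (@continuous_cos R)).
  by move=> t _; exact: isd_cos.
by move=> t _; rewrite normrN sin_max.
Qed.

Lemma sin_lip (x y : R) : `|sin x - sin y| <= `|x - y|.
Proof.
wlog yx : x y / y <= x.
  move=> H; have [/H//|/ltW xy] := leP y x.
  by rewrite distrC [leRHS]distrC; exact: H.
rewrite [leRHS]ger0_norm ?subr_ge0// -[leRHS]mul1r.
apply: (@derive_bound R sin cos 1 y x yx (@continuous_sin R)).
  by move=> t _; exact: isd_sin.
by move=> t _; rewrite cos_max.
Qed.

End trigonometric_bounds.

Section clt_quantile.
Context d d' (T : measurableType d) (T' : measurableType d') (R : realType).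
Variables (P : probability T R) (h : probability T' R).
Variable X : nat -> {RV P >-> T'}.
Hypothesis iX : mutually_independent X.
Hypothesis dX : identically_distributed X h.
Variables (F1 F2 : T' -> R).
Hypotheses (mF1 : measurable_fun setT F1) (mF2 : measurable_fun setT F2).
Hypotheses (IF1 : rint h (fun x => F1 x ^+ 2)) (IF2 : rint h (fun x => F2 x ^+ 2)).
Hypotheses (F1c : \int[h]_x F1 x = 0) (F2c : \int[h]_x F2 x = 0).
Variables (V1 V2 : nat -> T -> R).
Hypotheses (mV1 : forall n, measurable_fun setT (V1 n)).
Hypotheses (mV2 : forall n, measurable_fun setT (V2 n)).
Let S (F : T' -> R) (n : nat) (a : T) : R := (Num.sqrt n.+1%:R)^-1 * \sum_(j < n.+1) F (X j a).
Variable c : nat -> R.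
Hypothesis c0 : c @ \oo --> (0 : R).
Hypothesis V1S : forall n, (\int[P]_a (`|V1 n a - S F1 n a|)%:E <= (c n)%:E)%E.
Hypothesis V2S : forall n, (\int[P]_a (`|V2 n a - S F2 n a|)%:E <= (c n)%:E)%E.

Let mS (F : T' -> R) n : measurable_fun setT F -> measurable_fun setT (S F n).
Proof.
move=> mF; apply: measurable_funM => //; apply: measurable_sum => j.
by apply: measurableT_comp.
Qed.

Let I12 : rint h (fun x => F1 x * F2 x).
Proof.
apply: (@rint_le _ _ _ _ _ (fun x => F1 x ^+ 2 + F2 x ^+ 2)) => [|x|].
- exact: measurable_funM.
- rewrite normrM -[F1 x ^+ 2]real_normK ?num_real// -[F2 x ^+ 2]real_normK ?num_real//.
  have H1 : 0 <= (`|F1 x| - `|F2 x|) ^+ 2 by exact: sqr_ge0.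
  have H2 : 0 <= (`|F1 x| + `|F2 x|) ^+ 2 by exact: sqr_ge0.
  by nra.
- exact: rintD.
Qed.

Let rint1 (F : T' -> R) : measurable_fun setT F -> rint h (fun x => F x ^+ 2) -> rint h F.
Proof.
move=> mF IF; have := @rint_exp _ _ _ h F 1 2 isT mF.
rewrite (_ : (fun x => F x ^+ 1) = F); last by apply/funext => x; rewrite expr1.
by apply; apply: rint_eq IF => x; rewrite real_normK ?num_real.
Qed.

(** The Cramer-Wold device: u F1 + v F2 is again a centred square-integrable function, to which the
    one-dimensional theorem applies. The L^1 error between [V1], [V2] and the normalized sums is
    harmless because the cosine is 1-Lipschitz. *)
Let charV (u v : R) : (\int[P]_a cos (u * V1 n a + v * V2 n a)) @[n --> \oo] -->
  expR (- ((\int[h]_x (F1 x ^+ 2) * u ^+ 2 + 2 * (\int[h]_x (F1 x * F2 x)) * u * v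
     + \int[h]_x (F2 x ^+ 2) * v ^+ 2) / 2)).
Proof.
pose f x := u * F1 x + v * F2 x.
have mf : measurable_fun setT f by apply: measurable_funD; apply: measurable_funM.
have J1 := rintZ (u ^+ 2) IF1.
have J2 := rintZ (2 * u * v) I12.
have J3 := rintZ (v ^+ 2) IF2.
have fE x : u ^+ 2 * F1 x ^+ 2 + 2 * u * v * (F1 x * F2 x) + v ^+ 2 * F2 x ^+ 2 = f x ^+ 2.
  by rewrite /f; ring.
have If : rint h (fun x => f x ^+ 2).
  by apply: (rint_eq fE); apply: rintD => //; exact: rintD.
have f0 : \int[h]_x f x = 0.
  have K1 := rintZ u (rint1 mF1 IF1); have K2 := rintZ v (rint1 mF2 IF2).
  rewrite /f RintegralD// !RintegralZl//; [|exact: rint1|exact: rint1].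
  by rewrite F1c F2c !mulr0 addr0.
have fv : \int[h]_x (f x ^+ 2) = \int[h]_x (F1 x ^+ 2) * u ^+ 2 +
    2 * (\int[h]_x (F1 x * F2 x)) * u * v + \int[h]_x (F2 x ^+ 2) * v ^+ 2.
  rewrite -(eq_Rintegral _ (fun x _ => fE x)) RintegralD//; last exact: rintD.
  by rewrite RintegralD// !RintegralZl//; ring.
rewrite -fv.
have lim := cos_clt iX dX mf If f0.
apply: cvg_sub0 lim.
have cle : (fun n => (`|u| + `|v|) * c n) @ \oo --> (0 : R).
  by rewrite -[X in _ --> X](mulr0 (`|u| + `|v|)); apply: cvgM => //; exact: cvg_cst.
apply: norm_cvg0; apply: squeeze_cvgr cle; last exact: cvg_cst.
near=> n; rewrite normr_ge0 /=.
have Slin a : (Num.sqrt n.+1%:R)^-1 * (\sum_(j < n.+1) f (X j a)) = u * S F1 n a + v * S F2 n a.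
  rewrite /S /f big_split /= -!mulr_sumr; ring.
have mc1 : measurable_fun setT (fun a => cos (u * V1 n a + v * V2 n a)).
  apply: measurableT_comp; first exact: measurable_cosR.
  by apply: measurable_funD; apply: measurable_funM.
have mc2 : measurable_fun setT (fun a => cos ((Num.sqrt n.+1%:R)^-1 * (\sum_(j < n.+1) f (X j a)))).
  apply: measurableT_comp; first exact: measurable_cosR.
  by apply: (mS n mf).
rewrite (_ : (_ - _) n = \int[P]_a cos (u * V1 n a + v * V2 n a) -
  \int[P]_a cos ((Num.sqrt n.+1%:R)^-1 * (\sum_(j < n.+1) f (X j a))))//.
rewrite -RintegralB//; last 2 first.
- by apply: (@rint_bounded _ _ _ _ _ 1) => // a; rewrite cos_max.
- by apply: (@rint_bounded _ _ _ _ _ 1) => // a; rewrite cos_max.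
have mD : measurable_fun setT (fun a => cos (u * V1 n a + v * V2 n a) -
    cos ((Num.sqrt n.+1%:R)^-1 * (\sum_(j < n.+1) f (X j a)))) by exact: measurable_funB.
have ID : rint P (fun a => cos (u * V1 n a + v * V2 n a) -
    cos ((Num.sqrt n.+1%:R)^-1 * (\sum_(j < n.+1) f (X j a)))).
  apply: (@rint_bounded _ _ _ _ _ 2) => // a.
  by rewrite (le_trans (ler_normB _ _))// -[2]/(1 + 1) lerD ?cos_max.
rewrite (le_trans (le_normr_Rintegral _ ID))//.
rewrite -lee_fin Rintegral_EFin; last exact: rint_abs.
have mN (V : nat -> T -> R) (F : T' -> R) : measurable_fun setT (V n) -> measurable_fun setT F ->
    measurable_fun setT (fun a => (`|V n a - S F n a|)%:E).
  move=> mV mF; apply/measurable_EFinP; apply: measurableT_comp => //.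
  by apply: measurable_funB => //; exact: mS.
apply: (@le_trans _ _ (\int[P]_a (`|u|%:E * (`|V1 n a - S F1 n a|)%:E +
    `|v|%:E * (`|V2 n a - S F2 n a|)%:E))%E).
  apply: ge0_le_integral => //.
  - by apply/measurable_EFinP; apply: measurableT_comp.
  - by apply: emeasurable_funD; apply: measurable_funeM; exact: mN.
  move=> a _; rewrite -!EFinM -EFinD lee_fin Slin (le_trans (cos_lip _ _))//.
  rewrite (_ : _ - _ = u * (V1 n a - S F1 n a) + v * (V2 n a - S F2 n a)); last by ring.
  by rewrite (le_trans (ler_normD _ _))// !normrM.
rewrite ge0_integralD//; [|by apply: measurable_funeM; exact: mN|by apply: measurable_funeM; exact: mN].
rewrite !ge0_integralZl//; try exact: mN.
rewrite mulrDl EFinD !EFinM leeD//; apply: lee_wpmul2l => //; exact: lee_fin.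
Unshelve. all: by end_near. Qed.

Lemma clt_quantile :
  ~ (forall s : R, 0 < s ->
      P [set a | V1 n a ^+ 2 + V2 n a ^+ 2 < s] @[n --> \oo] --> 1%E) ->
  forall p : R, 0 < p < 1 -> exists2 s : R, 0 < s &
    P [set a | V1 n a ^+ 2 + V2 n a ^+ 2 < s] @[n --> \oo] --> p%:E.
Proof.
apply: (limit_quantile mV1 mV2 _ charV) => u v.
have fE x : u ^+ 2 * F1 x ^+ 2 + 2 * u * v * (F1 x * F2 x) + v ^+ 2 * F2 x ^+ 2 =
    (u * F1 x + v * F2 x) ^+ 2 by ring.
have J1 := rintZ (u ^+ 2) IF1.
have J2 := rintZ (2 * u * v) I12.
have J3 := rintZ (v ^+ 2) IF2.
rewrite (_ : _ + _ = \int[h]_x (u * F1 x + v * F2 x) ^+ 2).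
  by apply: Rintegral_ge0 => x _; exact: sqr_ge0.
rewrite -(eq_Rintegral _ (fun x _ => fE x)) RintegralD//; last exact: rintD.
by rewrite RintegralD// !RintegralZl//; ring.
Qed.

End clt_quantile.

(** * The adjoint Volterra equation *)

Section weighted_fixpoint.
Context (R : realType) d (X : measurableType d) (m : {finite_measure set X -> \bar R}).
Variables (k : X * X -> R) (M : R) (psi alpha : X -> R) (A B : R).
Hypothesis mk : measurable_fun setT k.
Hypothesis kM : forall z, `|k z| <= M.
Hypothesis mpsi : measurable_fun setT psi.
Hypothesis psi0 : forall x, 0 <= psi x.
Hypothesis psiB : forall x, psi x <= B.
Hypothesis kpsi : forall s, \int[m]_u (psi u * `|k (u, s)|) <= psi s / 2.
Hypothesis malpha : measurable_fun setT alpha.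
Hypothesis A0 : 0 <= A.
Hypothesis alphaA : forall x, `|alpha x| <= A * psi x.

Let T (w : X -> R) (s : X) := \int[m]_u (w u * k (u, s)).

Let mprod (w : X -> R) : measurable_fun setT w ->
  measurable_fun setT (fun z : X * X => w z.1 * k z).
Proof. by move=> mw; apply: measurable_funM => //; apply: measurableT_comp. Qed.

Let bprod (w : X -> R) (C : R) : 0 <= C -> (forall x, `|w x| <= C * psi x) ->
  forall z, `|w z.1 * k z| <= C * B * M.
Proof.
move=> C0 wC z; rewrite normrM ler_pM// (le_trans (wC _))// ler_wpM2l//.
Qed.

Let mk1 s : measurable_fun setT (fun u => k (u, s)).
Proof. by apply: measurableT_comp => //; exact: measurable_pair2. Qed.

Let mT (w : X -> R) (C : R) : 0 <= C -> measurable_fun setT w ->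
  (forall x, `|w x| <= C * psi x) -> measurable_fun setT (T w).
Proof.
move=> C0 mw wC.
exact: (@Rintegral_prod2 R _ _ _ _ m m _ _ (mprod mw) (bprod C0 wC)).
Qed.

Let IT (w : X -> R) (C : R) s : 0 <= C -> measurable_fun setT w ->
  (forall x, `|w x| <= C * psi x) -> rint m (fun u => w u * k (u, s)).
Proof.
move=> C0 mw wC; apply: (@bounded_integrable _ _ _ _ _ (C * B * M)) => [|u].
  exact: measurable_funM.
exact: (bprod C0 wC (u, s)).
Qed.

Let bT (w : X -> R) (C : R) s : 0 <= C -> measurable_fun setT w ->
  (forall x, `|w x| <= C * psi x) -> `|T w s| <= C / 2 * psi s.
Proof.
move=> C0 mw wC.
apply: (@le_trans _ _ (\int[m]_u (C * (psi u * `|k (u, s)|)))).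
  apply: normr_Rintegral_le => [||u]; first exact: IT wC.
    apply: (@bounded_integrable _ _ _ _ _ (C * B * M)) => [|u].
      by apply: measurable_funM => //; apply: measurable_funM => //; apply: measurableT_comp.
    rewrite -mulrA normrM (ger0_norm C0) ler_wpM2l// normrM normr_id ler_pM//.
    by rewrite ger0_norm.
  by rewrite normrM mulrA ler_wpM2r.
rewrite RintegralZl//; last first.
  apply: (@bounded_integrable _ _ _ _ _ (B * M)) => [|u].
    by apply: measurable_funM => //; apply: measurableT_comp.
  by rewrite normrM normr_id ler_pM// ger0_norm.
by rewrite -mulrA ler_wpM2l// mulrC kpsi.
Qed.

Let w : nat -> X -> R := fix w n :=
  if n is n'.+1 then (fun s => alpha s + T (w n') s) else alpha.

Let wP n : measurable_fun setT (w n) /\ forall x, `|w n x| <= 2 * A * psi x.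
Proof.
elim: n => [|n [mw bw]] /=.
  split=> // x; rewrite (le_trans (alphaA x))// ler_wpM2r// ler_peMl// ler1n//.
split; first by apply: measurable_funD => //; apply: mT bw => //; exact: mulr_ge0.
move=> x; rewrite (le_trans (ler_normD _ _))//.
have := @bT _ _ x _ mw bw; rewrite mulr_ge0// => /(_ isT).
rewrite (_ : 2 * A / 2 = A); last by field.
by have := alphaA x; lra.
Qed.

Let wD n x : `|w n.+1 x - w n x| <= A / 2 ^+ n * psi x.
Proof.
elim: n x => [|n IH] x.
  rewrite /= addrC addKr expr0 divr1.
  have := @bT _ _ x A0 malpha alphaA; have := psi0 x.
  by move=> p0 /le_trans; apply; rewrite ler_wpM2r// ler_pdivrMr// ler_peMr// ler1n//.
have [m1 b1] := wP n; have [m2 b2] := wP n.+1.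
have A20 : 0 <= 2 * A by rewrite mulr_ge0.
rewrite [w n.+2 x]/= [X in _ - X]/= opprD addrACA subrr add0r /T.
rewrite -RintegralB//; [|exact: (IT _ A20 m2 b2)|exact: (IT _ A20 m1 b1)].
have -> : \int[m]_u (w n.+1 u * k (u, x) - w n u * k (u, x)) = T (fun u => w n.+1 u - w n u) x.
  by apply: eq_Rintegral => u _; rewrite mulrBl.
apply: le_trans (bT x _ _ IH) _.
- by rewrite divr_ge0// exprn_ge0.
- exact: measurable_funB.
by rewrite exprSr invfM mulrA.
Qed.

Let w_cvg x : cvgn (w ^~ x).
Proof.
have -> : w ^~ x = fun n => w 0%N x + series (fun n => w n.+1 x - w n x) n.
  apply/funext => n; rewrite /series /= telescope_sumr//.
  by rewrite addrC subrK.
apply: is_cvgD; first exact: is_cvg_cst.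
apply: normed_cvg.
apply: (@series_le_cvg _ _ (fun n => A * psi x * (2^-1) ^+ n)) => [n|n|n|].
- exact: normr_ge0.
- by rewrite mulr_ge0 ?mulr_ge0// exprn_ge0.
- by rewrite (le_trans (wD n x))// exprVn mulrAC.
- apply: (@is_cvg_geometric_series _ (A * psi x) (2^-1)).
  by rewrite ger0_norm// invf_lt1// ltr1n.
Qed.

(* In the norm weighted by [psi] the integral operator is a contraction of ratio 1/2. *)
Lemma weighted_fixpoint : exists W : X -> R,
  [/\ measurable_fun setT W, forall x, `|W x| <= 2 * A * psi x &
      forall s, W s = alpha s + \int[m]_u (W u * k (u, s))].
Proof.
pose W x := limn (w ^~ x).
have wW x : w ^~ x @ \oo --> W x by exact: w_cvg.
have mW : measurable_fun setT W.
  by apply: (measurable_fun_cvg (h := w)) => [n|x _]; [exact: (wP n).1|exact: wW].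
have bW x : `|W x| <= 2 * A * psi x.
  by apply: cvgr_to_le (cvg_norm (wW x)) _; near=> n; exact: (wP n).2.
exists W; split=> // s.
have A20 : 0 <= 2 * A by rewrite mulr_ge0.
have lim : (\int[m]_u (w n u * k (u, s))) @[n --> \oo] --> \int[m]_u (W u * k (u, s)).
  apply: (@rint_dominated_cvg _ _ _ _ (fun n u => w n u * k (u, s)) _ (fun=> 2 * A * B * M)).
  - by move=> n; apply: measurable_funM => //; exact: (wP n).1.
  - by move=> u; apply: cvgM => //; exact: cvg_cst.
  - by apply: (@bounded_integrable _ _ _ _ _ (`|2 * A * B * M|)).
  - move=> n u; exact: (bprod A20 (wP n).2 (u, s)).
have l2 : w n.+1 s @[n --> \oo] --> alpha s + \int[m]_u (W u * k (u, s)).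
  by apply: cvgD => //; exact: cvg_cst.
have l1 : w n.+1 s @[n --> \oo] --> W s by rewrite (cvg_shiftS (w ^~ s)).
exact: (cvg_unique _ l1 l2).
Unshelve. all: by end_near. Qed.

End weighted_fixpoint.

Section two_component_time.
Context (R : realType).

Definition component (b : bool) (s : measurableTypeR R) : bool * measurableTypeR R := (b, s).

Lemma measurable_component b : measurable_fun setT (component b).
Proof. by apply: measurable_fun_pair; [exact: measurable_cst|exact: measurable_id]. Qed.

HB.instance Definition _ b :=
  isMeasurableFun.Build _ _ _ _ (component b) (measurable_component b).

(* Lebesgue measure on two copies of [0, T]. *)
Definition lam2 (T : R) : set (bool * measurableTypeR R) -> \bar R.
refine (measure_add (pushforward (lam T) (component true)) (pushforward (lam T) (component false))).
all: exact: measurable_component.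
Defined.

HB.instance Definition _ (T : R) := Measure.on (lam2 T).

Lemma lam2_fin (T : R) : fin_num_fun (lam2 T).
Proof.
move=> A mA; rewrite /lam2 measure_addE /pushforward fin_numD.
by rewrite !fin_num_measure//; rewrite -[X in measurable X]setTI; exact: measurable_component.
Qed.

HB.instance Definition _ (T : R) := Measure_isFinite.Build _ _ _ (lam2 T) (lam2_fin T).

Lemma measurable_section2 (f : bool * measurableTypeR R -> R) b :
  measurable_fun setT f -> measurable_fun setT (fun s : measurableTypeR R => f (b, s)).
Proof. by move=> mf; apply: (measurableT_comp mf (measurable_component b)). Qed.

Lemma Rintegral_lam2 (T : R) (f : bool * measurableTypeR R -> R) (M : R) :
  measurable_fun setT f -> (forall x, `|f x| <= M) ->
  \int[lam2 T]_x f x = \int[lam T]_s f (true, s) + \int[lam T]_s f (false, s).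
Proof.
move=> mf fM; rewrite {1}/Rintegral /lam2.
have I b : (lam T).-integrable setT (EFin \o (fun s => f (b, s))).
  by apply: bounded_integrable => [|s]; [exact: measurable_section2|exact: fM].
have mE : measurable_fun setT (EFin \o f) by exact/measurable_EFinP.
have J b : (pushforward (lam T) (component b)).-integrable setT (EFin \o f).
  by apply: integrable_pushforward => //; exact: I.
rewrite integral_measure_add//; [|exact: J|exact: J].
rewrite !integral_pushforward//; [|exact: I|exact: I].
rewrite preimage_setT fineD//.
- exact: (integrable_fin_num measurableT (I true)).
- exact: (integrable_fin_num measurableT (I false)).
Qed.

(** Made constant for negative times so as to be bounded by 1 on the whole line, although only
    [0, T] carries mass. *)
Let wt (L u : R) := expR (- L * Num.max u 0).

Let cont_wt L : continuous (wt L).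
Proof.
apply: (@cont_comp _ (fun u => Num.max u 0) (fun y => expR (- L * y))).
  by move=> x; apply: continuous_max; [exact: cvg_id|exact: cvg_cst].
exact: cont_expR_lin.
Qed.

Let wt_le1 L u : 0 <= L -> `|wt L u| <= 1.
Proof.
move=> L0; rewrite ger0_norm ?expR_ge0// -expR0 ler_expR mulNr oppr_le0.
by rewrite mulr_ge0// le_max lexx orbT.
Qed.

Let prim_wt L t : 0 < L -> 0 <= t -> prim (wt L) t = (1 - expR (- L * t)) / L.
Proof.
move=> L0 t0.
have := @derive_bound _ (fun t => prim (wt L) t - (1 - expR (- L * t)) / L) (fun=> 0) 0 0 t t0.
rewrite mul0r prim0// mulr0 expR0 subrr mul0r subrr subr0 => H.
suff : `|prim (wt L) t - (1 - expR (- L * t)) / L| <= 0.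
  by rewrite normr_le0 subr_eq0 => /eqP.
apply: H => [|s /andP[s0 st]|s st]; last by rewrite normr0.
  apply: contB; first exact: prim_continuous.
  apply: contM; last exact: cont_cst.
  by apply: contB; [exact: cont_cst|exact: cont_expR_lin].
apply: isd_eq.
  apply: isdB; first exact: prim_derive.
  apply: isdM; last exact: isd_cst.
  by apply: isdB; [exact: isd_cst|exact: isd_expR_lin].
rewrite /wt (max_idPl _) ?(ltW s0)//=.
by field; exact: lt0r_neq0.
Qed.

Let mwt L : measurable_fun setT (wt L : measurableTypeR R -> R).
Proof. exact: continuous_measurable_R. Qed.

(** The times u >= s are enclosed in those with u > s - 1/L, whose integral is the difference of two
    values of the primitive. This enlargement costs the factor [expR 1] and avoids a discussion of
    the endpoint. For s <= 1/L the full integral, at most 1/L, is small enough. *)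
Lemma exp_weight (T L s : R) : 0 < L -> 0 <= T ->
  \int[lam T]_u ((s <= u)%R%:R * wt L u) <= expR 1 / L * wt L s.
Proof.
move=> L0 T0.
have mI (F : measurableTypeR R -> bool) : measurable_fun setT (fun u => (F u)%:R : R) ->
    rint (lam T) (fun u => (F u)%:R * wt L u).
  move=> mF; apply: (@bounded_integrable _ _ _ _ _ 1) => [|u]; first exact: measurable_funM.
  rewrite normrM -[leRHS]mulr1 ler_pM// ?wt_le1 ?(ltW L0)//.
  by case: (F u); rewrite ?normr1 ?normr0.
have Iw : rint (lam T) (wt L).
  apply: (@bounded_integrable _ _ _ _ _ 1) => // u; exact: wt_le1 (ltW L0).
have I1 : rint (lam T) (fun u => (s <= u)%R%:R * wt L u).
  by apply: mI; apply: (@measurable_leb _ _ _ (fun=> s) id).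
have primT : \int[lam T]_u wt L u = prim (wt L) T.
  rewrite (@prim_lam _ _ 1 T T)// ?lexx ?T0// => [|u]; last exact: wt_le1 (ltW L0).
  rewrite !Rintegral_lam//; last first.
    by apply: mI; apply: (@measurable_leb _ _ _ id (fun=> T)).
  by apply: eq_Rintegral => u; rewrite inE /= in_itv /= => /andP[_ ->]; rewrite mul1r.
have [sL|sL] := leP s L^-1.
  apply: (@le_trans _ _ (\int[lam T]_u wt L u)).
    apply: le_Rintegral => // u _; rewrite ler_piMl ?expR_ge0//.
    by case: (s <= u).
  rewrite primT prim_wt// /wt mulrAC -expRD ler_pM2r ?invr_gt0//.
  apply: (@le_trans _ _ 1); first by rewrite lerBlDr lerDl expR_ge0.
  rewrite -[leLHS]expR0 ler_expR mulNr subr_ge0 -ler_pdivlMl// mulr1 ge_max sL invr_ge0 (ltW L0)//.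
pose s' := Num.min (s - L^-1) T.
have s's : s' < s by rewrite gt_min ltrBlDr ltrDl invr_gt0 L0.
have s'0 : 0 <= s' by rewrite le_min T0 subr_ge0 (ltW sL).
have s'T : s' <= T by rewrite ge_min lexx orbT.
have I2 : rint (lam T) (fun u => (u <= s')%R%:R * wt L u).
  by apply: mI; apply: (@measurable_leb _ _ _ id (fun=> s')).
apply: (@le_trans _ _ (\int[lam T]_u (wt L u - (u <= s')%R%:R * wt L u))).
  apply: le_Rintegral => //; first exact: rintB.
  move=> u _; rewrite -[X in _ <= X - _]mul1r -mulrBl ler_wpM2r ?expR_ge0//.
  have [su|su] := leP s u.
    have -> : (u <= s')%R = false by apply/negbTE; rewrite -ltNge (lt_le_trans s's su).
    by rewrite subr0.
  by rewrite subr_ge0 lern1; case: (u <= s').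
rewrite RintegralB// primT -(@prim_lam _ _ 1)// ?s'0 ?s'T// => [|u]; last exact: wt_le1 (ltW L0).
rewrite !prim_wt// -mulrBl opprB addrCA addrAC subrr add0r mulrAC ler_pM2r ?invr_gt0//.
rewrite /wt -expRD (max_idPl _); last by rewrite (le_trans _ (ltW sL))// invr_ge0 ltW.
have [Ts|sT] := leP T (s - L^-1).
  by rewrite /s' (min_idPr Ts) subrr expR_ge0.
rewrite /s' (min_idPl (ltW sT)).
apply: (@le_trans _ _ (expR (- L * (s - L^-1)))); first by rewrite lerBlDr lerDl expR_ge0.
by rewrite ler_expR mulrBr mulNr mulNr opprK divff ?gt_eqF// addrC.
Qed.

(** The equation is adjoint, so its integral runs over the later times u >= s and the weight must
    decay in time. A fast exponential decay makes the operator a contraction whatever the length of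
    the interval. *)
Lemma volterra (T M A : R) (k : (bool * measurableTypeR R) * (bool * measurableTypeR R) -> R)
    (alpha : bool * measurableTypeR R -> R) : 0 <= T -> 0 <= M -> 0 <= A ->
  measurable_fun setT k -> measurable_fun setT alpha ->
  (forall u s, `|k (u, s)| <= M * (s.2 <= u.2)%R%:R) ->
  (forall s, `|alpha s| <= A * (s.2 <= T)%R%:R) ->
  exists (W : bool * measurableTypeR R -> R) (C : R),
  [/\ measurable_fun setT W, forall x, `|W x| <= C &
      forall s, W s = alpha s + \int[lam2 T]_u (W u * k (u, s))].
Proof.
move=> T0 M0 A0 mk malpha kM aA.
(* With this choice expR 1 / L = 1 / (4 (M + 1)), so that each of the two components contributes at
   most a quarter of the weight and both together a half. M + 1 instead of M keeps [L] positive when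
   M = 0. *)
pose L := 4 * (M + 1) * expR 1.
have L0 : 0 < L by rewrite !mulr_gt0 ?expR_gt0// ltr_wpDl.
pose psi (x : bool * measurableTypeR R) := wt L x.2.
have mpsi : measurable_fun setT psi by apply: (measurableT_comp (@mwt L)).
have psi0 x : 0 <= psi x by exact: expR_ge0.
have psi1 x : `|psi x| <= 1 by apply: wt_le1; exact: ltW.
have kM' z : `|k z| <= M.
  by case: z => u s; rewrite (le_trans (kM u s))// ler_piMr// lern1 leq_b1.
have [||||W [mW bW EW]] := @weighted_fixpoint R _ _ (lam2 T) k M psi alpha (A * expR (L * T)) 1
  mk kM' mpsi psi0 _ _ malpha _ _.
- by move=> x; rewrite (le_trans (ler_norm _)).
- move=> s; have mks : measurable_fun setT (fun u => k (u, s)).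
    by apply: measurableT_comp => //; exact: measurable_pair2.
  have mf1 : measurable_fun setT (fun u => psi u * `|k (u, s)|).
    by apply: measurable_funM => //; apply: measurableT_comp.
  rewrite (@Rintegral_lam2 T _ M)// => [|u]; last first.
    by rewrite normrM normr_id -[leRHS]mul1r ler_pM.
  have key b : \int[lam T]_u (psi (b, u) * `|k (b, u, s)|) <= psi s / 4.
    apply: (@le_trans _ _ (\int[lam T]_u (M * ((s.2 <= u)%R%:R * wt L u)))).
      apply: le_Rintegral => //.
      - apply: (@bounded_integrable _ _ _ _ _ M) => [|u].
          exact: (@measurable_section2 (fun x => psi x * `|k (x, s)|) b).
        by rewrite normrM normr_id -[leRHS]mul1r ler_pM.
      - apply: (@bounded_integrable _ _ _ _ _ M) => [|u].
          apply: measurable_funM => //; apply: measurable_funM => //.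
          exact: (@measurable_leb _ _ _ (fun=> s.2) id).
        rewrite !normrM (ger0_norm M0) ler_piMr// mulr_ile1// ?wt_le1 ?(ltW L0)//.
        by rewrite normr_nat lern1 leq_b1.
      move=> u _; rewrite mulrA mulrC ler_wpM2r ?expR_ge0//; exact: (kM (b, u) s).
    rewrite RintegralZl//; last first.
      apply: (@bounded_integrable _ _ _ _ _ 1) => [|u].
        apply: measurable_funM => //; exact: (@measurable_leb _ _ _ (fun=> s.2) id).
      rewrite normrM mulr_ile1// ?wt_le1 ?(ltW L0)//.
      by rewrite normr_nat lern1 leq_b1.
    have := @exp_weight T L s.2 L0 T0.
    rewrite /psi; set q := wt L s.2; set I := Rintegral _ _ _ => HI.
    have q0 : 0 <= q by exact: expR_ge0.
    have E1 : expR 1 / L = (4 * (M + 1))^-1.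
      by rewrite /L invfM mulrC -mulrA mulVf ?mulr1// gt_eqF// expR_gt0.
    rewrite E1 in HI.
    apply: (le_trans (ler_wpM2l M0 HI)).
    rewrite mulrA [leRHS]mulrC ler_wpM2r// ler_pdivrMr ?mulr_gt0 ?ltr_wpDl//.
    by rewrite mulrA mulVf// mul1r; lra.
  have := key true; have := key false; set I1 := Rintegral _ _ _; set I2 := Rintegral _ _ _.
  by lra.
- by rewrite mulr_ge0 ?expR_ge0.
- move=> s; rewrite (le_trans (aA s))// -mulrA ler_wpM2l// /psi /wt -expRD.
  have [sT|_] := leP s.2 T; last exact: expR_ge0.
  by rewrite -expR0 ler_expR mulNr subr_ge0 ler_pM2l// ge_max sT T0.
exists W, (2 * (A * expR (L * T))); split=> // x.
rewrite (le_trans (bW x))// ler_piMr ?mulr_ge0 ?expR_ge0//.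
by rewrite (le_trans (ler_norm _)).
Qed.

End two_component_time.

(** * A particle in a perturbed mean field *)

Section trig_pair.
Context (R : realType).

(** A boolean index treats both components at once: sin(z - a) is the sum over b of trig b z * dtrig
    b a, so the coupling depends on the other particles only through their two averages of
    [trig]. *)
Definition trig (b : bool) (x : R) : R := if b then sin x else cos x.
Definition dtrig (b : bool) (x : R) : R := if b then cos x else - sin x.

Lemma isd_trig b x : isd (trig b) x (dtrig b x).
Proof. by case: b; [exact: isd_sin|exact: isd_cos]. Qed.

Lemma isd_dtrig b x : isd (dtrig b) x (- trig b x).
Proof. by case: b; [exact: isd_cos|apply: isdN; exact: isd_sin]. Qed.

Lemma trig_max b x : `|trig b x| <= 1.
Proof. by case: b; [exact: sin_max|exact: cos_max]. Qed.

Lemma dtrig_max b x : `|dtrig b x| <= 1.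
Proof. by case: b => /=; [exact: cos_max|rewrite normrN; exact: sin_max]. Qed.

Lemma trig_lip b x y : `|trig b x - trig b y| <= `|x - y|.
Proof. by case: b; [exact: sin_lip|exact: cos_lip]. Qed.

Lemma dtrig_lip b x y : `|dtrig b x - dtrig b y| <= `|x - y|.
Proof.
by case: b => /=; [exact: cos_lip|rewrite -opprD normrN; exact: sin_lip].
Qed.

Lemma cont_trig b : continuous (trig b).
Proof. by apply: (@isd_continuous _ _ (dtrig b)) => x; exact: isd_trig. Qed.

Lemma cont_dtrig b : continuous (dtrig b).
Proof. by apply: (@isd_continuous _ _ (fun x => - trig b x)) => x; exact: isd_dtrig. Qed.

Lemma ler_normD4 (a b c d : R) : `|a + b + c + d| <= `|a| + `|b| + `|c| + `|d|.
Proof.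
apply: le_trans (ler_normD _ _) _; rewrite lerD2r.
by apply: le_trans (ler_normD _ _) _; rewrite lerD2r; exact: ler_normD.
Qed.

(** The mean value bound for f - g(y) id gives the constant 1 in place of the optimal 1/2, which is
    enough. *)
Lemma taylor2 (f g : R -> R) : (forall x, isd f x (g x)) ->
  (forall x y, `|g x - g y| <= `|x - y|) ->
  forall x y, `|f x - f y - g y * (x - y)| <= (x - y) ^+ 2.
Proof.
move=> fd gl x y.
pose F s := f s - g y * s.
have cF : continuous F.
  apply: contB; first exact: isd_continuous fd.
  by apply: contM; [exact: cont_cst|exact: cont_id].
have Fd s : isd F s (g s - g y).
  apply: isd_eq; first by apply: isdB; [exact: fd|apply: isdM; [exact: isd_cst|exact: isd_id]].
  by rewrite /=; ring.
have -> : f x - f y - g y * (x - y) = F x - F y by rewrite /F; ring.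
rewrite -[(x - y) ^+ 2]real_normK ?num_real// expr2.
have [xy|/ltW yx] := leP x y.
  rewrite distrC (distrC x y) (ger0_norm (_ : 0 <= y - x)) ?subr_ge0//.
  apply: (@derive_bound _ F (fun s => g s - g y)) => // s /andP[xs sy].
  by rewrite (le_trans (gl _ _))// distrC ger0_norm ?subr_ge0 ?(ltW sy)// lerB// ltW.
rewrite (ger0_norm (_ : 0 <= x - y)) ?subr_ge0//.
apply: (@derive_bound _ F (fun s => g s - g y)) => // s /andP[xs sy].
by rewrite (le_trans (gl _ _))// ger0_norm ?subr_ge0 ?(ltW xs)// lerB// ltW.
Qed.

Lemma trig_taylor b x y : `|trig b x - trig b y - dtrig b y * (x - y)| <= (x - y) ^+ 2.
Proof. by apply: taylor2 => [z|z w]; [exact: isd_trig|exact: dtrig_lip]. Qed.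

Lemma dtrig_taylor b x y : `|dtrig b x - dtrig b y + trig b y * (x - y)| <= (x - y) ^+ 2.
Proof.
have := @taylor2 (dtrig b) (fun z => - trig b z) (isd_dtrig b) _ x y.
rewrite mulNr opprK; apply=> z w; rewrite -opprD normrN; exact: trig_lip.
Qed.

End trig_pair.

(** * One particle: displacement and linear response to a field error *)

Section particle.
Context (R : realType).
Variables (K om T : R) (r rho : bool -> R -> R) (y th : R -> R).
Hypotheses (K0 : 0 <= K) (T0 : 0 <= T).
Hypotheses (cr : forall b, continuous (r b)) (crho : forall b, continuous (rho b)).
Hypotheses (cy : continuous y) (cth : continuous th).
Hypothesis r1 : forall b t, `|r b t| <= 1.
Let drift (q : bool -> R -> R) (x : R -> R) t : R :=
  om + K * (q true t * dtrig true (x t) + q false t * dtrig false (x t)).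
Hypothesis yd : forall t, 0 < t < T -> isd y t (drift r y t).
Hypothesis thd : forall t, 0 < t < T -> isd th t (drift rho th t).
Hypothesis yth0 : th 0 = y 0.

Let e b t := rho b t - r b t.
Let E t := `|e true t| + `|e false t|.

Let ce b : continuous (e b). Proof. exact: contB. Qed.
Let cE : continuous E. Proof. by apply: contD; apply: cont_abs. Qed.
Let E0 t : 0 <= E t. Proof. exact: addr_ge0. Qed.

Definition displacement_const := expR (2 * K * T) * K.

Lemma displacement_const_ge0 : 0 <= displacement_const. Proof. by rewrite mulr_ge0// expR_ge0. Qed.

Let K2 : 0 <= 2 * K. Proof. by rewrite mulr_ge0. Qed.

(** The difference of drifts splits into the field error, evaluated along [th], and the change of
    position under the unperturbed field. As |r b| <= 1 for both values of b, the second part is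
    Lipschitz with constant 2 K, which is the rate in the Gronwall exponent. *)
Lemma particle_error t : 0 <= t <= T -> `|th t - y t| <= displacement_const * prim E t.
Proof.
move=> /andP[t0 tT].
apply: (@le_trans _ _ (expR (2 * K * t) * (`|th 0 - y 0| + (K * prim E t - K * prim E 0)))).
  apply: (@gronwall _ (fun t => th t - y t) (fun t => K * E t) (fun t => K * prim E t)
    (fun t => drift rho th t - drift r y t)) => //.
  - exact: contB.
  - by apply: contM; [exact: cont_cst|exact: prim_continuous].
  - move=> s /andP[s0 st]; have sT : 0 < s < T by rewrite s0 (lt_le_trans st).
    by apply: isdB; [exact: thd|exact: yd].
  - move=> s /andP[s0 st]; apply: isd_eq.
      by apply: isdM; [exact: isd_cst|exact: prim_derive].
    by rewrite /=; ring.
  - by move=> s _; rewrite mulr_ge0.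
  move=> s /andP[s0 st].
  have -> : drift rho th s - drift r y s = K *
      (e true s * dtrig true (th s) + e false s * dtrig false (th s) +
       r true s * (dtrig true (th s) - dtrig true (y s)) +
       r false s * (dtrig false (th s) - dtrig false (y s))).
    by rewrite /drift /e; ring.
  rewrite normrM (ger0_norm K0) (mulrC 2) -mulrA -mulrDr ler_wpM2l//.
  have H b : `|e b s * dtrig b (th s)| <= `|e b s|.
    by rewrite normrM ler_piMr// dtrig_max.
  have H' b : `|r b s * (dtrig b (th s) - dtrig b (y s))| <= `|th s - y s|.
    by rewrite normrM -[leRHS]mul1r ler_pM// dtrig_lip.
  apply: le_trans (ler_normD4 _ _ _ _) _.
  have := H true; have := H false; have := H' true; have := H' false; rewrite /E.
  set a1 := `|_ * _|; set a2 := `|_ * _|; set a3 := `|_ * _|; set a4 := `|_ * _|.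
  by lra.
rewrite yth0 subrr normr0 add0r prim0// mulr0 subr0 mulrA ler_wpM2r ?prim_ge0//.
by rewrite ler_wpM2r// ler_expR ler_wpM2l.
Qed.

Let al (s : R) := r true s * trig true (y s) + r false s * trig false (y s).
(* [response] is the variation of constants solution of the equation linearized along [y],
   in the form [response_factor] times a primitive. *)
Definition response_factor (t : R) := expR (- K * prim al (Num.min t T)).
Definition source (b : bool) (s : R) := K * dtrig b (y s) * expR (K * prim al (Num.min s T)).
Definition response (t : R) : R := response_factor t * prim (fun s => e true s * source true s + e false s * source false s) t.

Let cal : continuous al.
Proof.
by apply: contD; apply: contM => //; apply: cont_comp => //; exact: cont_trig.
Qed.

Let al2 t : `|al t| <= 2.
Proof.
rewrite (le_trans (ler_normD _ _))// !normrM -[2]/(1 + 1)%R -[1 in leRHS](mulr1 1).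
by apply: lerD; apply: ler_pM => //; exact: trig_max.
Qed.

Let cmin : continuous (fun t : R => Num.min t T).
Proof. by move=> x; apply: continuous_min; [exact: cvg_id|exact: cvg_cst]. Qed.

Let cP : continuous (fun t => prim al (Num.min t T)).
Proof. by apply: (@cont_comp _ _ (prim al)) => //; exact: prim_continuous. Qed.

Lemma cont_response_factor : continuous response_factor.
Proof. by apply: (@cont_comp _ _ (fun u => expR (- K * u))) => //; exact: cont_expR_lin. Qed.

Lemma cont_source b : continuous (source b).
Proof.
apply: contM.
  by apply: contM; [exact: cont_cst|apply: cont_comp => //; exact: cont_dtrig].
by apply: (@cont_comp _ _ (fun u => expR (K * u))) => //; exact: cont_expR_lin.
Qed.

(** The truncation of time at [T] in [response_factor] and [source] serves this bound: both are then
    bounded and continuous on the whole line, as the integral operators over [lam2] require. *)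
Let P2 t : `|prim al (Num.min t T)| <= 2 * T.
Proof.
have [t0|t0] := ltP t 0.
  have [F [_ _ _ Fn]] := prim_full cal.
  by rewrite (min_idPl _) ?Fn ?normr0 ?mulr_ge0// (le_trans (ltW t0)).
have m0 : 0 <= Num.min t T by rewrite le_min t0 T0.
have := @derive_bound _ (prim al) al 2 0 _ m0 (prim_continuous cal) _ _.
rewrite prim0// !subr0 => H; apply: le_trans (H _ _) _.
- by move=> s /andP[s0 _]; exact: prim_derive.
- by [].
by rewrite ler_wpM2l// ge_min lexx orbT.
Qed.

Lemma response_factor_bound t : `|response_factor t| <= expR (2 * K * T).
Proof.
rewrite ger0_norm ?expR_ge0// ler_expR mulNr (le_trans (ler_norm _))//.
by rewrite normrN normrM (ger0_norm K0) (mulrC 2) -mulrA ler_wpM2l.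
Qed.

Lemma source_bound b t : `|source b t| <= displacement_const.
Proof.
rewrite /source /displacement_const normrM mulrC ler_pM//.
  rewrite ger0_norm ?expR_ge0// ler_expR (le_trans (ler_norm _))//.
  by rewrite normrM (ger0_norm K0) (mulrC 2) -mulrA ler_wpM2l.
by rewrite normrM (ger0_norm K0) ler_piMr// dtrig_max.
Qed.

Let cq : continuous (fun s => e true s * source true s + e false s * source false s).
Proof. by apply: contD; apply: contM => //; exact: cont_source. Qed.

(** The drift linearized along [y]: the derivative of [dtrig b] is - [trig b], so the coefficient of
    the response is - K times [al]. *)
Lemma isd_response t : 0 < t < T -> isd response t
  (K * (e true t * dtrig true (y t) + e false t * dtrig false (y t)) - K * al t * response t).
Proof.
move=> /andP[t0 tT].
apply: isd_eq.
  apply: isdM; last exact: prim_derive.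
  apply: (@isd_near _ (fun t => expR (- K * prim al t))).
    near=> s; rewrite /response_factor (min_idPl _)// ltW//; near: s; exact: lt_nbhsl.
  apply: (@isd_comp _ (fun t => - K * prim al t) expR); first exact: isd_expR.
  by apply: isdM; [exact: isd_cst|exact: prim_derive].
rewrite /response /response_factor /source (min_idPl (ltW tT)).
set p := prim _ t; set P := prim _ t.
have -> : expR (- K * p) * (e true t * (K * dtrig true (y t) * expR (K * p)) +
   e false t * (K * dtrig false (y t) * expR (K * p))) =
   (expR (- K * p) * expR (K * p)) *
    (K * (e true t * dtrig true (y t) + e false t * dtrig false (y t))) by ring.
by rewrite -expRD mulNr addNr expR0 mul1r; ring.
Unshelve. all: by end_near. Qed.

Let le_primE s t : 0 <= s -> s <= t -> prim E s <= prim E t.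
Proof.
move=> s0 st; rewrite -lerN2.
apply: (@derive_le0_le _ (fun u => - prim E u) (fun u => - E u)) => //.
- by apply: contN; exact: prim_continuous.
- by move=> u /andP[su _]; apply: isdN; apply: prim_derive => //; exact: le_lt_trans su.
- by move=> u _; rewrite oppr_le0.
Qed.

(** The Gronwall factor times the two quadratic sources. Field error times displacement is at most K
    c E I, with c the displacement constant and I the primitive of E, and integrates to K c / 2
    times I^2. The Taylor remainders of the two fields give 2 K c^2 I^2 per unit of time. *)
Definition linearization_const := expR (2 * K * T) * (K * displacement_const / 2 + 2 * K * displacement_const ^+ 2 * T).

Lemma linearization_const_ge0 : 0 <= linearization_const.
Proof.
have := displacement_const_ge0 => c0.
by rewrite mulr_ge0 ?expR_ge0// addr_ge0 ?mulr_ge0 ?sqr_ge0.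
Qed.

Lemma linear_response t : 0 <= t <= T -> `|th t - y t - response t| <= linearization_const * prim E t ^+ 2.
Proof.
move=> /andP[t0 tT]; have c0 := displacement_const_ge0.
have cI := prim_continuous cE.
set c := 2 * K * displacement_const ^+ 2 * prim E t ^+ 2.
have cc0 : 0 <= c by rewrite /c mulr_ge0 ?sqr_ge0// mulr_ge0 ?sqr_ge0.
have z0 : th 0 - y 0 - response 0 = 0.
  by rewrite yth0 subrr /response prim0// mulr0 subrr.
apply: (@le_trans _ _ (expR (2 * K * t) * (`|th 0 - y 0 - response 0| +
    ((K * displacement_const / 2 * prim E t ^+ 2 + c * t) - (K * displacement_const / 2 * prim E 0 ^+ 2 + c * 0))))).
  apply: (@gronwall _ (fun t => th t - y t - response t)
    (fun s => K * displacement_const * (E s * prim E s) + c) (fun s => K * displacement_const / 2 * prim E s ^+ 2 + c * s)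
    (fun s => drift rho th s - drift r y s -
      (K * (e true s * dtrig true (y s) + e false s * dtrig false (y s)) - K * al s * response s))).
  - exact: t0.
  - exact: K2.
  - apply: contB; first exact: contB.
    by apply: contM; [exact: cont_response_factor|exact: prim_continuous].
  - apply: contD; apply: contM => //; try exact: cont_cst; last exact: cont_id.
    by rewrite /GRing.exp /=; apply: contM.
  - move=> s /andP[s0 st]; have sT : 0 < s < T by rewrite s0 (lt_le_trans st).
    by apply: isdB; [apply: isdB; [exact: thd|exact: yd]|exact: isd_response].
  - move=> s /andP[s0 st]; apply: isd_eq.
      apply: isdD; apply: isdM; try exact: isd_cst; last exact: isd_id.
      by rewrite /GRing.exp /=; apply: isdM; exact: prim_derive.
    by rewrite /=; field.
  - by move=> s _; rewrite addr_ge0// !mulr_ge0// prim_ge0.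
  move=> s /andP[s0 st].
  have sT : s <= T by rewrite (le_trans (ltW st)).
  set z := th s - y s - response s; set D := th s - y s.
  have De : `|D| <= displacement_const * prim E s by apply: particle_error; rewrite (ltW s0).
  (* Three kinds of terms appear: field error times displacement, second-order Taylor remainders,
     and - al * z. Only the last is fed back into Gronwall; the others are quadratic sources. *)
  have -> : drift rho th s - drift r y s -
      (K * (e true s * dtrig true (y s) + e false s * dtrig false (y s)) - K * al s * response s) = K *
      (e true s * (dtrig true (th s) - dtrig true (y s)) +
       e false s * (dtrig false (th s) - dtrig false (y s)) +
       r true s * (dtrig true (th s) - dtrig true (y s) + trig true (y s) * D) +
       r false s * (dtrig false (th s) - dtrig false (y s) + trig false (y s) * D) - al s * z).
    by rewrite /drift /z /D /e /al; ring.
  rewrite normrM (ger0_norm K0).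
  have -> : 2 * K * `|z| + (K * displacement_const * (E s * prim E s) + c) =
    K * (2 * `|z| + (displacement_const * (E s * prim E s) + 2 * displacement_const ^+ 2 * prim E t ^+ 2)) by rewrite /c; ring.
  rewrite ler_wpM2l//.
  have H b : `|e b s * (dtrig b (th s) - dtrig b (y s))| <= `|e b s| * (displacement_const * prim E s).
    by rewrite normrM ler_wpM2l// (le_trans (dtrig_lip _ _ _)).
  have H' b : `|r b s * (dtrig b (th s) - dtrig b (y s) + trig b (y s) * D)| <= displacement_const ^+ 2 * prim E t ^+ 2.
    rewrite normrM -[leRHS]mul1r ler_pM// (le_trans (dtrig_taylor _ _ _))// -exprMn.
    rewrite -[leLHS]real_normK ?num_real// lerXn2r ?nnegrE ?mulr_ge0 ?prim_ge0//.
    by rewrite (le_trans De)// ler_wpM2l// le_primE// ltW.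
  have Hz : `|al s * z| <= 2 * `|z| by rewrite normrM ler_wpM2r.
  apply: le_trans (ler_normB _ _) _.
  apply: le_trans (lerD (ler_normD4 _ _ _ _) (lexx _)) _.
  have := H true; have := H false; have := H' true; have := H' false.
  rewrite /E; set a1 := `|r _ _ * _|; set a2 := `|r _ _ * _|; set a3 := `|e _ _ * _|; set a4 := `|e _ _ * _|.
  by move: Hz; set a5 := `|al s * z|; lra.
rewrite z0 normr0 add0r prim0// expr0n /= !mulr0 addr0 subr0 /linearization_const.
have -> : K * displacement_const / 2 * prim E t ^+ 2 + c * t = (K * displacement_const / 2 + 2 * K * displacement_const ^+ 2 * t) * prim E t ^+ 2.
  by rewrite /c; ring.
rewrite mulrA ler_wpM2r ?sqr_ge0// ler_pM ?expR_ge0//.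
- by rewrite addr_ge0 ?mulr_ge0 ?sqr_ge0.
- by rewrite ler_expR ler_wpM2l.
- by rewrite lerD2l ler_wpM2l// !mulr_ge0// sqr_ge0.
Qed.

Lemma trig_error b (k t : R) : 0 <= t <= T ->
  `|trig b (k * th t) - trig b (k * y t)| <= `|k| * displacement_const * prim E t.
Proof.
move=> tT; rewrite (le_trans (trig_lip _ _ _))// -mulrBr normrM -mulrA ler_wpM2l//.
exact: particle_error.
Qed.

Lemma trig_response b (k t : R) : 0 <= t <= T ->
  `|trig b (k * th t) - trig b (k * y t) - k * dtrig b (k * y t) * response t| <=
  (k ^+ 2 * displacement_const ^+ 2 + `|k| * linearization_const) * prim E t ^+ 2.
Proof.
move=> tT.
have -> : trig b (k * th t) - trig b (k * y t) - k * dtrig b (k * y t) * response t =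
  (trig b (k * th t) - trig b (k * y t) - dtrig b (k * y t) * (k * th t - k * y t)) +
  k * dtrig b (k * y t) * (th t - y t - response t) by ring.
rewrite (le_trans (ler_normD _ _))// mulrDl lerD//.
  rewrite (le_trans (trig_taylor _ _ _))// -mulrBr exprMn -mulrA ler_wpM2l ?sqr_ge0//.
  rewrite -exprMn -[leLHS]real_normK ?num_real// lerXn2r ?nnegrE ?mulr_ge0 ?prim_ge0 ?displacement_const_ge0//.
  exact: particle_error.
rewrite !normrM -(mulrA `|k|) -(mulrA `|k| linearization_const) ler_wpM2l// -[leRHS]mul1r ler_pM// ?dtrig_max//.
exact: linear_response.
Qed.

End particle.

(** * Measurability and integration over two-component time *)

Section parameter_integral.
Context (R : realType) d (T : measurableType d) (P : probability T R).

Lemma cont_Rintegral (f : R -> T -> R) (M : R) : (forall s, measurable_fun setT (f s)) ->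
  (forall a, continuous (f ^~ a)) -> (forall s a, `|f s a| <= M) ->
  continuous (fun s => \int[P]_a f s a).
Proof.
move=> mf cf fM s.
apply: (@continuity_under_integral _ _ _ P f setT measurableT (s - 1) (s + 1) _ _ (fun=> M)).
- by move=> x _; exact: rint_bounded.
- by apply: aeW => a _ x _; exact: cf.
- exact: rint_cst.
- by move=> x _; apply: aeW => a _.
by rewrite inE /= in_itv /= ltrBlDr ltrDl ltr01.
Qed.

End parameter_integral.

Section time_component.
Context (R : realType) d (T : measurableType d).

Lemma measurable_time_component (F : bool -> R -> T -> R) :
  (forall b s, measurable_fun setT (F b s)) -> (forall b a, continuous (F b ^~ a)) ->
  measurable_fun setT (fun z : (bool * measurableTypeR R) * T => F z.1.1 z.1.2 z.2).
Proof.
move=> mF cF.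
have m1 b : measurable_fun setT (fun z : (bool * measurableTypeR R) * T => F b z.1.2 z.2).
  have := measurable_caratheodory (mF b) (cF b) => mC.
  have mp : measurable_fun setT (fun z : (bool * measurableTypeR R) * T => (z.1.2, z.2)).
    by apply: measurable_fun_pair => //; apply: measurableT_comp.
  exact: (measurableT_comp mC mp).
rewrite (_ : (fun _ => _) = fun z : (bool * measurableTypeR R) * T =>
  if z.1.1 then F true z.1.2 z.2 else F false z.1.2 z.2); last first.
  by apply/funext => -[[[] s] a].
by apply: measurable_fun_ifT => //; apply: measurableT_comp.
Qed.

Lemma measurable_time_component0 (F : bool -> R -> R) : (forall b, continuous (F b)) ->
  measurable_fun setT (fun x : bool * measurableTypeR R => F x.1 x.2).
Proof.
move=> cF.
rewrite (_ : (fun _ => _) = fun x : bool * measurableTypeR R =>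
  if x.1 then F true x.2 else F false x.2); last by apply/funext => -[[] s].
apply: measurable_fun_ifT => //; apply: measurableT_comp => //;
  exact: continuous_measurable_R.
Qed.

End time_component.

Section lam2_bounds.
Context (R : realType).
Variable T : R.
Hypothesis T0 : 0 <= T.
Let X := (bool * measurableTypeR R)%type.

Lemma lam2_setT : fine (lam2 T setT) = 2 * T.
Proof.
have -> : lam2 T setT = (lam T setT + lam T setT)%E by rewrite /lam2 measure_addE.
rewrite fineD; [|exact: fin_num_measure|exact: fin_num_measure].
by rewrite lam_setT// mulr_natl mulr2n.
Qed.

Let itv_integrable (f : measurableTypeR R -> R) (M : R) : measurable_fun setT f ->
  (forall s, `|f s| <= M) -> (@lebesgue_measure R).-integrable `[0, T] (EFin \o f).
Proof.
move=> mf fM.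
have fin : (@lebesgue_measure R `[0%R, T] < +oo)%E.
  by rewrite lebesgue_measure_itv; case: ifP => //= _; rewrite ltry.
apply: measurable_bounded_integrable => //.
- exact: measurable_funTS.
by exists M; split; rewrite ?num_real // => N MN x _ /=; rewrite (le_trans (fM x))// ltW.
Qed.

Lemma le_Rintegral_lam2 (f g : X -> R) (M : R) :
  measurable_fun setT f -> measurable_fun setT g ->
  (forall x, `|f x| <= M) -> (forall x, `|g x| <= M) ->
  (forall x, 0 <= x.2 <= T -> f x <= g x) ->
  \int[lam2 T]_x f x <= \int[lam2 T]_x g x.
Proof.
move=> mf mg fM gM fg; rewrite !(@Rintegral_lam2 _ _ _ M)//.
have key b : \int[lam T]_s f (b, s) <= \int[lam T]_s g (b, s).
  have If := @bounded_integrable _ _ _ (lam T) _ _ (measurable_section2 b mf) (fun s => fM (b, s)).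
  have Ig := @bounded_integrable _ _ _ (lam T) _ _ (measurable_section2 b mg) (fun s => gM (b, s)).
  rewrite !Rintegral_lam//; apply: le_Rintegral => //.
  - exact: (itv_integrable (measurable_section2 b mf) (fun s => fM (b, s))).
  - exact: (itv_integrable (measurable_section2 b mg) (fun s => gM (b, s))).
  by move=> s; rewrite /= in_itv /= => st; exact: fg.
exact: lerD.
Qed.

Lemma normr_Rintegral_lam2_le (f g : X -> R) (M : R) : measurable_fun setT f ->
  measurable_fun setT g -> (forall x, `|f x| <= M) -> (forall x, `|g x| <= M) ->
  (forall x, 0 <= x.2 <= T -> `|f x| <= g x) ->
  `|\int[lam2 T]_x f x| <= \int[lam2 T]_x g x.
Proof.
move=> mf mg fM gM fg.
have If : rint (lam2 T) f by exact: (@bounded_integrable _ _ _ (lam2 T) _ M mf fM).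
apply: (@le_trans _ _ (\int[lam2 T]_x `|f x|)).
  exact: normr_Rintegral_le If (rint_abs If) _.
apply: (le_Rintegral_lam2 (M := M)) => //; first exact: measurableT_comp.
by move=> x; rewrite normr_id.
Qed.

Lemma prim_lam2 (F : bool -> R -> R) (M t : R) : (forall b, continuous (F b)) ->
  (forall b s, `|F b s| <= M) -> 0 <= t <= T ->
  prim (fun s => F true s + F false s) t =
  \int[lam2 T]_x ((x.2 <= t)%R%:R * F x.1 x.2).
Proof.
move=> cF FM tT.
have M0 : 0 <= M := le_trans (normr_ge0 _) (FM true 0).
have mI : measurable_fun setT (fun x : X => (x.2 <= t)%R%:R * F x.1 x.2).
  apply: measurable_funM; last exact: measurable_time_component0.
  by apply: (@measurable_leb _ _ _ (fun x : X => x.2) (fun=> t)); [exact: measurable_snd|].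
have bI (x : X) : `|(x.2 <= t)%R%:R * F x.1 x.2| <= M.
  by rewrite normrM normr_nat -[leRHS]mul1r ler_pM// lern1 leq_b1.
rewrite (Rintegral_lam2 _ mI bI) /=.
rewrite -(prim_lam (cF true) (FM true) tT) -(prim_lam (cF false) (FM false) tT).
by rewrite /prim RintegralD//; exact: cont_integrable.
Qed.

(** The product is named in order to carry a finite measure structure: the moment bounds for
    averaged fields are stated for an arbitrary finite measure and serve both fields on [X] and
    kernels on X * X. *)
Definition lam22 : set (X * X) -> \bar R := (lam2 T \x lam2 T)%E.

HB.instance Definition _ := Measure.on lam22.

Lemma lam22_setT : lam22 setT = (lam2 T setT * lam2 T setT)%E.
Proof. by rewrite /lam22 -setXTT product_measure1E. Qed.

Lemma lam22_fin : fin_num_fun lam22.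
Proof.
move=> A mA; rewrite ge0_fin_numE//.
apply: (@le_lt_trans _ _ (lam22 setT)); first by apply: le_measure; rewrite ?inE.
rewrite lam22_setT -ge0_fin_numE; last exact: mule_ge0.
by apply: fin_numM; exact: fin_num_measure.
Qed.

HB.instance Definition _ := Measure_isFinite.Build _ _ _ lam22 lam22_fin.

Lemma Rintegral_lam22 (f : X * X -> R) (M : R) : measurable_fun setT f ->
  (forall z, `|f z| <= M) -> \int[lam22]_z f z = \int[lam2 T]_x \int[lam2 T]_y f (x, y).
Proof.
move=> mf fM; rewrite /Rintegral; congr fine.
under [in RHS]eq_integral do
  rewrite fineK ?(integrable_fin_num measurableT (bounded_section1 (lam2 T) mf fM _))//.
exact/esym/(integral12_prod_meas1 (bounded_integrable_prod (lam2 T) (lam2 T) mf fM)).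
Qed.

End lam2_bounds.

(** * Fluctuations of the particle system *)

Section empirical_average.
Context d d' (T : measurableType d) (T' : measurableType d') (R : realType).
Variables (P : probability T R) (h : probability T' R).
Variable X : nat -> {RV P >-> T'}.
Hypothesis iX : mutually_independent X.
Hypothesis dX : identically_distributed X h.

Definition avg (f : T' -> R) (n : nat) (a : T) : R :=
  n.+1%:R^-1 * \sum_(j < n.+1) f (X j a).

Lemma measurable_avg f n : measurable_fun setT f -> measurable_fun setT (avg f n).
Proof.
move=> mf; apply: measurable_funM => //; apply: measurable_sum => j.
exact: measurableT_comp.
Qed.

(** The bounds involve [f] only through its envelope [B]. They are therefore uniform over a family
    of fields with a common envelope and can be integrated over its parameter. *)
Lemma avg_moments (f B : T' -> R) n : measurable_fun setT f -> measurable_fun setT B ->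
  (forall x, `|f x| <= B x) -> rint h (fun x => B x ^+ 4) -> \int[h]_x f x = 0 ->
  [/\ rint P (fun a => avg f n a ^+ 4), rint P (fun a => avg f n a ^+ 2),
      \int[P]_a (avg f n a ^+ 2) <= (\int[h]_x (B x ^+ 2)) / n.+1%:R &
      \int[P]_a (avg f n a ^+ 4) <=
        (3 * (\int[h]_x (B x ^+ 2)) ^+ 2 + \int[h]_x (B x ^+ 4)) / n.+1%:R ^+ 2].
Proof.
move=> mf mB fB IB f0.
have B0 x : 0 <= B x := le_trans (normr_ge0 _) (fB x).
have fBp p x : `|f x ^+ p| <= B x ^+ p by rewrite normrX lerXn2r ?nnegrE.
have IB2 : rint h (fun x => B x ^+ 2).
  apply: (@rint_exp _ _ _ h B 2 4) => //.
  by apply: rint_eq IB => x; rewrite ger0_norm.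
have If4 : rint h (fun x => f x ^+ 4).
  by apply: rint_le (fBp 4%N) IB; exact: measurable_funX.
have If2 : rint h (fun x => f x ^+ 2).
  by apply: rint_le (fBp 2%N) IB2; exact: measurable_funX.
have F2 : \int[h]_x (f x ^+ 2) <= \int[h]_x (B x ^+ 2).
  by apply: le_Rintegral => // x _; rewrite (le_trans (ler_norm _)).
have F4 : \int[h]_x (f x ^+ 4) <= \int[h]_x (B x ^+ 4).
  by apply: le_Rintegral => // x _; rewrite (le_trans (ler_norm _)).
have F20 : 0 <= \int[h]_x (f x ^+ 2) by apply: Rintegral_ge0 => x _; exact: sqr_ge0.
have F40 : 0 <= \int[h]_x (f x ^+ 4).
  by apply: Rintegral_ge0 => x _; rewrite -[4%N]/(2 * 2)%N exprM sqr_ge0.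
have [g gf] := mfun_bundle mf.
have gfe : g =1 f by [].
have ge : (g : T' -> R) = f by apply/funext.
have [] := psum_moments iX dX (f := g) n.+1; rewrite ?ge//.
rewrite /psum ge => I4 _ M2 M4.
have aE p a : (n.+1%:R^-1) ^+ p * (\sum_(j < n.+1) f (X j a)) ^+ p = avg f n a ^+ p.
  by rewrite /avg exprMn.
have I2 : rint P (fun a => (\sum_(j < n.+1) f (X j a)) ^+ 2).
  apply: (@rint_exp _ _ _ P _ 2 4) => //.
    by apply: measurable_sum => j; exact: measurableT_comp.
  apply: rint_eq I4 => a; rewrite -[4%N]/(2 * 2)%N !exprM real_normK ?num_real//.
set N := n.+1%:R; have N0 : 0 < N :> R by [].
split.
- by apply: (rint_eq (aE 4%N)); exact: rintZ.
- by apply: (rint_eq (aE 2%N)); exact: rintZ.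
- rewrite -(eq_Rintegral _ (fun a _ => aE 2%N a)) RintegralZl// M2 -/N.
  have -> : N^-1 ^+ 2 * (N * \int[h]_x (f x ^+ 2)) = \int[h]_x (f x ^+ 2) / N.
    by field; rewrite gt_eqF.
  by rewrite ler_pM2r ?invr_gt0.
rewrite -(eq_Rintegral _ (fun a _ => aE 4%N a)) RintegralZl//.
apply: (@le_trans _ _ (N^-1 ^+ 4 * (3 * N ^+ 2 * (\int[h]_x (f x ^+ 2)) ^+ 2
    + N ^+ 2 * \int[h]_x (f x ^+ 4)))).
  rewrite ler_wpM2l ?exprn_ge0 ?invr_ge0 ?(ltW N0)// (le_trans M4)// lerD2l ler_wpM2r//.
  by rewrite expr2 ler_peMr ?(ltW N0)// /N ler1n.
have -> : N^-1 ^+ 4 * (3 * N ^+ 2 * (\int[h]_x (f x ^+ 2)) ^+ 2 + N ^+ 2 * \int[h]_x (f x ^+ 4)) =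
  (3 * (\int[h]_x (f x ^+ 2)) ^+ 2 + \int[h]_x (f x ^+ 4)) / N ^+ 2.
  by field; rewrite gt_eqF.
rewrite ler_pM2r ?invr_gt0 ?exprn_gt0// lerD// ler_wpM2l// lerXn2r ?nnegrE//.
exact: le_trans F2.
Qed.

Section field.
Context dz (Z : measurableType dz) (nu : {finite_measure set Z -> \bar R}).
Variables (g : Z * T' -> R) (B : T' -> R).
Hypotheses (mg : measurable_fun setT g) (mB : measurable_fun setT B).
Hypothesis gB : forall z x, `|g (z, x)| <= B x.
Hypothesis IB : rint h (fun x => B x ^+ 4).
Hypothesis g0 : forall z, \int[h]_x g (z, x) = 0.

Definition favg n (z : Z) (a : T) : R := avg (fun x => g (z, x)) n a.

Lemma measurable_favg n : measurable_fun setT (fun w : T * Z => favg n w.2 w.1).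
Proof.
apply: measurable_funM => //; apply: measurable_sum => j.
apply: (measurableT_comp mg); apply: measurable_fun_pair => //.
by apply: measurableT_comp => //; exact: measurable_fst.
Qed.

Lemma favg_bound n z a : `|favg n z a| <= avg B n a.
Proof.
rewrite /favg /avg normrM ger0_norm ?invr_ge0// ler_wpM2l ?invr_ge0//.
rewrite (le_trans (ler_norm_sum _ _ _))// ler_sum// => j _; exact: gB.
Qed.

Let favg_tonelli n (p : nat) (C : R) : ~~ odd p ->
  (forall z, (\int[P]_a (favg n z a ^+ p)%:E <= C%:E)%E) ->
  (\int[P]_a \int[nu]_z (favg n z a ^+ p)%:E <= (C * fine (nu setT))%:E)%E.
Proof.
move=> pe HC.
have mf : measurable_fun setT (fun w : T * Z => (favg n w.2 w.1 ^+ p)%:E).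
  by apply/measurable_EFinP; apply: measurable_funX; exact: measurable_favg.
have f0 (w : T * Z) : (0 <= (favg n w.2 w.1 ^+ p)%:E)%E.
  by rewrite lee_fin exprn_even_ge0.
rewrite (@fubini_tonelli _ _ _ _ _ P nu (fun w : T * Z => (favg n w.2 w.1 ^+ p)%:E) mf f0)/=.
apply: (@le_trans _ _ (\int[nu]_z C%:E)%E).
  apply: ge0_le_integral => //.
  - by move=> z _; apply: integral_ge0 => a _; rewrite lee_fin exprn_even_ge0.
  - exact: (@measurable_fun_fubini_tonelli_G _ _ _ _ _ P _ mf f0).
rewrite integral_cst// EFinM fineK//; exact: fin_num_measure.
Qed.

Lemma favg_moment2 n :
  (\int[P]_a \int[nu]_z (favg n z a ^+ 2)%:E <=
   (((\int[h]_x (B x ^+ 2)) * fine (nu setT)) / n.+1%:R)%:E)%E.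
Proof.
rewrite mulrAC; apply: favg_tonelli => // z.
have mgz : measurable_fun setT (fun x => g (z, x)) by apply: measurableT_comp.
have [_ I2 M2 _] := avg_moments n mgz mB (gB z) IB (g0 z).
by rewrite -Rintegral_EFin// lee_fin.
Qed.

Lemma favg_moment4 n :
  (\int[P]_a \int[nu]_z (favg n z a ^+ 4)%:E <=
   (((3 * (\int[h]_x (B x ^+ 2)) ^+ 2 + \int[h]_x (B x ^+ 4)) * fine (nu setT))
      / n.+1%:R ^+ 2)%:E)%E.
Proof.
rewrite mulrAC; apply: favg_tonelli => // z.
have mgz : measurable_fun setT (fun x => g (z, x)) by apply: measurableT_comp.
have [I4 _ _ M4] := avg_moments n mgz mB (gB z) IB (g0 z).
by rewrite -Rintegral_EFin// lee_fin.
Qed.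

Lemma rint_favg n (p : nat) a : rint nu (fun z => favg n z a ^+ p).
Proof.
apply: (@bounded_integrable _ _ _ _ _ (avg B n a ^+ p)) => [|z].
  apply: measurable_funX.
  by apply: (measurableT_comp (@measurable_favg n) (measurable_pair1 a)).
rewrite normrX lerXn2r ?nnegrE ?favg_bound//.
exact: le_trans (favg_bound n z a).
Qed.

End field.
End empirical_average.

(** * Centred fields, kernel and forcing term of the mean-field flow *)

Section mean_field.
Context d' (T' : measurableType d') (R : realType).
Variables (h : probability T' R) (K T : R) (Y : T' -> R -> R).
Hypotheses (K0 : 0 <= K) (T0 : 0 <= T).
Hypothesis cY : forall x, continuous (Y x).
Hypothesis mY : forall b t, measurable_fun setT (fun x => trig b (Y x t)).

Definition mean_trig (b : bool) (t : R) : R := \int[h]_x trig b (Y x t).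
Let r := mean_trig.

Lemma mean_trig_max b t : `|r b t| <= 1.
Proof. by apply: probability_bound => // x; exact: trig_max. Qed.

Lemma cont_trigY b x : continuous (fun t => trig b (Y x t)).
Proof. by apply: cont_comp => //; exact: cont_trig. Qed.

Lemma cont_mean_trig b : continuous (r b).
Proof.
apply: (@cont_Rintegral _ _ _ h (fun t x => trig b (Y x t)) 1) => // [x|t x].
  exact: cont_trigY.
exact: trig_max.
Qed.

Lemma mdY b t : measurable_fun setT (fun x => dtrig b (Y x t)).
Proof.
case: b => /=; first exact: (mY false t).
by apply: measurableT_comp => //; exact: (mY true t).
Qed.

Let X := (bool * measurableTypeR R)%type.

(* A point (b, s) of [X] selects one of the two trigonometric fields and a time; [fA] is the
   centred field, and [fPhi (b, u)] times [fPsi (b', s)] is the linear effect on the field b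
   at time u of an error in the field b' at time s < u. *)
Definition fA (z : X * T') : R := trig z.1.1 (Y z.2 z.1.2) - r z.1.1 z.1.2.
Definition fPsi (z : X * T') : R := source K T r (Y z.2) z.1.1 z.1.2.
Definition fPhi (z : X * T') : R :=
  dtrig z.1.1 (Y z.2 z.1.2) * response_factor K T r (Y z.2) z.1.2.

Lemma measurable_fA : measurable_fun setT fA.
Proof.
apply: (@measurable_time_component _ _ _ (fun b t x => trig b (Y x t) - r b t)) => [b s|b x].
  exact: measurable_funB.
by apply: contB; [exact: cont_trigY|exact: cont_mean_trig].
Qed.

Lemma fA_bound z : `|fA z| <= 2.
Proof.
rewrite (le_trans (ler_normB _ _))// -[2]/(1 + 1)%R lerD ?trig_max//.
exact: mean_trig_max.
Qed.

Lemma fA_mean x : \int[h]_w fA (x, w) = 0.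
Proof.
rewrite /fA /= RintegralB//; last exact: rint_cst.
  by rewrite probability_cst subrr.
by apply: (@rint_bounded _ _ _ _ _ 1) => // w; exact: trig_max.
Qed.

Let al (x : T') (s : R) := r true s * trig true (Y x s) + r false s * trig false (Y x s).

Let cal x : continuous (al x).
Proof. by apply: contD; apply: contM; try exact: cont_trigY; exact: cont_mean_trig. Qed.

(** [Y] is known to be measurable in the starting point only through [trig], and so is [al]. The
    primitive is rewritten as an integral against [lam T] of a jointly measurable function, where
    Fubini gives measurability. *)
Let mprim u : measurable_fun setT (fun x => prim (al x) (Num.min u T)).
Proof.
have [u0|u0] := ltP u 0.
  rewrite (_ : (fun _ => _) = fun=> 0)//; apply/funext => x.
  have [F [_ _ _ Fn]] := prim_full (cal (x := x)).
  by rewrite (min_idPl _) ?Fn// (le_trans (ltW u0)).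
have al2 x s : `|al x s| <= 2.
  rewrite (le_trans (ler_normD _ _))// !normrM -[2]/(1 + 1)%R -[1 in leRHS](mulr1 1).
  by apply: lerD; apply: ler_pM => //; rewrite ?trig_max//; exact: mean_trig_max.
have mT : 0 <= Num.min u T <= T by rewrite le_min u0 T0 /= ge_min lexx orbT.
rewrite (_ : (fun _ => _) = fun x => \int[lam T]_s ((s <= Num.min u T)%R%:R * al x s)); last first.
  by apply/funext => x; rewrite (prim_lam (cal (x := x)) (al2 x) mT).
apply: (@Rintegral_prod2 R _ _ _ _ (lam T) h
  (fun z : measurableTypeR R * T' => (z.1 <= Num.min u T)%R%:R * al z.2 z.1) 2).
  apply: measurable_funM.
    by apply: (@measurable_leb _ _ _ (fun z : measurableTypeR R * T' => z.1)) => //; exact: measurable_fst.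
  apply: (@measurable_caratheodory _ _ _ (fun s x => al x s)) => [s|x]; last exact: cal.
  by apply: measurable_funD; apply: measurable_funM => //; exact: mY.
by move=> z; rewrite normrM normr_nat -[leRHS]mul1r ler_pM// lern1 leq_b1.
Qed.

Lemma measurable_response_factor t : measurable_fun setT (fun x => response_factor K T r (Y x) t).
Proof.
apply: (measurableT_comp (continuous_measurable_R (@continuous_expR R))).
by apply: measurable_funM => //; exact: mprim.
Qed.

Lemma measurable_fPsi : measurable_fun setT fPsi.
Proof.
apply: (@measurable_time_component _ _ _ (fun b t x => source K T r (Y x) b t)) => [b s|b x].
  apply: measurable_funM; first by apply: measurable_funM => //; exact: mdY.
  apply: (measurableT_comp (continuous_measurable_R (@continuous_expR R))).
  by apply: measurable_funM => //; exact: mprim.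
by apply: cont_source => //; exact: cont_mean_trig.
Qed.

Lemma measurable_fPhi : measurable_fun setT fPhi.
Proof.
apply: (@measurable_time_component _ _ _ (fun b t x => dtrig b (Y x t) * response_factor K T r (Y x) t)) => [b s|b x].
  by apply: measurable_funM; [exact: mdY|exact: measurable_response_factor].
apply: contM; first by apply: cont_comp => //; exact: cont_dtrig.
by apply: cont_response_factor => //; exact: cont_mean_trig.
Qed.

Lemma fPsi_bound z : `|fPsi z| <= displacement_const K T.
Proof. by apply: source_bound => //; [exact: cont_mean_trig|exact: mean_trig_max]. Qed.

Lemma response_factor_mean_bound x t : `|response_factor K T r (Y x) t| <= expR (2 * K * T).
Proof. by apply: response_factor_bound => //; [exact: cont_mean_trig|exact: mean_trig_max]. Qed.

Lemma fPhi_bound z : `|fPhi z| <= expR (2 * K * T).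
Proof.
by rewrite /fPhi normrM -[leRHS]mul1r ler_pM// ?dtrig_max// response_factor_mean_bound.
Qed.

Let Cg := expR (2 * K * T) * displacement_const K T.

(** The contribution of one sample to the linear response kernel, with causality made explicit by
    the indicator. Its mean [kern] drives the Volterra equation, while its centred part [gk] meets
    the error [e] and yields a product of small quantities. *)
Let gk0 (w : (X * X) * T') : R := (w.1.2.2 <= w.1.1.2)%R%:R * (fPhi (w.1.1, w.2) * fPsi (w.1.2, w.2)).

Let mgk0 : measurable_fun setT gk0.
Proof.
have m1 : measurable_fun setT (fun w : (X * X) * T' => w.1) by exact: measurable_fst.
have m11 : measurable_fun setT (fun w : (X * X) * T' => w.1.1) by apply: measurableT_comp m1.
have m12 : measurable_fun setT (fun w : (X * X) * T' => w.1.2) by apply: measurableT_comp m1.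
have m2 : measurable_fun setT (fun w : (X * X) * T' => w.2) by exact: measurable_snd.
apply: measurable_funM.
  apply: (@measurable_leb _ _ _ (fun w : (X * X) * T' => w.1.2.2) (fun w => w.1.1.2)).
    by apply: measurableT_comp m12.
  by apply: measurableT_comp m11.
apply: measurable_funM.
  by apply: (measurableT_comp measurable_fPhi); exact: measurable_fun_pair.
by apply: (measurableT_comp measurable_fPsi); exact: measurable_fun_pair.
Qed.

Let gk0_bound w : `|gk0 w| <= Cg * (w.1.2.2 <= w.1.1.2)%R%:R.
Proof.
rewrite /gk0 normrM normr_nat mulrC ler_wpM2r// normrM ler_pM//.
  exact: fPhi_bound.
exact: fPsi_bound.
Qed.

Let Cg0 : 0 <= Cg. Proof. by rewrite mulr_ge0 ?expR_ge0 ?displacement_const_ge0. Qed.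

Let gk0_bound1 w : `|gk0 w| <= Cg.
Proof. by rewrite (le_trans (gk0_bound w))// ler_piMr// lern1 leq_b1. Qed.

Definition kern (z : X * X) : R := \int[h]_x gk0 (z, x).

Lemma measurable_kern : measurable_fun setT kern.
Proof. exact: (@Rintegral_prod1 R _ _ _ _ (lam22 T) h gk0 _ mgk0 gk0_bound1). Qed.

Lemma kern_bound u s : `|kern (u, s)| <= Cg * (s.2 <= u.2)%R%:R.
Proof.
apply: probability_bound => [|x]; last exact: (gk0_bound ((u, s), x)).
by apply: (measurableT_comp mgk0 (measurable_pair1 (u, s))).
Qed.

Let kern_bound1 z : `|kern z| <= Cg.
Proof. by case: z => u s; rewrite (le_trans (kern_bound u s))// ler_piMr// lern1 leq_b1. Qed.

Definition gk (w : (X * X) * T') : R := gk0 w - kern w.1.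

Lemma measurable_gk : measurable_fun setT gk.
Proof.
apply: measurable_funB => //.
by apply: (measurableT_comp measurable_kern); exact: measurable_fst.
Qed.

Lemma gk_bound w : `|gk w| <= 2 * Cg.
Proof. by rewrite (le_trans (ler_normB _ _))// mulr_natl mulr2n lerD. Qed.

Lemma gk_mean z : \int[h]_x gk (z, x) = 0.
Proof.
rewrite /gk /= RintegralB//; last exact: rint_cst.
  by rewrite probability_cst subrr.
apply: (@rint_bounded _ _ _ _ _ Cg) => [|x]; last exact: gk0_bound1.
by apply: (measurableT_comp mgk0 (measurable_pair1 z)).
Qed.

Section observable.
Variables (f : T' -> R) (k : R) (c : bool).
Hypothesis mf : measurable_fun setT f.
Hypothesis If4 : rint h (fun x => f x ^+ 4).
Hypothesis mkY : forall b, measurable_fun setT (fun x => trig b (k * Y x T)).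

(** The derivative of the observable in the final position, times the response factor. Multiplied by
    [fPsi] at an earlier time, it is the linear effect of a field error at that time on the
    observable. *)
Definition phi0 (x : T') : R := f x * (k * dtrig c (k * Y x T)) * response_factor K T r (Y x) T.

Lemma measurable_phi0 : measurable_fun setT phi0.
Proof.
apply: measurable_funM; last exact: measurable_response_factor.
apply: measurable_funM => //; apply: measurable_funM => //.
case: c => /=; first exact: (mkY false).
by apply: measurableT_comp => //; exact: (mkY true).
Qed.

Let Cf := `|k| * expR (2 * K * T) * displacement_const K T.

Let Cf0 : 0 <= Cf. Proof. by rewrite mulr_ge0 ?displacement_const_ge0// mulr_ge0 ?expR_ge0. Qed.

Let ga0 (z : X * T') : R := (z.1.2 <= T)%R%:R * (phi0 z.2 * fPsi z).

Let mga0 : measurable_fun setT ga0.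
Proof.
apply: measurable_funM.
  apply: (@measurable_leb _ _ _ (fun z : X * T' => z.1.2) (fun=> T)) => //.
  exact: (measurableT_comp measurable_snd measurable_fst).
apply: measurable_funM; last exact: measurable_fPsi.
by apply: (measurableT_comp measurable_phi0); exact: measurable_snd.
Qed.

Let ga0_bound z : `|ga0 z| <= Cf * `|f z.2| * (z.1.2 <= T)%R%:R.
Proof.
rewrite /ga0 normrM normr_nat mulrC ler_wpM2r// normrM.
rewrite (_ : Cf * `|f z.2| = (`|f z.2| * (`|k| * 1) * expR (2 * K * T)) * displacement_const K T); last first.
  by rewrite /Cf; ring.
apply: ler_pM => //; last exact: fPsi_bound.
rewrite /phi0 !normrM ler_pM ?mulr_ge0//; last exact: response_factor_mean_bound.
by rewrite ler_wpM2l// ler_wpM2l// dtrig_max.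
Qed.

Let ga0_bound1 z : `|ga0 z| <= Cf * `|f z.2|.
Proof. by rewrite (le_trans (ga0_bound z))// ler_piMr ?mulr_ge0// lern1 leq_b1. Qed.

Lemma rint_absf : rint h (fun x => `|f x|).
Proof.
apply: rint_abs; apply: (@rint_eq _ _ _ _ (fun x => f x ^+ 1)) => [x|]; first by rewrite expr1.
apply: (@rint_exp _ _ _ _ _ 1 4) => //.
by apply: rint_eq If4 => x; rewrite -[4%N]/(2 * 2)%N !exprM real_normK ?num_real.
Qed.

Let Iga0 s : rint h (fun x => ga0 (s, x)).
Proof.
apply: (@rint_le _ _ _ _ _ (fun x => Cf * `|f x|)) => [|x|]; last first.
- by apply: rintZ; exact: rint_absf.
- exact: (ga0_bound1 (s, x)).
by apply: (measurableT_comp mga0 (measurable_pair1 s)).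
Qed.

Definition alph (s : X) : R := \int[h]_x ga0 (s, x).

(** Since [f] is unbounded, Fubini for bounded functions does not cover this integrand.
    Integrability on the product follows from that of |f| and the finite mass of [lam2]. *)
Lemma measurable_alph : measurable_fun setT alph.
Proof.
have Iprod : (lam2 T \x h)%E.-integrable setT (EFin \o ga0).
  apply/integrable12ltyP; first exact/measurable_EFinP.
  apply: (@le_lt_trans _ _ (\int[lam2 T]_s (Cf * \int[h]_x `|f x|)%:E)%E).
    apply: ge0_le_integral => //.
    - by move=> s _; exact: integral_ge0.
    - apply: (@measurable_fun_fubini_tonelli_F _ _ _ _ _ h (fun z => `|(EFin \o ga0) z|%E)) => //.
      by apply: measurableT_comp => //; apply/measurable_EFinP.
    - move=> s _; rewrite EFinM Rintegral_EFin; last exact: rint_absf.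
      rewrite -integralZl//; last exact: rint_absf.
      apply: ge0_le_integral => //.
      - apply: measurableT_comp => //; apply/measurable_EFinP.
        by apply: (measurableT_comp mga0 (measurable_pair1 s)).
      - by apply: measurable_funeM; apply/measurable_EFinP; apply: measurableT_comp.
      by move=> x _; rewrite /= lee_fin; exact: (ga0_bound1 (s, x)).
  rewrite integral_cst// -ge0_fin_numE; last first.
    by rewrite mule_ge0// lee_fin mulr_ge0// Rintegral_ge0.
  by rewrite fin_numM//; exact: fin_num_measure.
by apply: measurableT_comp => //; exact: (measurable_fubini_F Iprod).
Qed.

Let Mf := \int[h]_x `|f x|.

Let Mf0 : 0 <= Mf. Proof. exact: Rintegral_ge0. Qed.

Lemma alph_bound s : `|alph s| <= Cf * Mf * (s.2 <= T)%R%:R.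
Proof.
rewrite mulrAC -RintegralZl//; last exact: rint_absf.
apply: normr_Rintegral_le => //; first by apply: rintZ; exact: rint_absf.
by move=> x; rewrite mulrAC; exact: (ga0_bound (s, x)).
Qed.

Let alph_bound1 s : `|alph s| <= Cf * Mf.
Proof. by rewrite (le_trans (alph_bound s))// ler_piMr ?mulr_ge0// lern1 leq_b1. Qed.

Definition ga (z : X * T') : R := ga0 z - alph z.1.

Lemma measurable_ga : measurable_fun setT ga.
Proof.
apply: measurable_funB => //.
by apply: (measurableT_comp measurable_alph); exact: measurable_fst.
Qed.

Lemma ga_bound s x : `|ga (s, x)| <= Cf * (`|f x| + Mf).
Proof.
rewrite (le_trans (ler_normB _ _))// mulrDr lerD//; exact: (ga0_bound1 (s, x)).
Qed.

Lemma ga_mean s : \int[h]_x ga (s, x) = 0.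
Proof.
rewrite /ga /= RintegralB; [|by []|exact: Iga0|exact: rint_cst].
by rewrite probability_cst subrr.
Qed.

(** The weight depends on [h], the flow and the observable but not on the samples. Integrating the
    fields of the particle system against it thus preserves the form of an average over independent
    samples. *)
Lemma adjoint_weight : exists (W : X -> R) (C : R),
  [/\ measurable_fun setT W, forall x, `|W x| <= C &
      forall s, W s = alph s + \int[lam2 T]_u (W u * kern (u, s))].
Proof.
apply: (@volterra _ T Cg (Cf * Mf)) => //.
- by rewrite mulr_ge0.
- exact: measurable_kern.
- exact: measurable_alph.
- exact: kern_bound.
- exact: alph_bound.
Qed.

End observable.
End mean_field.

(** * Pathwise expansion through the adjoint weight *)

Section adjoint_expansion.
Context (R : realType).
Variable T : R.
Hypothesis T0 : 0 <= T.
Let X := (bool * measurableTypeR R)%type.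
Variables (e A ga al W : X -> R) (k g : X * X -> R) (be bA bga bal bW bk bg : R).
Hypotheses (me : measurable_fun setT e) (mA : measurable_fun setT A).
Hypotheses (mga : measurable_fun setT ga) (mal : measurable_fun setT al).
Hypotheses (mW : measurable_fun setT W).
Hypotheses (mk : measurable_fun setT k) (mg : measurable_fun setT g).
Hypotheses (ebd : forall x, `|e x| <= be) (Abd : forall x, `|A x| <= bA).
Hypotheses (gabd : forall x, `|ga x| <= bga) (albd : forall x, `|al x| <= bal).
Hypotheses (Wbd : forall x, `|W x| <= bW).
Hypotheses (kbd : forall z, `|k z| <= bk) (gbd : forall z, `|g z| <= bg).
Hypothesis WE : forall s, W s = al s + \int[lam2 T]_u (W u * k (u, s)).
Variables (V rV rE : R).
Hypothesis VE : `|V - \int[lam2 T]_s (e s * (al s + ga s))| <= rV.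
Hypothesis eE : forall u, 0 <= u.2 <= T ->
  `|e u - A u - \int[lam2 T]_s (e s * (k (u, s) + g (u, s)))| <= rE.
Hypothesis rE0 : 0 <= rE.

Let rint_lam2 (q : X -> R) (M : R) : measurable_fun setT q -> (forall x, `|q x| <= M) ->
  rint (lam2 T) q.
Proof. exact: bounded_integrable. Qed.

Let lam2_cst (a : R) : \int[lam2 T]_x a = a * (2 * T).
Proof. by rewrite Rintegral_cst//= lam2_setT. Qed.

Let bW0 : 0 <= bW. Proof. exact: le_trans (normr_ge0 _) (Wbd (true, 0)). Qed.

Let mk1 u : measurable_fun setT (fun s => k (u, s)).
Proof. exact: (measurableT_comp mk (measurable_pair1 u)). Qed.

Let mg1 u : measurable_fun setT (fun s => g (u, s)).
Proof. exact: (measurableT_comp mg (measurable_pair1 u)). Qed.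

Let me2 : measurable_fun setT (fun z : X * X => e z.2).
Proof. exact: (measurableT_comp me measurable_snd). Qed.

Let bM (q1 q2 : X -> R) (b1 b2 : R) : (forall x, `|q1 x| <= b1) -> (forall x, `|q2 x| <= b2) ->
  forall x, `|q1 x * q2 x| <= b1 * b2.
Proof. by move=> H1 H2 x; rewrite normrM ler_pM. Qed.

Let Kx u := \int[lam2 T]_s (e s * k (u, s)).
Let Gx u := \int[lam2 T]_s (e s * g (u, s)).

Let mKx : measurable_fun setT Kx.
Proof.
apply: (@Rintegral_prod1 R _ _ _ _ (lam2 T) (lam2 T) (fun z => e z.2 * k z) (be * bk)).
  exact: measurable_funM.
by move=> z; rewrite normrM ler_pM.
Qed.

Let mGx : measurable_fun setT Gx.
Proof.
apply: (@Rintegral_prod1 R _ _ _ _ (lam2 T) (lam2 T) (fun z => e z.2 * g z) (be * bg)).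
  exact: measurable_funM.
by move=> z; rewrite normrM ler_pM.
Qed.

Let IKx u : rint (lam2 T) (fun s => e s * k (u, s)).
Proof. by apply: rint_lam2 (bM ebd (fun s => kbd (u, s))); exact: measurable_funM. Qed.

Let IGx u : rint (lam2 T) (fun s => e s * g (u, s)).
Proof. by apply: rint_lam2 (bM ebd (fun s => gbd (u, s))); exact: measurable_funM. Qed.

Let bKx u : `|Kx u| <= be * bk * (2 * T).
Proof.
rewrite -(lam2_setT T0); apply: Rintegral_bound (bM ebd (fun s => kbd (u, s))).
exact: measurable_funM.
Qed.

Let bGx u : `|Gx u| <= be * bg * (2 * T).
Proof.
rewrite -(lam2_setT T0); apply: Rintegral_bound (bM ebd (fun s => gbd (u, s))).
exact: measurable_funM.
Qed.

Let eps u := e u - A u - (Kx u + Gx u).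

Let eps_le u : 0 <= u.2 <= T -> `|eps u| <= rE.
Proof.
move=> uT; have := eE uT; rewrite /eps -RintegralD//; [|exact: IKx|exact: IGx].
by under eq_Rintegral do rewrite mulrDr.
Qed.

Let meps : measurable_fun setT eps.
Proof. by apply: measurable_funB; [exact: measurable_funB|exact: measurable_funD]. Qed.

Let Beps := be + bA + (be * bk * (2 * T) + be * bg * (2 * T)).

Let beps u : `|eps u| <= Beps.
Proof.
rewrite (le_trans (ler_normB _ _))// lerD//.
  by rewrite (le_trans (ler_normB _ _))// lerD.
by rewrite (le_trans (ler_normD _ _))// lerD.
Qed.

Let rintW (q : X -> R) (M : R) : measurable_fun setT q -> (forall x, `|q x| <= M) ->
  rint (lam2 T) (fun x => W x * q x).
Proof. by move=> mq bq; apply: rint_lam2 (bM Wbd bq); exact: measurable_funM. Qed.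

Let Ie_al : rint (lam2 T) (fun x => e x * al x).
Proof. by apply: rint_lam2 (bM ebd albd); exact: measurable_funM. Qed.

Let Ie_ga : rint (lam2 T) (fun x => e x * ga x).
Proof. by apply: rint_lam2 (bM ebd gabd); exact: measurable_funM. Qed.

Let IWe : rint (lam2 T) (fun x => W x * e x). Proof. exact: rintW ebd. Qed.

(** Fubini transfers the kernel from [e] to [W], and the equation of [W] replaces the resulting
    integral by W - al. *)
Let adjoint : \int[lam2 T]_u (W u * Kx u) =
  \int[lam2 T]_x (W x * e x) - \int[lam2 T]_x (e x * al x).
Proof.
transitivity (\int[lam2 T]_u \int[lam2 T]_s (W u * (e s * k (u, s)))).
  by apply: eq_Rintegral => u _; rewrite RintegralZl//; exact: IKx.
rewrite (@Rintegral_swap R _ _ _ _ (lam2 T) (lam2 T)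
  (fun z => W z.1 * (e z.2 * k z)) (bW * (be * bk))); last 2 first.
- apply: measurable_funM; last exact: measurable_funM.
  exact: (measurableT_comp mW measurable_fst).
- by move=> z; rewrite !normrM ler_pM// ler_pM.
rewrite -RintegralB//; apply: eq_Rintegral => s _ /=.
have -> : W s * e s - e s * al s = e s * \int[lam2 T]_u (W u * k (u, s)).
  by rewrite {1}WE; ring.
have mk2 : measurable_fun setT (fun u => k (u, s)).
  exact: (measurableT_comp mk (measurable_pair2 s)).
rewrite -RintegralZl//; last exact: (rintW mk2 (fun u => kbd (u, s))).
by apply: eq_Rintegral => u _; ring.
Qed.

Let rem := V - \int[lam2 T]_s (e s * (al s + ga s)).

Let main_identity : V - \int[lam2 T]_x (W x * A x) =
  rem + \int[lam2 T]_x (e x * ga x) + \int[lam2 T]_u (W u * Gx u)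
    + \int[lam2 T]_u (W u * eps u).
Proof.
have WA : \int[lam2 T]_x (W x * A x) = \int[lam2 T]_x (W x * e x) -
    \int[lam2 T]_u (W u * Kx u) - \int[lam2 T]_u (W u * Gx u) - \int[lam2 T]_u (W u * eps u).
  have IK := rintW mKx bKx; have IG := rintW mGx bGx; have Ie := rintW meps beps.
  have I1 := rintB IWe IK; have I2 := rintB I1 IG.
  rewrite -RintegralB// -RintegralB// -RintegralB//.
  by apply: eq_Rintegral => u _; rewrite /eps; ring.
have remE : V = rem + \int[lam2 T]_s (e s * al s) + \int[lam2 T]_s (e s * ga s).
  rewrite -addrA -RintegralD// /rem.
  rewrite -[LHS](subrK (\int[lam2 T]_s (e s * (al s + ga s)))); congr (_ + _).
  by apply: eq_Rintegral => s _; rewrite mulrDr.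
by rewrite WA adjoint {1}remE; ring.
Qed.

Let half (a b : R) : `|a * b| <= 2^-1 * (a ^+ 2 + b ^+ 2).
Proof.
rewrite normrM -[a ^+ 2]real_normK ?num_real// -[b ^+ 2]real_normK ?num_real//.
have : 0 <= (`|a| - `|b|) ^+ 2 by exact: sqr_ge0.
by nra.
Qed.

Let Ie2 : rint (lam2 T) (fun x => e x ^+ 2).
Proof. by apply: (@rint_lam2 (fun x => e x ^+ 2) _ _ (bM ebd ebd)); exact: measurable_funX. Qed.

Let bound_ga : `|\int[lam2 T]_x (e x * ga x)| <=
  2^-1 * (\int[lam2 T]_x (e x ^+ 2) + \int[lam2 T]_x (ga x ^+ 2)).
Proof.
have Iga2 : rint (lam2 T) (fun x => ga x ^+ 2).
  by apply: (@rint_lam2 (fun x => ga x ^+ 2) _ _ (bM gabd gabd)); exact: measurable_funX.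
rewrite -RintegralD// -RintegralZl//; last exact: rintD.
apply: normr_Rintegral_le => [||x]; [exact: Ie_ga| |exact: half].
by apply: rintZ; exact: rintD.
Qed.

Let bound_g : `|\int[lam2 T]_u (W u * Gx u)| <=
  bW / 2 * (2 * T * \int[lam2 T]_x (e x ^+ 2) + \int[lam22 T]_z (g z ^+ 2)).
Proof.
pose q u := \int[lam2 T]_s (g (u, s) ^+ 2).
have bq z : `|g z ^+ 2| <= bg * bg by rewrite normrM ler_pM.
have mg2 : measurable_fun setT (fun z => g z ^+ 2) by exact: measurable_funX.
have mq : measurable_fun setT q.
  exact: (@Rintegral_prod1 R _ _ _ _ (lam2 T) (lam2 T) (fun z => g z ^+ 2) (bg * bg)).
have mgu u : measurable_fun setT (fun s => g (u, s) ^+ 2) by exact: measurable_funX.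
have Iq1 u : rint (lam2 T) (fun s => g (u, s) ^+ 2).
  exact: (rint_lam2 (mgu u) (fun s => bq (u, s))).
have Iq : rint (lam2 T) q.
  apply: (@rint_lam2 _ (bg * bg * (2 * T))) => // u.
  by rewrite -(lam2_setT T0); apply: Rintegral_bound (fun s => bq (u, s)).
have Icst (a : R) : rint (lam2 T) (fun=> a) by apply: (@rint_lam2 _ `|a|).
set Q := \int[lam2 T]_x (e x ^+ 2).
apply: (@le_trans _ _ (\int[lam2 T]_u (bW / 2 * (Q + q u)))).
  apply: normr_Rintegral_le => [||u].
  - exact: rintW bGx.
  - by apply: rintZ; exact: rintD.
  rewrite normrM -mulrA ler_pM//.
  have -> : 2^-1 * (Q + q u) = \int[lam2 T]_s (2^-1 * (e s ^+ 2 + g (u, s) ^+ 2)).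
    have ID := rintD Ie2 (Iq1 u).
    by rewrite RintegralZl// RintegralD//; exact: Iq1.
  apply: normr_Rintegral_le; first exact: IGx.
    by apply: rintZ; exact: rintD.
  by move=> s; exact: half.
rewrite RintegralZl//; last exact: rintD.
have -> : \int[lam2 T]_x (Q + q x) = 2 * T * Q + \int[lam2 T]_x q x.
  by rewrite (RintegralD measurableT (Icst Q) Iq) lam2_cst mulrC.
by rewrite (@Rintegral_lam22 _ T (fun z => g z ^+ 2) (bg * bg)).
Qed.

Let bound_eps : `|\int[lam2 T]_u (W u * eps u)| <= bW * rE * (2 * T).
Proof.
have n0 : 0 <= bW * rE by rewrite mulr_ge0.
have B0 : 0 <= Beps := le_trans (normr_ge0 _) (beps (true, 0)).
rewrite -lam2_cst.
apply: (@normr_Rintegral_lam2_le _ T _ _ (bW * Beps + bW * rE)).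
- exact: measurable_funM.
- by [].
- by move=> x; rewrite (@le_trans _ _ (bW * Beps))// ?lerDl// normrM ler_pM.
- by move=> x; rewrite ger0_norm// lerDr mulr_ge0.
- by move=> x xT; rewrite normrM ler_pM//; exact: eps_le.
Qed.

(* Substituting the equation of [W] for [al] and then that of [e] makes the terms
   containing [k] cancel; what is left is quadratic. *)
Lemma adjoint_expansion : `|V - \int[lam2 T]_x (W x * A x)| <=
  rV + 2^-1 * (\int[lam2 T]_x (e x ^+ 2) + \int[lam2 T]_x (ga x ^+ 2)) +
  bW / 2 * (2 * T * \int[lam2 T]_x (e x ^+ 2) + \int[lam22 T]_z (g z ^+ 2)) +
  bW * rE * (2 * T).
Proof.
rewrite main_identity.
apply: le_trans (ler_normD _ _) _; apply: lerD => //.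
apply: le_trans (ler_normD _ _) _; apply: lerD => //.
by apply: le_trans (ler_normD _ _) _; apply: lerD; first exact: VE.
Qed.

End adjoint_expansion.

Section finite_average.
Context (R : realType) (n : nat).
Implicit Types F G : 'I_n.+1 -> R.

Definition av F : R := n.+1%:R^-1 * \sum_(j < n.+1) F j.

Lemma avD F G : av (fun j => F j + G j) = av F + av G.
Proof. by rewrite /av big_split mulrDr. Qed.

Lemma avZ c F : av (fun j => c * F j) = c * av F.
Proof. by rewrite /av -mulr_sumr mulrCA. Qed.

Lemma avB F G : av (fun j => F j - G j) = av F - av G.
Proof. by rewrite /av sumrB mulrBr. Qed.

Lemma av_cst c : av (fun=> c) = c.
Proof. by rewrite /av sumr_const card_ord -[c *+ _]mulr_natl mulrA mulVf ?mul1r. Qed.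

Lemma av_eq F G : F =1 G -> av F = av G.
Proof. by move=> FG; rewrite /av (eq_bigr _ (fun j _ => FG j)). Qed.

Lemma le_av F G : (forall j, F j <= G j) -> av F <= av G.
Proof. by move=> FG; rewrite /av ler_wpM2l ?invr_ge0// ler_sum. Qed.

Lemma ler_norm_av F : `|av F| <= av (fun j => `|F j|).
Proof.
by rewrite /av normrM ger0_norm ?invr_ge0// ler_wpM2l ?invr_ge0// ler_norm_sum.
Qed.

Lemma norm_av_le F G : (forall j, `|F j| <= G j) -> `|av F| <= av G.
Proof. by move=> FG; rewrite (le_trans (ler_norm_av F))// le_av. Qed.

Lemma cont_av (F : 'I_n.+1 -> R -> R) : (forall j, continuous (F j)) ->
  continuous (fun t => av (F ^~ t)).
Proof. by move=> cF; apply: contM; [exact: cont_cst|exact: cont_sum]. Qed.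

Lemma measurable_av d (Z : measurableType d) (F : 'I_n.+1 -> Z -> R) :
  (forall j, measurable_fun setT (F j)) -> measurable_fun setT (fun z => av (F ^~ z)).
Proof. by move=> mF; apply: measurable_funM => //; exact: measurable_sum. Qed.

Lemma Rintegral_av d (Z : measurableType d) (m : {measure set Z -> \bar R})
    (F : 'I_n.+1 -> Z -> R) : (forall j, rint m (F j)) ->
  \int[m]_z av (F ^~ z) = av (fun j => \int[m]_z F j z).
Proof.
move=> IF; rewrite /av RintegralZl//; last exact: rint_sum.
by rewrite Rintegral_sum.
Qed.

Lemma sqr_norm_le (x : R) : `|x| <= 2 -> `|x ^+ 2| <= 4.
Proof.
by move=> x2; rewrite normrX expr2 (_ : 4 = 2 * 2); [rewrite ler_pM|ring].
Qed.

End finite_average.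

(** * Estimates for one realization of the particle system *)

Section path.
Context d' (T' : measurableType d') (R : realType).
Variables (h : probability T' R) (K T : R) (om : T' -> R) (Y : T' -> R -> R).
Hypotheses (K0 : 0 <= K) (T0 : 0 <= T).
Hypothesis cY : forall x, continuous (Y x).
Hypothesis mY : forall b t, measurable_fun setT (fun x => trig b (Y x t)).
Let r := mean_trig h Y.
Hypothesis Yd : forall x t, 0 < t < T -> isd (Y x) t
  (om x + K * (r true t * dtrig true (Y x t) + r false t * dtrig false (Y x t))).
Variables (f : T' -> R) (k : R) (c : bool).
Hypothesis mf : measurable_fun setT f.
Hypothesis If4 : rint h (fun x => f x ^+ 4).
Hypothesis mkY : forall b, measurable_fun setT (fun x => trig b (k * Y x T)).

Variables (n : nat) (xi : 'I_n.+1 -> T') (th : 'I_n.+1 -> R -> R).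
Let rho b t := av (fun j => trig b (th j t)).
Hypothesis cth : forall j, continuous (th j).
Hypothesis th0 : forall j, th j 0 = Y (xi j) 0.
Hypothesis thd : forall j t, 0 < t < T -> isd (th j) t
  (om (xi j) + K * (rho true t * dtrig true (th j t) + rho false t * dtrig false (th j t))).

Let X := (bool * measurableTypeR R)%type.
Let pA := fA h Y.
Let pPsi := fPsi h K T Y.
Let pPhi := fPhi h K T Y.
Let pkern := kern h K T Y.
Let pgk := gk h K T Y.
Let pphi0 := phi0 h K T Y f k c.
Let palph := alph h K T Y f k c.
Let pga := ga h K T Y f k c.
Let c1 := displacement_const K T.
Let c2 := linearization_const K T.

Definition emp_fA (x : X) : R := av (fun j => pA (x, xi j)).
Definition emp_gk (z : X * X) : R := av (fun j => pgk (z, xi j)).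
Definition emp_ga (x : X) : R := av (fun j => pga (x, xi j)).
Let e b t := rho b t - r b t.
Let ex (x : X) : R := e x.1 x.2.
Let E (t : R) : R := `|e true t| + `|e false t|.
Let I := prim E.

Let cr b : continuous (r b). Proof. exact: cont_mean_trig. Qed.
Let r1 b t : `|r b t| <= 1. Proof. exact: mean_trig_max. Qed.

Let crho b : continuous (rho b).
Proof.
by apply: cont_av => j; apply: cont_comp => //; exact: cont_trig.
Qed.

Let ce b : continuous (e b). Proof. exact: contB. Qed.
Let cE : continuous E. Proof. by apply: contD; apply: cont_abs. Qed.
Let E0 t : 0 <= E t. Proof. exact: addr_ge0. Qed.
Let I0 t : 0 <= I t. Proof. exact: prim_ge0. Qed.
Let c10 : 0 <= c1. Proof. exact: displacement_const_ge0. Qed.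
Let c20 : 0 <= c2. Proof. exact: linearization_const_ge0. Qed.

Let e2 b t : `|e b t| <= 2.
Proof.
rewrite (le_trans (ler_normB _ _))// -[2]/(1 + 1)%R lerD//.
rewrite -(av_cst n (1 : R)); apply: norm_av_le => j; exact: trig_max.
Qed.

Let err j b (q t : R) : 0 <= t <= T ->
  `|trig b (q * th j t) - trig b (q * Y (xi j) t)| <= `|q| * c1 * I t.
Proof.
move=> tT.
exact (trig_error K0 cr crho (@cY (xi j)) (@cth j) r1 (@Yd (xi j)) (@thd j) (th0 j) b q tT).
Qed.

Let etaj j t := response K T r rho (Y (xi j)) t.

Let resp j b (q t : R) : 0 <= t <= T ->
  `|trig b (q * th j t) - trig b (q * Y (xi j) t) - q * dtrig b (q * Y (xi j) t) * etaj j t|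
    <= (q ^+ 2 * c1 ^+ 2 + `|q| * c2) * I t ^+ 2.
Proof.
move=> tT.
exact (trig_response K0 cr crho (@cY (xi j)) (@cth j) r1 (@Yd (xi j)) (@thd j) (th0 j) b q tT).
Qed.

(** The error of the empirical field is a centred average along the mean-field trajectories plus the
    average effect of the displacements. The latter is at most c1 times the accumulated error, which
    closes a Gronwall inequality for [I]. *)
Let eA b t : 0 <= t <= T -> `|e b t - emp_fA (b, t)| <= c1 * I t.
Proof.
move=> tT.
have -> : e b t - emp_fA (b, t) = av (fun j => trig b (1 * th j t) - trig b (1 * Y (xi j) t)).
  have -> : emp_fA (b, t) = av (fun j => trig b (Y (xi j) t)) - r b t.
    by rewrite -[X in _ - X](av_cst n) -avB.
  rewrite /e opprB addrA subrK -avB.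
  by apply: av_eq => j; rewrite !mul1r.
rewrite -(av_cst n (c1 * I t)); apply: norm_av_le => j.
by have := err j b 1 tT; rewrite normr1 (mul1r c1).
Qed.

Let cAx b : continuous (fun t => emp_fA (b, t)).
Proof.
apply: (@cont_av _ _ (fun j t => pA ((b, t), xi j))) => j.
apply: (@contB _ (fun t => trig b (Y (xi j) t)) (r b)) => //; exact: cont_trigY.
Qed.

Let H (t : R) : R := `|emp_fA (true, t)| + `|emp_fA (false, t)|.
Let cH : continuous H. Proof. by apply: contD; apply: cont_abs. Qed.

Let Ax2 x : `|emp_fA x| <= 2.
Proof. by rewrite -(av_cst n (2 : R)); apply: norm_av_le => j; exact: fA_bound. Qed.

Let mAx : measurable_fun setT emp_fA.
Proof.
apply: measurable_av => j.
by apply: (measurableT_comp (measurable_fA h cY mY)); exact: measurable_fun_pair.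
Qed.

Let IH : I T <= expR (2 * c1 * T) * prim H T.
Proof.
apply: gronwall_int => //; first by rewrite mulr_ge0.
  by move=> t; exact: addr_ge0.
move=> t tT.
have Hb b : `|e b t| <= `|emp_fA (b, t)| + c1 * I t.
  by rewrite -lerBlDl (le_trans _ (eA b tT))// lerB_dist.
have := Hb true; have := Hb false; rewrite /E /H -/(I t) -mulrA; lra.
Qed.

Definition energy_fA := \int[lam2 T]_x (emp_fA x ^+ 2).
Definition energy_gk := \int[lam22 T]_z (emp_gk z ^+ 2).
Definition energy_ga := \int[lam2 T]_x (emp_ga x ^+ 2).
Definition mean_absf := av (fun j => `|f (xi j)|).

Let TT : 0 <= T <= T. Proof. by rewrite T0 lexx. Qed.

Let primH : prim H T <= \int[lam2 T]_x `|emp_fA x|.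
Proof.
rewrite (@prim_lam2 _ T (fun b t => `|emp_fA (b, t)|) 2)//; last 2 first.
- by move=> b; apply: cont_abs; exact: cAx.
- by move=> b s; rewrite normr_id.
apply: (@le_Rintegral_lam2 _ _ _ _ 2) => //.
- apply: measurable_funM; last first.
    apply: (@measurable_time_component0 R (fun b t => `|emp_fA (b, t)|)) => b.
    by apply: cont_abs; exact: cAx.
  by apply: (@measurable_leb _ _ _ (fun x : X => x.2) (fun=> T)); [exact: measurable_snd|].
- by apply: measurableT_comp.
- move=> x; rewrite normrM normr_nat normr_id -[leRHS]mul1r ler_pM// ?lern1 ?leq_b1//.
- by move=> x; rewrite normr_id.
by move=> [b s] /= /andP[_ ->]; rewrite mul1r.
Qed.

(** The square of the Gronwall factor, times the total mass 2 T of [lam2] that comes from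
    Cauchy-Schwarz: it converts the squared accumulated error into the energy of the centred
    field. *)
Definition drift_const := expR (2 * c1 * T) ^+ 2 * (2 * T).

Lemma drift_const_ge0 : 0 <= drift_const. Proof. by rewrite mulr_ge0 ?mulr_ge0// sqr_ge0. Qed.

Let bAx2 x : `|emp_fA x ^+ 2| <= 4.
Proof. exact: sqr_norm_le. Qed.

Let I2 : I T ^+ 2 <= drift_const * energy_fA.
Proof.
have HI : I T <= expR (2 * c1 * T) * \int[lam2 T]_x `|emp_fA x|.
  by rewrite (le_trans IH)// ler_wpM2l ?expR_ge0// primH.
apply: (@le_trans _ _ ((expR (2 * c1 * T) * \int[lam2 T]_x `|emp_fA x|) ^+ 2)).
  by rewrite lerXn2r ?nnegrE// mulr_ge0 ?expR_ge0// Rintegral_ge0.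
rewrite exprMn /drift_const -[leRHS]mulrA ler_wpM2l ?sqr_ge0//.
have := @sqr_Rintegral_le _ _ _ (lam2 T) (fun x => `|emp_fA x|).
rewrite lam2_setT// => H2; apply: le_trans (H2 _ _) _.
- by apply: (@bounded_integrable _ _ _ _ _ 2) => [|x]; [exact: measurableT_comp|rewrite normr_id].
- apply: (@bounded_integrable _ _ _ _ _ 4) => [|x].
    by apply: measurable_funX; exact: measurableT_comp.
  by rewrite -normrX normr_id bAx2.
by rewrite /energy_fA; under eq_Rintegral do rewrite real_normK ?num_real//.
Qed.

Let mex : measurable_fun setT ex. Proof. exact: measurable_time_component0. Qed.

Let Imono t : 0 <= t <= T -> I t <= I T.
Proof.
move=> /andP[t0 tT]; rewrite -lerN2.
apply: (@derive_le0_le _ (fun u => - I u) (fun u => - E u)) => //.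
- by apply: contN; exact: prim_continuous.
- by move=> u /andP[su _]; apply: isdN; apply: prim_derive => //; exact: le_lt_trans su.
- by move=> u _; rewrite oppr_le0.
Qed.

(** From (x + y)^2 <= 2 x^2 + 2 y^2, with x the centred field and y the effect of the displacements,
    integrated over a total mass 2 T. *)
Definition defect_const := 2 + 2 * c1 ^+ 2 * drift_const * (2 * T).
Let Qe := \int[lam2 T]_x (ex x ^+ 2).

Lemma defect_const_ge0 : 0 <= defect_const.
Proof. by rewrite addr_ge0// !mulr_ge0 ?drift_const_ge0 ?sqr_ge0. Qed.

Let bex2 x : `|ex x ^+ 2| <= 4.
Proof. by apply: sqr_norm_le; exact: e2. Qed.

Let rint_lam2 (g : X -> R) (M : R) : measurable_fun setT g -> (forall x, `|g x| <= M) ->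
  rint (lam2 T) g.
Proof. exact: bounded_integrable. Qed.

Let lam2_cst (a : R) : \int[lam2 T]_x a = a * (2 * T).
Proof. by rewrite Rintegral_cst//= lam2_setT. Qed.

Let Qe_le : Qe <= defect_const * energy_fA.
Proof.
pose M := 8 + 2 * (c1 * I T) ^+ 2.
have M0 : 0 <= 2 * (c1 * I T) ^+ 2 by rewrite mulr_ge0// sqr_ge0.
apply: (@le_trans _ _ (\int[lam2 T]_x (2 * emp_fA x ^+ 2 + 2 * (c1 * I T) ^+ 2))).
  apply: (@le_Rintegral_lam2 _ _ _ _ M) => //.
  - exact: measurable_funX.
  - by apply: measurable_funD => //; apply: measurable_funM => //; exact: measurable_funX.
  - by move=> x; rewrite (le_trans (bex2 x))// /M; lra.
  - move=> x; rewrite ger0_norm; last by rewrite addr_ge0// mulr_ge0 ?sqr_ge0.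
    by rewrite lerD2r; have := bAx2 x; rewrite ger0_norm ?sqr_ge0//; lra.
  move=> [b s] /= sT; have H1 := eA b sT.
  have H2 : `|e b s - emp_fA (b, s)| <= c1 * I T.
    by rewrite (le_trans H1)// ler_wpM2l// Imono.
  have H3 : (e b s - emp_fA (b, s)) ^+ 2 <= (c1 * I T) ^+ 2.
    rewrite -[leLHS]real_normK ?num_real// lerXn2r ?nnegrE//.
    by rewrite mulr_ge0.
  rewrite /ex /=; have : 0 <= (e b s - 2 * emp_fA (b, s)) ^+ 2 by exact: sqr_ge0.
  by move: H3; nra.
rewrite RintegralD//; last 2 first.
- apply: (@rint_lam2 _ 8) => [|x]; first by apply: measurable_funM => //; exact: measurable_funX.
  by rewrite normrM ger0_norm//; have := bAx2 x; lra.
- by apply: (@rint_lam2 _ `|2 * (c1 * I T) ^+ 2|).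
rewrite RintegralZl//; last by apply: (@rint_lam2 _ 4) => [|x]; [exact: measurable_funX|exact: bAx2].
rewrite lam2_cst -/energy_fA /defect_const [leRHS]mulrDl lerD2l exprMn.
have -> : 2 * (c1 ^+ 2 * I T ^+ 2) * (2 * T) = 2 * c1 ^+ 2 * (2 * T) * I T ^+ 2 by ring.
have -> : 2 * c1 ^+ 2 * drift_const * (2 * T) * energy_fA = 2 * c1 ^+ 2 * (2 * T) * (drift_const * energy_fA) by ring.
apply: ler_wpM2l => //.
by apply: mulr_ge0; [apply: mulr_ge0 => //; exact: sqr_ge0|exact: mulr_ge0].
Qed.

(** First-order control without linearization. This is all that almost sure convergence requires,
    since the energy of the centred field tends to 0. *)
Lemma path_crude :
  `|av (fun j => f (xi j) * trig c (k * th j T)) - av (fun j => f (xi j) * trig c (k * Y (xi j) T))|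
    <= `|k| * c1 * mean_absf * I T /\ I T ^+ 2 <= drift_const * energy_fA.
Proof.
split; last exact: I2.
rewrite -avB (_ : `|k| * c1 * mean_absf * I T = `|k| * c1 * I T * mean_absf); last by ring.
rewrite /mean_absf -avZ; apply: norm_av_le => j.
rewrite -mulrBr normrM mulrC ler_wpM2r//.
exact: err.
Qed.

Let etaE j t : 0 <= t <= T -> etaj j t =
  response_factor K T r (Y (xi j)) t * \int[lam2 T]_x ((x.2 <= t)%R%:R * (ex x * pPsi (x, xi j))).
Proof.
move=> tT; rewrite /etaj /response; congr (_ * _).
apply: (@prim_lam2 _ T (fun b s => e b s * source K T r (Y (xi j)) b s) (2 * c1)) => //.
  by move=> b; apply: contM => //; apply: cont_source.
move=> b s; rewrite normrM ler_pM//; exact: (fPsi_bound h K0 T0 cY mY ((b, s), xi j)).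
Qed.

Let mPsi j : measurable_fun setT (fun x : X => pPsi (x, xi j)).
Proof. by apply: (measurableT_comp (measurable_fPsi h K T0 cY mY)); exact: measurable_fun_pair. Qed.

Let mgkx : measurable_fun setT emp_gk.
Proof.
apply: measurable_av => j.
by apply: (measurableT_comp (measurable_gk h K0 T0 cY mY)); exact: measurable_fun_pair.
Qed.

Let mgax : measurable_fun setT emp_ga.
Proof.
apply: measurable_av => j.
by apply: (measurableT_comp (measurable_ga K0 T0 cY mY c mf If4 mkY)); exact: measurable_fun_pair.
Qed.

Let bPsi j s : `|pPsi (s, xi j)| <= c1.
Proof. exact: (fPsi_bound h K0 T0 cY mY (s, xi j)). Qed.

Let mind t : measurable_fun setT (fun s : X => (s.2 <= t)%R%:R : R).
Proof. by apply: (@measurable_leb _ _ _ (fun x : X => x.2) (fun=> t)); [exact: measurable_snd|]. Qed.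

Let rint_resp j t : rint (lam2 T) (fun s : X => (s.2 <= t)%R%:R * (ex s * pPsi (s, xi j))).
Proof.
apply: (@rint_lam2 _ (2 * c1)) => [|s].
  by apply: measurable_funM => //; exact: measurable_funM.
rewrite normrM normr_nat -[leRHS]mul1r ler_pM// ?lern1 ?leq_b1//.
by rewrite normrM ler_pM//; exact: e2.
Qed.

Let response_av (F : 'I_n.+1 -> R) t :
  \int[lam2 T]_s (ex s * av (fun j => (s.2 <= t)%R%:R * (F j * pPsi (s, xi j)))) =
  av (fun j => F j * \int[lam2 T]_s ((s.2 <= t)%R%:R * (ex s * pPsi (s, xi j)))).
Proof.
transitivity (\int[lam2 T]_s av (fun j => F j * ((s.2 <= t)%R%:R * (ex s * pPsi (s, xi j))))).
  by apply: eq_Rintegral => s _; rewrite -avZ; apply: av_eq => j; ring.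
rewrite Rintegral_av; last by move=> j; exact: rintZ.
by apply: av_eq => j; rewrite RintegralZl//; exact: rint_resp.
Qed.

Definition field_rem_const := displacement_const K T ^+ 2 + linearization_const K T.

Let kern_gkx u s : pkern (u, s) + emp_gk (u, s) =
  av (fun j => (s.2 <= u.2)%R%:R * (pPhi (u, xi j) * pPsi (s, xi j))).
Proof.
rewrite /emp_gk -[pkern _](av_cst n) -avD; apply: av_eq => j.
by rewrite /pgk /gk /= addrC subrK.
Qed.

Let eps (u : X) := ex u - emp_fA u - \int[lam2 T]_s (ex s * (pkern (u, s) + emp_gk (u, s))).

Let I2t t : 0 <= t <= T -> I t ^+ 2 <= I T ^+ 2.
Proof. by move=> tT; rewrite lerXn2r ?nnegrE//; exact: Imono. Qed.

(** The empirical field is itself an observable, of frequency 1 and amplitude 1. Its linear response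
    produces [kern] and [gk], so [e] satisfies a Volterra equation up to a quadratic remainder. *)
Let eps_bound u : 0 <= u.2 <= T -> `|eps u| <= field_rem_const * I T ^+ 2.
Proof.
case: u => b t /= tT; rewrite /eps.
have -> : \int[lam2 T]_s (ex s * (pkern ((b, t), s) + emp_gk ((b, t), s))) =
    \int[lam2 T]_s (ex s * av (fun j => (s.2 <= t)%R%:R *
      (pPhi ((b, t), xi j) * pPsi (s, xi j)))).
  by apply: eq_Rintegral => s _; rewrite kern_gkx.
rewrite response_av.
have -> : ex (b, t) - emp_fA (b, t) = av (fun j => trig b (1 * th j t) - trig b (1 * Y (xi j) t)).
  have -> : emp_fA (b, t) = av (fun j => trig b (Y (xi j) t)) - r b t.
    by rewrite -[X in _ - X](av_cst n) -avB.
  rewrite /ex /e opprB addrA subrK -avB.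
  by apply: av_eq => j; rewrite !mul1r.
rewrite -avB.
apply: (@le_trans _ _ (field_rem_const * I t ^+ 2)); last first.
  by rewrite ler_wpM2l ?I2t// addr_ge0 ?sqr_ge0.
rewrite -(av_cst n (field_rem_const * _)); apply: norm_av_le => j.
have := resp j b 1 tT; rewrite etaE// expr1n normr1 !(mul1r, mul1r (c1 ^+ 2), mul1r c2) /pPhi /fPhi /= !mulrA.
by rewrite -/field_rem_const.
Qed.

Let Vdiff := av (fun j => f (xi j) * trig c (k * th j T)) -
  av (fun j => f (xi j) * trig c (k * Y (xi j) T)).

Definition obs_rem_const := k ^+ 2 * displacement_const K T ^+ 2 + `|k| * linearization_const K T.

Let alph_gax s : palph s + emp_ga s =
  av (fun j => (s.2 <= T)%R%:R * (pphi0 (xi j) * pPsi (s, xi j))).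
Proof.
rewrite /emp_ga -[palph _](av_cst n) -avD; apply: av_eq => j.
by rewrite /pga /ga /= addrC subrK.
Qed.

Let rem := Vdiff - \int[lam2 T]_s (ex s * (palph s + emp_ga s)).

Let rem_bound : `|rem| <= obs_rem_const * mean_absf * I T ^+ 2.
Proof.
have E1 : \int[lam2 T]_s (ex s * (palph s + emp_ga s)) =
    \int[lam2 T]_s (ex s * av (fun j => (s.2 <= T)%R%:R * (pphi0 (xi j) * pPsi (s, xi j)))).
  by apply: eq_Rintegral => s _; rewrite alph_gax.
rewrite /rem E1 response_av /Vdiff -!avB mulrAC /mean_absf -avZ; apply: norm_av_le => j.
have := resp j c k TT; rewrite etaE// -/obs_rem_const => H4.
set J := Rintegral _ _ _ in H4 *.
have -> : f (xi j) * trig c (k * th j T) - f (xi j) * trig c (k * Y (xi j) T) - pphi0 (xi j) * J =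
  f (xi j) * (trig c (k * th j T) - trig c (k * Y (xi j) T) -
    k * dtrig c (k * Y (xi j) T) * (response_factor K T r (Y (xi j)) T * J)).
  by rewrite /pphi0 /phi0; ring.
by rewrite normrM mulrC ler_wpM2r.
Qed.

Variables (W : X -> R) (CW : R).
Hypothesis mW : measurable_fun setT W.
Hypothesis bW : forall x, `|W x| <= CW.
Hypothesis WE : forall s, W s = palph s + \int[lam2 T]_u (W u * pkern (u, s)).

Let CW0 : 0 <= CW. Proof. exact: le_trans (normr_ge0 _) (bW (true, 0)). Qed.

Let cg := expR (2 * K * T) * displacement_const K T.

Let bkern z : `|pkern z| <= cg.
Proof.
case: z => u s; rewrite (le_trans (kern_bound h K0 T0 cY mY u s))//.
by rewrite ler_piMr ?lern1 ?leq_b1// mulr_ge0 ?expR_ge0.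
Qed.

Let bgkx z : `|emp_gk z| <= 2 * cg.
Proof.
rewrite -(av_cst n (2 * cg)); apply: norm_av_le => j.
exact: (gk_bound h K0 T0 cY mY (z, xi j)).
Qed.

Let bf := av (fun j => `|k| * expR (2 * K * T) * displacement_const K T * (`|f (xi j)| + \int[h]_x `|f x|)).

Let bgax s : `|emp_ga s| <= bf.
Proof. by apply: norm_av_le => j; exact: (ga_bound K0 T0 cY mY c mf If4 mkY s (xi j)). Qed.

Let balph s : `|palph s| <= `|k| * expR (2 * K * T) * displacement_const K T * \int[h]_x `|f x|.
Proof.
rewrite (le_trans (alph_bound K0 T0 cY mY c mf If4 mkY s))// ler_piMr// ?lern1 ?leq_b1//.
by rewrite mulr_ge0 ?Rintegral_ge0// mulr_ge0// mulr_ge0// expR_ge0.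
Qed.

(** The three coefficients of the energy of the centred field come, in order, from pairing [e] with
    [emp_ga], from pairing it with [emp_gk] under the weight, and from the remainder of the equation
    of [e]. *)
Definition path_const (CW : R) := defect_const / 2 + CW * T * defect_const + 2 * T * CW * field_rem_const * drift_const.

(** Each term on the right is quadratic in centred averages. One of them carries in addition the
    factor [mean_absf], which is random and not small; it has to be separated from the energy before
    expectations are taken. *)
Lemma path_expansion : `|Vdiff - \int[lam2 T]_x (W x * emp_fA x)| <=
  path_const CW * energy_fA + energy_ga / 2 + obs_rem_const * drift_const * (mean_absf * energy_fA) + CW / 2 * energy_gk.
Proof.
have c30 : 0 <= field_rem_const by rewrite addr_ge0 ?sqr_ge0.
have c40 : 0 <= obs_rem_const by apply: addr_ge0; apply: mulr_ge0; rewrite ?sqr_ge0.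
have M0 : 0 <= mean_absf by rewrite mulr_ge0 ?invr_ge0// sumr_ge0.
have rE0 : 0 <= field_rem_const * I T ^+ 2 by rewrite mulr_ge0 ?sqr_ge0.
have ex2 x : `|ex x| <= 2 by exact: e2.
have mal : measurable_fun setT palph := measurable_alph K0 T0 cY mY c mf If4 mkY.
have mk : measurable_fun setT pkern := measurable_kern h K0 T0 cY mY.
apply: le_trans (adjoint_expansion T0 mex mAx mgax mal mW mk mgkx ex2 Ax2 bgax balph bW
  bkern bgkx WE rem_bound eps_bound rE0) _.
rewrite -/Qe -/energy_ga -/energy_gk.
have B1 : obs_rem_const * mean_absf * I T ^+ 2 <= obs_rem_const * drift_const * (mean_absf * energy_fA).
  rewrite (_ : obs_rem_const * drift_const * (mean_absf * energy_fA) = obs_rem_const * mean_absf * (drift_const * energy_fA)); last by ring.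
  by rewrite ler_wpM2l// mulr_ge0.
have B2 : 2^-1 * (Qe + energy_ga) <= defect_const / 2 * energy_fA + energy_ga / 2.
  by rewrite mulrDr (mulrC _ energy_ga) lerD2r mulrC mulrAC ler_pM2r ?invr_gt0.
have B3 : CW / 2 * (2 * T * Qe + energy_gk) <= CW * T * defect_const * energy_fA + CW / 2 * energy_gk.
  rewrite mulrDr lerD2r.
  rewrite (_ : CW / 2 * (2 * T * Qe) = CW * T * Qe); last by field.
  by rewrite -(mulrA _ defect_const) ler_wpM2l// mulr_ge0.
have B4 : CW * (field_rem_const * I T ^+ 2) * (2 * T) <= 2 * T * CW * field_rem_const * drift_const * energy_fA.
  rewrite (_ : CW * (field_rem_const * I T ^+ 2) * (2 * T) = 2 * T * CW * field_rem_const * I T ^+ 2); last by ring.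
  rewrite -(mulrA _ drift_const) ler_wpM2l//.
  by rewrite mulr_ge0// mulr_ge0// mulr_ge0.
rewrite /path_const; lra.
Qed.

End path.

(** * Expectations of the pathwise bounds *)

Section expectation_bounds.
Context d (T : measurableType d) (R : realType) (P : probability T R).

(** Measurability and nonnegativity accompany the bound because additivity and monotonicity of the
    extended integral are used under these conditions. Bounds on expectations can then be assembled
    term by term. *)
Definition ebound (g : T -> R) (b : R) : Prop :=
  [/\ measurable_fun setT g, forall a, 0 <= g a & (\int[P]_a (g a)%:E <= b%:E)%E].

Lemma ebD g1 g2 b1 b2 : ebound g1 b1 -> ebound g2 b2 ->
  ebound (fun a => g1 a + g2 a) (b1 + b2).
Proof.
move=> [m1 p1 I1] [m2 p2 I2]; split => [|a|]; first exact: measurable_funD.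
  exact: addr_ge0.
under eq_integral do rewrite EFinD.
rewrite ge0_integralD//; first by rewrite EFinD leeD.
- by move=> a _; rewrite lee_fin.
- exact/measurable_EFinP.
- by move=> a _; rewrite lee_fin.
- exact/measurable_EFinP.
Qed.

Lemma ebZ (k : R) g b : 0 <= k -> ebound g b -> ebound (fun a => k * g a) (k * b).
Proof.
move=> k0 [m1 p1 I1]; split => [|a|]; first exact: measurable_funM.
  exact: mulr_ge0.
under eq_integral do rewrite EFinM.
rewrite ge0_integralZl//; last 2 first.
- exact/measurable_EFinP.
- by move=> a _; rewrite lee_fin.
by rewrite EFinM lee_wpmul2l.
Qed.

Lemma eb_le (g1 g2 : T -> R) b : measurable_fun setT g1 -> (forall a, 0 <= g1 a) ->
  (forall a, g1 a <= g2 a) -> ebound g2 b -> ebound g1 b.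
Proof.
move=> m1 p1 g12 [m2 p2 I2]; split=> //; apply: le_trans I2.
apply: ge0_le_integral => //.
- by move=> a _; rewrite lee_fin.
- exact/measurable_EFinP.
- exact/measurable_EFinP.
- by move=> a _; rewrite lee_fin.
Qed.

Lemma eb_cst (k : R) : 0 <= k -> ebound (fun=> k) k.
Proof.
by move=> k0; split=> //; rewrite integral_cst//= (@probability_setT _ _ _ P) mule1.
Qed.

Lemma eb_weak g (b b' : R) : b <= b' -> ebound g b -> ebound g b'.
Proof. by move=> bb [m1 p1 I1]; split=> //; rewrite (le_trans I1)// lee_fin. Qed.

End expectation_bounds.

Section particle_system.
Context d d' (T : measurableType d) (T' : measurableType d') (R : realType).
Variables (P : probability T R) (h : probability T' R).
Variable X : nat -> {RV P >-> T'}.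
Hypothesis iX : mutually_independent X.
Hypothesis dX : identically_distributed X h.
Variables (K t : R) (om : T' -> R) (Y : T' -> R -> R).
Hypotheses (K0 : 0 <= K) (t0 : 0 <= t).
Hypothesis cY : forall x, continuous (Y x).
Hypothesis mY : forall b s, measurable_fun setT (fun x => trig b (Y x s)).
Let r := mean_trig h Y.
Hypothesis Yd : forall x s, 0 < s < t -> isd (Y x) s
  (om x + K * (r true s * dtrig true (Y x s) + r false s * dtrig false (Y x s))).
Variables (f : T' -> R) (k : R) (c : bool).
Hypothesis mf : measurable_fun setT f.
Hypothesis If4 : rint h (fun x => f x ^+ 4).
Hypothesis mkY : forall b, measurable_fun setT (fun x => trig b (k * Y x t)).
Variable th : forall n : nat, T -> 'I_n.+1 -> R -> R.
Let rho n a b s := av (fun j : 'I_n.+1 => trig b (th a j s)).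
Hypothesis cth : forall n a (j : 'I_n.+1), continuous (th a j).
Hypothesis th0 : forall n a (j : 'I_n.+1), th a j 0 = Y (X j a) 0.
Hypothesis thd : forall n a (j : 'I_n.+1) s, 0 < s < t -> isd (th a j) s
  (om (X j a) + K * (rho n a true s * dtrig true (th a j s) +
                     rho n a false s * dtrig false (th a j s))).
Hypothesis mth : forall n (j : 'I_n.+1), measurable_fun setT (fun a => trig c (k * th a j t)).

Let obs (x : T') : R := f x * trig c (k * Y x t).
Let E0 := \int[h]_x obs x.
Definition fluct n a : R := av (fun j : 'I_n.+1 => f (X j a) * trig c (k * th a j t)) - E0.

Let mobs : measurable_fun setT obs. Proof. exact: measurable_funM. Qed.

Let Iabsf : rint h (fun x => `|f x|).
Proof. exact: rint_absf. Qed.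

Let Iobs : rint h obs.
Proof.
apply: (rint_le _ _ Iabsf) => // x.
by rewrite normrM ler_piMr// trig_max.
Qed.

Let m0 := \int[h]_x `|f x|.

Let m00 : 0 <= m0. Proof. exact: Rintegral_ge0. Qed.

Let IB (M : R) : 0 <= M -> rint h (fun x => (`|f x| + M) ^+ 4).
Proof.
move=> M0.
have I : rint h (fun x => 8 * f x ^+ 4 + 8 * M ^+ 4).
  by apply: rintD; [exact: rintZ|exact: rint_cst].
apply: (rint_le _ _ I) => [|x].
  by apply: measurable_funX; apply: measurable_funD => //; exact: measurableT_comp.
rewrite ger0_norm ?exprn_ge0 ?addr_ge0//.
have -> : f x ^+ 4 = `|f x| ^+ 4 by rewrite -[4%N]/(2 * 2)%N !exprM real_normK ?num_real.
have := normr_ge0 (f x); set u := `|f x| => u0.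
have H1 : (u + M) ^+ 2 <= 2 * (u ^+ 2 + M ^+ 2).
  by have := sqr_ge0 (u - M); nra.
have H2 : (u ^+ 2 + M ^+ 2) ^+ 2 <= 2 * (u ^+ 4 + M ^+ 4).
  by have := sqr_ge0 (u ^+ 2 - M ^+ 2); nra.
apply: (@le_trans _ _ ((2 * (u ^+ 2 + M ^+ 2)) ^+ 2)).
  rewrite -[4%N]/(2 * 2)%N exprM lerXn2r ?nnegrE ?sqr_ge0//.
  by rewrite mulr_ge0 ?addr_ge0 ?sqr_ge0.
by rewrite exprMn; lra.
Qed.

Let mB (M : R) : measurable_fun setT (fun x => `|f x| + M).
Proof. by apply: measurable_funD => //; exact: measurableT_comp. Qed.

Let xi n a (j : 'I_n.+1) := X j a.
Arguments xi : clear implicits.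

Let eb_favg2 dz (Z : measurableType dz) (nu : {finite_measure set Z -> \bar R})
    (g : Z * T' -> R) (B : T' -> R) : measurable_fun setT g -> measurable_fun setT B ->
  (forall z x, `|g (z, x)| <= B x) -> rint h (fun x => B x ^+ 4) ->
  (forall z, \int[h]_x g (z, x) = 0) ->
  exists C : R, 0 <= C /\ forall n,
    ebound P (fun a => \int[nu]_z (favg X g n z a ^+ 2)) (C / n.+1%:R).
Proof.
move=> mg mB' gB IB' g0; exists ((\int[h]_x (B x ^+ 2)) * fine (nu setT)).
split.
  apply: mulr_ge0; last exact: fine_ge0.
  by apply: Rintegral_ge0 => x _; exact: sqr_ge0.
move=> n; split.
- apply: measurableT_comp => //.
  apply: (@measurable_fun_fubini_tonelli_F _ _ _ _ _ nu
    (fun w : T * Z => (favg X g n w.2 w.1 ^+ 2)%:E)) => [|w].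
    by apply/measurable_EFinP; apply: measurable_funX; exact: measurable_favg.
  by rewrite lee_fin sqr_ge0.
- by move=> a; apply: Rintegral_ge0 => z _; exact: sqr_ge0.
rewrite (eq_integral (fun a => (\int[nu]_z (favg X g n z a ^+ 2)%:E)%E)); last first.
  by move=> a _; rewrite Rintegral_EFin//; exact: (rint_favg X nu mg gB).
exact: favg_moment2.
Qed.

Let eb_favg4 dz (Z : measurableType dz) (nu : {finite_measure set Z -> \bar R})
    (g : Z * T' -> R) (B : T' -> R) : measurable_fun setT g -> measurable_fun setT B ->
  (forall z x, `|g (z, x)| <= B x) -> rint h (fun x => B x ^+ 4) ->
  (forall z, \int[h]_x g (z, x) = 0) ->
  exists C : R, 0 <= C /\ forall n,
    ebound P (fun a => \int[nu]_z (favg X g n z a ^+ 4)) (C / n.+1%:R ^+ 2).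
Proof.
move=> mg mB' gB IB' g0.
have p4 (x : R) : 0 <= x ^+ 4 by rewrite exprn_even_ge0.
exists ((3 * (\int[h]_x (B x ^+ 2)) ^+ 2 + \int[h]_x (B x ^+ 4)) * fine (nu setT)).
split.
  apply: mulr_ge0; last exact: fine_ge0.
  by rewrite addr_ge0 ?Rintegral_ge0// mulr_ge0 ?sqr_ge0.
move=> n; split.
- apply: measurableT_comp => //.
  apply: (@measurable_fun_fubini_tonelli_F _ _ _ _ _ nu
    (fun w : T * Z => (favg X g n w.2 w.1 ^+ 4)%:E)) => [|w].
    by apply/measurable_EFinP; apply: measurable_funX; exact: measurable_favg.
  by rewrite lee_fin.
- by move=> a; apply: Rintegral_ge0 => z _.
rewrite (eq_integral (fun a => (\int[nu]_z (favg X g n z a ^+ 4)%:E)%E)); last first.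
  by move=> a _; rewrite Rintegral_EFin//; exact: (rint_favg X nu mg gB).
exact: favg_moment4.
Qed.

Let eb_avg4 (g B : T' -> R) : measurable_fun setT g -> measurable_fun setT B ->
  (forall x, `|g x| <= B x) -> rint h (fun x => B x ^+ 4) -> \int[h]_x g x = 0 ->
  exists C : R, 0 <= C /\ forall n,
    ebound P (fun a => avg X g n a ^+ 4) (C / n.+1%:R ^+ 2) /\
    ebound P (fun a => avg X g n a ^+ 2) (C / n.+1%:R).
Proof.
move=> mg mB' gB IB' g0.
have p4 (x : R) : 0 <= x ^+ 4 by rewrite exprn_even_ge0.
have q0 : 0 <= \int[h]_x (B x ^+ 2) by apply: Rintegral_ge0 => x _; exact: sqr_ge0.
pose C := 3 * (\int[h]_x (B x ^+ 2)) ^+ 2 + \int[h]_x (B x ^+ 4).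
have C0 : 0 <= C by rewrite addr_ge0 ?Rintegral_ge0// mulr_ge0 ?sqr_ge0.
exists (C + \int[h]_x (B x ^+ 2)); split; first exact: addr_ge0.
move=> n; have [I4 I2 M2 M4] := avg_moments iX dX n mg mB' gB IB' g0.
have ma := measurable_avg X n mg.
split; split.
- exact: measurable_funX.
- by [].
- rewrite -Rintegral_EFin// lee_fin (le_trans M4)// ler_wpM2r ?invr_ge0 ?sqr_ge0//.
  by rewrite lerDl.
- exact: measurable_funX.
- by move=> a; exact: sqr_ge0.
- by rewrite -Rintegral_EFin// lee_fin (le_trans M2)// ler_wpM2r ?invr_ge0// lerDr.
Qed.

Let A2 : exists C : R, 0 <= C /\ forall n,
  ebound P (fun a => energy_fA h t Y (xi n a)) (C / n.+1%:R).
Proof.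
apply: (@eb_favg2 _ _ (lam2 t) (fA h Y) (fun=> 2)) => //.
- exact: measurable_fA.
- by move=> z x; exact: fA_bound.
- exact: rint_cst.
- exact: fA_mean.
Qed.

Let Q4 n a := \int[lam2 t]_x (emp_fA h Y (xi n a) x ^+ 4).

Let A4 : exists C : R, 0 <= C /\ forall n, ebound P (Q4 n) (C / n.+1%:R ^+ 2).
Proof.
apply: (@eb_favg4 _ _ (lam2 t) (fA h Y) (fun=> 2)) => //.
- exact: measurable_fA.
- by move=> z x; exact: fA_bound.
- exact: rint_cst.
- exact: fA_mean.
Qed.

(** Cauchy-Schwarz over the total mass 2 t. The expectation of the squared energy is thus of order
    N^-2, which is what both the weighted product in the linear expansion and the almost sure limit
    need. *)
Let QA_sqr n a : energy_fA h t Y (xi n a) ^+ 2 <= 2 * t * Q4 n a.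
Proof.
have bA z x : `|fA h Y (z, x)| <= 2 by exact: fA_bound.
have := @sqr_Rintegral_le _ _ _ (lam2 t) (fun x => emp_fA h Y (xi n a) x ^+ 2).
rewrite lam2_setT// => H; apply: le_trans (H _ _) _.
- exact: (rint_favg X (lam2 t) (measurable_fA h cY mY) bA n 2 a).
- apply: rint_eq (rint_favg X (lam2 t) (measurable_fA h cY mY) bA n 4 a) => x.
  by rewrite -exprM.
rewrite ler_wpM2l ?mulr_ge0//.
by under eq_Rintegral do rewrite -exprM.
Qed.

Let Ak : exists C : R, 0 <= C /\ forall n,
  ebound P (fun a => energy_gk h K t Y (xi n a)) (C / n.+1%:R).
Proof.
apply: (@eb_favg2 _ _ (lam22 t) (gk h K t Y) (fun=> 2 * (expR (2 * K * t) * displacement_const K t))) => //.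
- exact: measurable_gk.
- by move=> z x; exact: gk_bound.
- exact: rint_cst.
- exact: gk_mean.
Qed.

Let Aa : exists C : R, 0 <= C /\ forall n,
  ebound P (fun a => energy_ga h K t Y f k c (xi n a)) (C / n.+1%:R).
Proof.
apply: (@eb_favg2 _ _ (lam2 t) (ga h K t Y f k c)
  (fun x => `|k| * expR (2 * K * t) * displacement_const K t * (`|f x| + m0))).
- exact: measurable_ga.
- by apply: measurable_funM.
- by move=> z x; exact: ga_bound.
- have := rintZ ((`|k| * expR (2 * K * t) * displacement_const K t) ^+ 4) (IB m00).
  by apply: rint_eq => x; rewrite -exprMn.
- exact: ga_mean.
Qed.

Let absf0 x : `| `|f x| - m0 | <= `|f x| + m0.
Proof. by have := ler_normB `|f x| m0; rewrite normr_id (ger0_norm m00). Qed.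

Let mabsf0 : measurable_fun setT (fun x => `|f x| - m0).
Proof. by apply: measurable_funB => //; exact: measurableT_comp. Qed.

Let absf0_mean : \int[h]_x (`|f x| - m0) = 0.
Proof. by rewrite RintegralB//; [rewrite probability_cst subrr|exact: rint_cst]. Qed.

Let MfE n a : mean_absf f (xi n a) = avg X (fun x => `|f x| - m0) n a + m0.
Proof.
have : avg X (fun x => `|f x| - m0) n a = av (fun j : 'I_n.+1 => `|f (X j a)| - m0) by [].
by move=> ->; rewrite avB av_cst subrK.
Qed.

(** The average of |f| is split into its centred part, controlled by moments, and its mean [m0]. It
    stays bounded in L^2 without tending to 0. *)
Let AM : exists C : R, 0 <= C /\ forall n, ebound P (fun a => mean_absf f (xi n a) ^+ 2) C.
Proof.
have [C [C0 HC]] := eb_avg4 mabsf0 (mB m0) absf0 (IB m00) absf0_mean.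
exists (2 * C + 2 * m0 ^+ 2); split; first by rewrite addr_ge0 ?mulr_ge0 ?sqr_ge0.
move=> n; have [_ H2] := HC n.
have H2' : ebound P (fun a => avg X (fun x => `|f x| - m0) n a ^+ 2) C.
  by apply: eb_weak H2; rewrite ler_piMr ?invf_le1 ?ler1n.
have p20 : 0 <= (2 : R) by [].
have pm0 : 0 <= 2 * m0 ^+ 2 by rewrite mulr_ge0 ?sqr_ge0.
apply: eb_le (ebD (ebZ p20 H2') (eb_cst P pm0)).
- apply: measurable_funX; apply: (measurable_av (F := fun j a => `|f (X j a)|)) => j.
  by apply: measurableT_comp => //; exact: measurableT_comp.
- by move=> a; exact: sqr_ge0.
move=> a; rewrite MfE /=; set u := avg _ _ _ _.
by have := sqr_ge0 (u - m0); nra.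
Qed.

(** [F] adds to the centred observable of an independent mean-field particle the effect of that
    particle on the field felt by all the others, collected over time by the adjoint weight. The
    remainder has expectation O(1/N), hence vanishes after multiplication by sqrt N. *)
Lemma fluct_linear : exists F : T' -> R,
  [/\ measurable_fun setT F, rint h (fun x => F x ^+ 2), \int[h]_x F x = 0 &
    exists C : R, forall n,
      (\int[P]_a (`|fluct n a - avg X F n a|)%:E <= (C / n.+1%:R)%:E)%E].
Proof.
have [W [CW [mW bW WE]]] := adjoint_weight K0 t0 cY mY c mf If4 mkY.
pose q (z : (bool * measurableTypeR R) * T') := W z.1 * fA h Y z.
have mq : measurable_fun setT q.
  apply: measurable_funM; last exact: measurable_fA.
  exact: (measurableT_comp mW measurable_fst).
have CW0 : 0 <= CW := le_trans (normr_ge0 _) (bW (true, 0)).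
have bq z : `|q z| <= CW * 2.
  by rewrite normrM ler_pM//; exact: fA_bound.
pose G x := \int[lam2 t]_s q (s, x).
have mG : measurable_fun setT G by exact: (@Rintegral_prod2 R _ _ _ _ (lam2 t) h q _ mq bq).
have bG x : `|G x| <= CW * 2 * (2 * t).
  rewrite -(lam2_setT t0); apply: Rintegral_bound => // s.
  exact: (measurableT_comp mq (measurable_pair2 x)).
have G0 : \int[h]_x G x = 0.
  rewrite /G -(@Rintegral_swap R _ _ _ _ (lam2 t) h q _ mq bq).
  transitivity (\int[lam2 t]_s (0 : R)); last by rewrite Rintegral_cst//= mul0r.
  apply: eq_Rintegral => s _; rewrite /q /= RintegralZl//.
    by rewrite fA_mean ?mulr0.
  apply: (@rint_bounded _ _ _ _ _ 2) => [|x]; last exact: fA_bound.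
  exact: (measurableT_comp (measurable_fA h cY mY) (measurable_pair1 s)).
have IG : rint h G by exact: rint_bounded bG.
pose F x := obs x - E0 + G x.
have mF : measurable_fun setT F by apply: measurable_funD => //; exact: measurable_funB.
have bE0 : `|E0| <= m0.
  apply: normr_Rintegral_le => // x; by rewrite normrM ler_piMr// trig_max.
have c0 : 0 <= m0 + CW * 2 * (2 * t) by rewrite addr_ge0// !mulr_ge0.
have bF x : `|F x| <= `|f x| + (m0 + CW * 2 * (2 * t)).
  rewrite (le_trans (ler_normD _ _))// addrA lerD//.
  by rewrite (le_trans (ler_normB _ _))// lerD// normrM ler_piMr// trig_max.
have IF2 : rint h (fun x => F x ^+ 2).
  apply: (@rint_exp _ _ _ _ F 2 4) => //.
  apply: (rint_le _ _ (IB c0)) => [|x].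
    by apply: measurable_funX; exact: measurableT_comp.
  rewrite normrX normr_id; apply: lerXn2r => //; rewrite nnegrE.
  exact: addr_ge0.
exists F; split => //.
  rewrite /F RintegralD//; last by apply: rintB => //; exact: rint_cst.
  by rewrite RintegralB//; [rewrite probability_cst subrr add0r|exact: rint_cst].
have avgF n a : fluct n a - avg X F n a =
    (av (fun j : 'I_n.+1 => f (X j a) * trig c (k * th a j t)) -
     av (fun j : 'I_n.+1 => f (X j a) * trig c (k * Y (X j a) t))) -
    \int[lam2 t]_x (W x * emp_fA h Y (xi n a) x).
  have -> : avg X F n a = av (fun j : 'I_n.+1 => obs (X j a) - E0 + G (X j a)) by [].
  rewrite avD avB av_cst /fluct.
  have -> : \int[lam2 t]_x (W x * emp_fA h Y (xi n a) x) = av (fun j : 'I_n.+1 => G (X j a)).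
    rewrite /G -Rintegral_av; last first.
      move=> j; apply: (@bounded_integrable _ _ _ _ _ (CW * 2)) => // s.
      exact: (measurableT_comp mq (measurable_pair2 (X j a))).
    by apply: eq_Rintegral => s _; rewrite /emp_fA -avZ.
  by rewrite /obs; ring.
have [CA [CA0 HA]] := A2; have [C4 [C40 H4]] := A4.
have [Ck [Ck0 Hk]] := Ak; have [Ca [Ca0 Ha]] := Aa; have [CM [CM0 HM]] := AM.
have z1 : 0 <= path_const K t CW.
  have := defect_const_ge0 K0 t0; have := drift_const_ge0 K t0; have := displacement_const_ge0 t K0; have := linearization_const_ge0 K0 t0.
  move=> q1 q2 q3 q4; rewrite /path_const /field_rem_const.
  rewrite addr_ge0//; last by rewrite !mulr_ge0// addr_ge0// sqr_ge0.
  by rewrite addr_ge0// ?mulr_ge0.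
have z2 : 0 <= obs_rem_const K t k * drift_const K t.
  have := drift_const_ge0 K t0; have := displacement_const_ge0 t K0; have := linearization_const_ge0 K0 t0.
  move=> q1 q2 q3; apply: mulr_ge0 => //; apply: addr_ge0; apply: mulr_ge0; rewrite ?sqr_ge0//.
have z3 : 0 <= CW / 2 by rewrite divr_ge0.
have z4 : 0 <= 2^-1 :> R by [].
pose C := path_const K t CW * CA + 2^-1 * Ca + obs_rem_const K t k * drift_const K t * (2^-1 * CM + t * C4) + CW / 2 * Ck.
exists C => n.
have N0 : 0 < n.+1%:R :> R by [].
(* The product M Q of [mean_absf] and the energy is bounded by half of M^2/N + N Q^2 with N = n + 1.
   As M^2 has bounded expectation and that of Q^2 is O(N^-2), both terms are O(1/N). *)
have N1 : 0 <= 2^-1 * n.+1%:R^-1 :> R by rewrite mulr_ge0 ?invr_ge0.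
have N2 : 0 <= t * n.+1%:R by rewrite mulr_ge0.
have EB := ebD (ebD (ebD (ebZ z1 (HA n)) (ebZ z4 (Ha n)))
  (ebZ z2 (ebD (ebZ N1 (HM n)) (ebZ N2 (H4 n))))) (ebZ z3 (Hk n)).
have -> : C / n.+1%:R = path_const K t CW * (CA / n.+1%:R) + 2^-1 * (Ca / n.+1%:R) +
  obs_rem_const K t k * drift_const K t * (2^-1 * n.+1%:R^-1 * CM + t * n.+1%:R * (C4 / n.+1%:R ^+ 2)) +
  CW / 2 * (Ck / n.+1%:R).
  rewrite /C; field; exact: lt0r_neq0.
have mV : measurable_fun setT (fluct n).
  apply: measurable_funB => //.
  apply: (measurable_av (F := fun j a => f (X j a) * trig c (k * th a j t))) => j.
  by apply: measurable_funM => //; exact: measurableT_comp.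
suff [] : ebound P (fun a => `|fluct n a - avg X F n a|)
  (path_const K t CW * (CA / n.+1%:R) + 2^-1 * (Ca / n.+1%:R) +
  obs_rem_const K t k * drift_const K t * (2^-1 * n.+1%:R^-1 * CM + t * n.+1%:R * (C4 / n.+1%:R ^+ 2)) +
  CW / 2 * (Ck / n.+1%:R)) by [].
apply: eb_le EB => // [|a].
  by apply: measurableT_comp => //; apply: measurable_funB => //; exact: measurable_avg.
rewrite avgF.
apply: le_trans (path_expansion K0 t0 cY mY Yd mf If4 mkY (@cth n a) (@th0 n a) (@thd n a)
  mW bW WE) _.
rewrite lerD2r [energy_ga _ _ _ _ _ _ _ _ / 2]mulrC lerD2l ler_wpM2l//.
have HQ := QA_sqr n a.
set M := mean_absf _ _; set Q := energy_fA _ _ _ _ in HQ *; set q4 := Q4 n a in HQ *.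
have -> : 2^-1 * n.+1%:R^-1 * M ^+ 2 + t * n.+1%:R * q4 =
  2^-1 * (n.+1%:R^-1 * M ^+ 2 + n.+1%:R * (2 * t * q4)) by field; exact: lt0r_neq0.
apply: (@le_trans _ _ (2^-1 * (n.+1%:R^-1 * M ^+ 2 + n.+1%:R * Q ^+ 2))).
  have -> : M * Q = 2^-1 * (2 * M * Q) by field.
  rewrite ler_wpM2l// -subr_ge0.
  have -> : n.+1%:R^-1 * M ^+ 2 + n.+1%:R * Q ^+ 2 - 2 * M * Q =
    n.+1%:R^-1 * (M - n.+1%:R * Q) ^+ 2 by field; exact: lt0r_neq0.
  by rewrite mulr_ge0 ?sqr_ge0 ?invr_ge0.
by rewrite ler_wpM2l// lerD2l ler_wpM2l.
Qed.

Let sqrt4 (x : R) : Num.sqrt (Num.sqrt (x ^+ 4)) = `|x|.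
Proof. by rewrite -[4%N]/(2 * 2)%N exprM !sqrtr_sqr ger0_norm ?sqr_ge0// sqrtr_sqr. Qed.

(** Three centred quantities have fourth moments of order N^-2: the fields, |f| - m0 and the
    observable along mean-field trajectories. They control, in order, the displacement of the
    particles, its amplification by the unbounded |f|, and the sampling error. *)
Lemma fluct_cvg0 : {ae P, forall a, fluct n a @[n --> \oo] --> (0 : R)}.
Proof.
have p4 (x : R) : 0 <= x ^+ 4 by rewrite exprn_even_ge0.
have bE0 : `|E0| <= m0.
  by apply: normr_Rintegral_le => // x; rewrite normrM ler_piMr// trig_max.
have [C4 [C40 H4]] := A4.
have [Cm [Cm0 Hm]] := eb_avg4 mabsf0 (mB m0) absf0 (IB m00) absf0_mean.
have mo : measurable_fun setT (fun x => obs x - E0) by exact: measurable_funB.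
have bo x : `|obs x - E0| <= `|f x| + m0.
  by rewrite (le_trans (ler_normB _ _))// lerD// normrM ler_piMr// trig_max.
have o0 : \int[h]_x (obs x - E0) = 0.
  by rewrite RintegralB//; [rewrite probability_cst subrr|exact: rint_cst].
have [Co [Co0 Ho]] := eb_avg4 mo (mB m0) bo (IB m00) o0.
have Z1 : {ae P, forall a, Q4 n a @[n --> \oo] --> 0}.
  by apply: (@ae_cvg0 _ _ _ P Q4 C4) => [n|n a|n]; have [] := H4 n.
have Z2 : {ae P, forall a, avg X (fun x => `|f x| - m0) n a ^+ 4 @[n --> \oo] --> 0}.
  by apply: (@ae_cvg0 _ _ _ P (fun n a => avg X (fun x => `|f x| - m0) n a ^+ 4) Cm)
    => [n|n a|n]; have [[]] := Hm n.
have Z3 : {ae P, forall a, avg X (fun x => obs x - E0) n a ^+ 4 @[n --> \oo] --> 0}.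
  by apply: (@ae_cvg0 _ _ _ P (fun n a => avg X (fun x => obs x - E0) n a ^+ 4) Co)
    => [n|n a|n]; have [[]] := Ho n.
apply: filterS3 Z1 Z2 Z3 => a z1 z2 z3.
have cs (u : nat -> R) (l : R) : u @ \oo --> l -> Num.sqrt (u n) @[n --> \oo] --> Num.sqrt l.
  by move=> ul; exact: (continuous_cvg _ (@sqrt_continuous R l) ul).
(* This bounds the accumulated error [I]: its square is at most [drift_const] times the energy, and
   the square of the energy is at most 2 t times [Q4]. *)
have b1 : Num.sqrt (drift_const K t * Num.sqrt (2 * t * Q4 n a)) @[n --> \oo] --> (0 : R).
  have e1 : (fun n => 2 * t * Q4 n a) @ \oo --> (0 : R).
    by rewrite -[X in _ --> X](mulr0 (2 * t)); apply: cvgM => //; exact: cvg_cst.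
  have := cs _ _ e1; rewrite sqrtr0 => e2.
  have e3 : (fun n => drift_const K t * Num.sqrt (2 * t * Q4 n a)) @ \oo --> (0 : R).
    by rewrite -[X in _ --> X](mulr0 (drift_const K t)); apply: cvgM => //; exact: cvg_cst.
  by have := cs _ _ e3; rewrite sqrtr0.
have b2 : `|avg X (fun x => `|f x| - m0) n a| @[n --> \oo] --> (0 : R).
  have := cs _ _ (cs _ _ z2); rewrite !sqrtr0.
  by under eq_fun do rewrite sqrt4.
have b3 : `|avg X (fun x => obs x - E0) n a| @[n --> \oo] --> (0 : R).
  have := cs _ _ (cs _ _ z3); rewrite !sqrtr0.
  by under eq_fun do rewrite sqrt4.
have b4 : (fun n => `|k| * displacement_const K t * (`|avg X (fun x => `|f x| - m0) n a| + m0) *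
    Num.sqrt (drift_const K t * Num.sqrt (2 * t * Q4 n a)) +
    `|avg X (fun x => obs x - E0) n a|) @ \oo --> (0 : R).
  rewrite -[X in _ --> X](_ : `|k| * displacement_const K t * (0 + m0) * 0 + 0 = 0); last by rewrite mulr0 addr0.
  apply: cvgD b3; apply: cvgM b1; apply: cvgM; first exact: cvg_cst.
  by apply: cvgD b2 _; exact: cvg_cst.
apply: norm_cvg0; apply: squeeze_cvgr b4; last exact: cvg_cst.
apply: nearW => n; rewrite normr_ge0 /=.
have -> : fluct n a = (av (fun j : 'I_n.+1 => f (X j a) * trig c (k * th a j t)) -
     av (fun j : 'I_n.+1 => f (X j a) * trig c (k * Y (X j a) t))) +
    avg X (fun x => obs x - E0) n a.
  have -> : avg X (fun x => obs x - E0) n a = av (fun j : 'I_n.+1 => obs (X j a) - E0) by [].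
  by rewrite avB av_cst /fluct addrA subrK.
rewrite (le_trans (ler_normD _ _))// lerD2r.
have [H1 H2] := path_crude K0 t0 cY mY Yd f k c (@cth n a) (@th0 n a) (@thd n a).
set I := prim _ t in H1 H2; have I0 : 0 <= I.
  by apply: prim_ge0 => s; exact: addr_ge0.
rewrite (le_trans H1)//.
have M1 : mean_absf f (xi n a) <= `|avg X (fun x => `|f x| - m0) n a| + m0.
  by rewrite MfE lerD2r ler_norm.
have M0 : 0 <= mean_absf f (xi n a).
  by rewrite mulr_ge0 ?invr_ge0// sumr_ge0.
have kC : 0 <= `|k| * displacement_const K t by rewrite mulr_ge0// displacement_const_ge0.
have I1 : I <= Num.sqrt (drift_const K t * Num.sqrt (2 * t * Q4 n a)).
  rewrite -[I]ger0_norm// -sqrtr_sqr ler_sqrt; last first.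
    by rewrite mulr_ge0 ?sqrtr_ge0 ?drift_const_ge0.
  rewrite (le_trans H2)// ler_wpM2l ?drift_const_ge0//.
  have Q0 : 0 <= energy_fA h t Y (xi n a) by apply: Rintegral_ge0 => x _; exact: sqr_ge0.
  rewrite -[energy_fA _ _ _ _]ger0_norm// -sqrtr_sqr ler_sqrt ?QA_sqr//.
  by rewrite mulr_ge0 ?mulr_ge0// Rintegral_ge0.
apply: ler_pM => //; [exact: mulr_ge0|exact: ler_wpM2l].
Qed.

End particle_system.

(** * Measurable dependence on the data *)

Section measurable_modulus.
Context d (T : measurableType d) (R : realType) (I : finType).
Variables (z : I -> T -> R) (V : T -> R).
Hypothesis mz : forall i, measurable_fun setT (z i).
Hypothesis zV : forall a (e : R), 0 < e -> exists2 dl : R, 0 < dl &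
  forall a', (forall i, `|z i a' - z i a| < dl) -> `|V a' - V a| < e.

(* [V] factors through [z] only continuously, so its superlevel sets are countable
   unions of preimages of rational boxes. *)
Lemma measurable_modulus : measurable_fun setT V.
Proof.
apply: (measurability (@RGenOInfty.G R)); first exact: RGenOInfty.measurableE.
move=> _ [_ [y ->] <-]; rewrite setTI.
pose box (w : {ffun I -> rat} * nat) : set T :=
  [set a | forall i, `|z i a - ratr (w.1 i)| < w.2.+1%:R^-1].
have mbox w : measurable (box w).
  rewrite (_ : box w = \bigcap_(i in [set: I]) [set a | `|z i a - ratr (w.1 i)| < w.2.+1%:R^-1]).
    apply: fin_bigcap_measurable => [|i _]; first exact: finite_finset.
    have mzi : measurable_fun setT (fun a => `|z i a - ratr (w.1 i)|).
      by apply: measurableT_comp => //; exact: measurable_funB.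
    rewrite (_ : [set a | _] = (fun a => `|z i a - ratr (w.1 i)|) @^-1` `]-oo, w.2.+1%:R^-1[).
      by rewrite -[X in measurable X]setTI; apply: mzi => //; exact: measurable_itv.
    by apply/seteqP; split => a; rewrite /= in_itv.
  by apply/seteqP; split => a /= H i; [move=> _; exact: H|exact: H].
rewrite (_ : V @^-1` _ = \bigcup_(w in [set w | box w `<=` V @^-1` `]y, +oo[ ]) box w).
  rewrite bigcup_mkcond; apply: countable_bigcupT_measurable => [|w]; first exact: countableP.
  by case: ifP.
apply/seteqP; split => [a|a [w /= bV /bV]//].
rewrite /= in_itv /= andbT => yV.
have [|dl dl0 H] := @zV a (V a - y); first by rewrite subr_gt0.
(* The radius 1/(p+1) is below dl/2, so two points of one box differ by less than [dl] in every
   coordinate. *)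
pose p := Num.truncn (2 / dl).
have p0 : p.+1%:R^-1 < dl / 2.
  rewrite invf_plt ?posrE ?divr_gt0// invf_div.
  by rewrite truncnS_gt.
have r0 : 0 < p.+1%:R^-1 :> R by rewrite invr_gt0.
move Er : p.+1%:R^-1 => rr in p0 r0.
have q i : exists q : rat, `|z i a - ratr q| < rr.
  have zz : z i a < z i a + rr by rewrite ltrDl.
  have [q] := rat_in_itvoo zz; rewrite in_itv /= => /andP[h1 h2].
  by exists q; rewrite ltr_norml; apply/andP; split; lra.
have [q' Hq] := choice q.
exists ([ffun i => q' i], p) => /=; last by move=> i /=; rewrite ffunE Er.
move=> a' Ha' /=; rewrite in_itv /= andbT.
have : `|V a' - V a| < V a - y.
  apply: H => i; have := Ha' i; have := Hq i; rewrite /= ffunE Er => h1 h2.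
  rewrite (_ : z i a' - z i a = (z i a' - ratr (q' i)) - (z i a - ratr (q' i))); last by ring.
  by rewrite (le_lt_trans (ler_normB _ _))//; lra.
by rewrite ltr_norml => /andP[h1 _]; lra.
Qed.

End measurable_modulus.

Section measurable_multiples.
Context d (T : measurableType d) (R : realType) (g : T -> R).
Hypothesis mg : forall b, measurable_fun setT (fun a => trig b (g a)).

(** The function [g] itself may fail to be measurable, being a lift obtained by choice. The addition
    formulas express the multiples through the sine and cosine of [g]. *)
Lemma measurable_trig_mulz (k : int) b : measurable_fun setT (fun a => trig b (k%:~R * g a)).
Proof.
have nat_case (n : nat) : measurable_fun setT (fun a => sin (n%:R * g a)) /\
    measurable_fun setT (fun a => cos (n%:R * g a)).
  elim: n => [|n [IHs IHc]].
    split; first by under eq_fun do rewrite mul0r sin0; exact: measurable_cst.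
    by under eq_fun do rewrite mul0r cos0; exact: measurable_cst.
  have ms := mg true; have mc := mg false; rewrite /= in ms mc.
  split.
    under eq_fun do rewrite -addn1 natrD mulrDl mul1r sinD.
    by apply: measurable_funD; exact: measurable_funM.
  under eq_fun do rewrite -addn1 natrD mulrDl mul1r cosD.
  by apply: measurable_funB; exact: measurable_funM.
case: k => n.
  by have [ms mc] := nat_case n; case: b.
have [ms mc] := nat_case n.+1; case: b => /=.
  under eq_fun do rewrite NegzE mulrNz mulNr sinN.
  exact: measurable_funN.
by under eq_fun do rewrite NegzE mulrNz mulNr cosN.
Qed.

End measurable_multiples.

(** * Continuous dependence of the particles on their data *)

Section continuous_dependence.
Context (R : realType) (n : nat) (K t : R).
Hypotheses (K0 : 0 <= K) (t0 : 0 <= t).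
Variables (om om' : 'I_n.+1 -> R) (x x' : 'I_n.+1 -> R -> R).
Let rho (y : 'I_n.+1 -> R -> R) b s := av (fun j => trig b (y j s)).
Let vel (o : 'I_n.+1 -> R) (y : 'I_n.+1 -> R -> R) j s :=
  o j + K * (rho y true s * dtrig true (y j s) + rho y false s * dtrig false (y j s)).
Hypotheses (cx : forall j, continuous (x j)) (cx' : forall j, continuous (x' j)).
Hypothesis xd : forall j s, 0 < s < t -> isd (x j) s (vel om x j s).
Hypothesis xd' : forall j s, 0 < s < t -> isd (x' j) s (vel om' x' j s).

Let del b j s := trig b (x j s) - trig b (x' j s).
(** The squared chord 2 - 2 cos(x - x') between two points of the circle. It is insensitive to the
    choice of lifts, and its derivative is 2 sin(x - x') times the difference of velocities, again
    bounded in terms of the chord. *)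
Let dist j s := del true j s ^+ 2 + del false j s ^+ 2.
Let D s := av (dist ^~ s).
Let W := av (fun j => (om j - om' j) ^+ 2).
Let dvel j s := vel om x j s - vel om' x' j s.
Let ddist j s := 2 * dvel j s *
  (trig false (x j s) * trig true (x' j s) - trig true (x j s) * trig false (x' j s)) * -1.

Let dist0 j s : 0 <= dist j s. Proof. by rewrite addr_ge0 ?sqr_ge0. Qed.

Let cdel b j : continuous (del b j).
Proof. by apply: contB; apply: cont_comp => //; exact: cont_trig. Qed.

Let cdist j : continuous (dist j).
Proof. by apply: contD; rewrite /GRing.exp /=; apply: contM; exact: cdel. Qed.

Let isd_trig_comp b (y : R -> R) s v : isd y s v ->
  isd (fun u => trig b (y u)) s (dtrig b (y s) * v).
Proof. by move=> yd; apply: isd_comp yd; exact: isd_trig. Qed.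

Let isd_dist j s : 0 < s < t -> isd (dist j) s (ddist j s).
Proof.
move=> st.
have Hd b : isd (del b j) s (dtrig b (x j s) * vel om x j s - dtrig b (x' j s) * vel om' x' j s).
  by apply: isdB; apply: isd_trig_comp; [exact: xd|exact: xd'].
apply: isd_eq.
  by apply: isdD; rewrite /GRing.exp /=; apply: isdM; exact: Hd.
rewrite /ddist /dvel /del /=; ring.
Qed.

Let q j s := `|del true j s| + `|del false j s|.

Let q0 j s : 0 <= q j s. Proof. exact: addr_ge0. Qed.

Let q2 j s : q j s ^+ 2 <= 2 * dist j s.
Proof.
rewrite /q /dist -[del true j s ^+ 2]real_normK ?num_real//.
rewrite -[del false j s ^+ 2]real_normK ?num_real//.
by have := sqr_ge0 (`|del true j s| - `|del false j s|); nra.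
Qed.

Let wedge j s : `|trig false (x j s) * trig true (x' j s) - trig true (x j s) * trig false (x' j s)| <= q j s.
Proof.
have -> : trig false (x j s) * trig true (x' j s) - trig true (x j s) * trig false (x' j s) =
  trig false (x j s) * (- del true j s) + trig true (x j s) * del false j s.
  by rewrite /del; ring.
rewrite (le_trans (ler_normD _ _))// !normrM normrN lerD//.
  by rewrite ler_piMl// trig_max.
by rewrite ler_piMl// trig_max.
Qed.

Let Q s := av (q ^~ s).

Let drho b s : `|rho x b s - rho x' b s| <= Q s.
Proof.
rewrite -avB; apply: norm_av_le => j; rewrite /q.
by case: b; [rewrite lerDl|rewrite lerDr].
Qed.

Let rho1 y b s : `|rho y b s| <= 1.
Proof. by rewrite -(av_cst n (1 : R)); apply: norm_av_le => j; exact: trig_max. Qed.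

Let ddtrig b j s : `|dtrig b (x j s) - dtrig b (x' j s)| <= `|del (~~ b) j s|.
Proof. by case: b => //=; rewrite -opprD normrN. Qed.

Let dvel_le j s : `|dvel j s| <= `|om j - om' j| + K * (2 * Q s + q j s).
Proof.
have -> : dvel j s = (om j - om' j) + K * (
    (rho x true s - rho x' true s) * dtrig true (x j s) +
    (rho x false s - rho x' false s) * dtrig false (x j s) +
    rho x' true s * (dtrig true (x j s) - dtrig true (x' j s)) +
    rho x' false s * (dtrig false (x j s) - dtrig false (x' j s))).
  by rewrite /dvel /vel; ring.
rewrite (le_trans (ler_normD _ _))// lerD2l normrM (ger0_norm K0) ler_wpM2l//.
rewrite (le_trans (ler_normD4 _ _ _ _))//.
have H1 b : `|(rho x b s - rho x' b s) * dtrig b (x j s)| <= Q s.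
  by rewrite normrM -[leRHS]mulr1 ler_pM// dtrig_max.
have H2 b : `|rho x' b s * (dtrig b (x j s) - dtrig b (x' j s))| <= `|del (~~ b) j s|.
  by rewrite normrM -[leRHS]mul1r ler_pM.
have := H1 true; have := H1 false; have := H2 true; have := H2 false; rewrite /q /=.
set a1 := `|_ * _|; set a2 := `|_ * _|; set a3 := `|_ * _|; set a4 := `|_ * _|.
by lra.
Qed.

Let Q2 s : Q s ^+ 2 <= 2 * D s.
Proof.
have H : 0 <= av (fun j => (q j s - Q s) ^+ 2).
  by rewrite -(av_cst n (0 : R)); apply: le_av => j; exact: sqr_ge0.
have E1 : av (fun j => (q j s - Q s) ^+ 2) = av (fun j => q j s ^+ 2) - Q s ^+ 2.
  transitivity (av (fun j => q j s ^+ 2 - (2 * Q s * q j s - Q s ^+ 2))).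
    by apply: av_eq => j; ring.
  rewrite avB; congr (_ - _); rewrite avB av_cst avZ -/(Q s); ring.
have H2 : av (fun j => q j s ^+ 2) <= 2 * D s.
  by rewrite /D -avZ; apply: le_av => j; exact: q2.
by rewrite E1 in H; lra.
Qed.

(** After averaging [ddist_le], the chord terms contribute 2 + 6 K and 2 K, and the bound Q^2 <= 2 D
    contributes 4 K. *)
Let C := 2 + 12 * K.

Let ddist_le j s : `|ddist j s| <= (2 + 6 * K) * dist j s + 2 * K * Q s ^+ 2 + (om j - om' j) ^+ 2
  + 2 * K * dist j s.
Proof.
rewrite /ddist normrM normrN1 mulr1 normrM normrM (ger0_norm (_ : 0 <= 2 :> R))//.
apply: (@le_trans _ _ (2 * (`|om j - om' j| + K * (2 * Q s + q j s)) * q j s)).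
  by rewrite ler_pM ?mulr_ge0// ler_wpM2l.
have := q2 j s; have := q0 j s; set u := q j s; set v := Q s; set o := `|_|; set dd := dist j s.
move=> u0 u2.
have -> : (om j - om' j) ^+ 2 = o ^+ 2 by rewrite real_normK ?num_real.
have h1 : 2 * o * u <= o ^+ 2 + 2 * dd by have := sqr_ge0 (o - u); nra.
have h2 : K * (2 * v * u) <= K * (v ^+ 2 + 2 * dd).
  by rewrite ler_wpM2l//; have := sqr_ge0 (v - u); nra.
have h3 : K * u ^+ 2 <= K * (2 * dd) by rewrite ler_wpM2l.
have -> : 2 * (o + K * (2 * v + u)) * u = 2 * o * u + 2 * (K * (2 * v * u)) + 2 * (K * u ^+ 2) by ring.
by lra.
Qed.

Lemma continuous_dependence : D t <= expR (C * t) * (D 0 + W * t).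
Proof.
have D0 s : 0 <= D s by rewrite -(av_cst n (0 : R)); apply: le_av.
have W0 : 0 <= W by rewrite -(av_cst n (0 : R)); apply: le_av => j; exact: sqr_ge0.
have C0 : 0 <= C by rewrite addr_ge0// mulr_ge0.
have := @gronwall R D (fun=> W) (fun s => W * s) (fun s => av (ddist ^~ s)) C t t0 C0.
rewrite (ger0_norm (D0 t)) (ger0_norm (D0 0)) mulr0 subr0; apply => //.
- exact: cont_av.
- by apply: contM; [exact: cont_cst|exact: cont_id].
- move=> s st; apply: isd_eq.
    apply: isdM; first exact: isd_cst.
    by apply: isd_sum => j; exact: isd_dist.
  by rewrite mulr0 addr0.
- by move=> s _; apply: isd_eq; [apply: isdM; [exact: isd_cst|exact: isd_id]|rewrite /=; ring].
move=> s _; rewrite (ger0_norm (D0 s)).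
apply: (@le_trans _ _ (av (fun j => (2 + 6 * K) * dist j s + 2 * K * Q s ^+ 2 + (om j - om' j) ^+ 2
  + 2 * K * dist j s))).
  by apply: norm_av_le => j; exact: ddist_le.
rewrite !avD av_cst !avZ -/(D s) -/W.
have h : K * Q s ^+ 2 <= K * (2 * D s) by rewrite ler_wpM2l.
by rewrite /C; lra.
Qed.

End continuous_dependence.

Section measurable_particles.
Context d (T : measurableType d) (R : realType) (n : nat) (K t : R).
Hypotheses (K0 : 0 <= K) (t0 : 0 <= t).
Variables (om : 'I_n.+1 -> T -> R) (th : T -> 'I_n.+1 -> R -> R).
Hypothesis mom : forall j, measurable_fun setT (om j).
Hypothesis mth0 : forall b j, measurable_fun setT (fun a => trig b (th a j 0)).
Hypothesis cth : forall a j, continuous (th a j).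
Hypothesis thd : forall a j s, 0 < s < t -> isd (th a j) s
  (om j a + K * (av (fun i => trig true (th a i s)) * dtrig true (th a j s) +
                 av (fun i => trig false (th a i s)) * dtrig false (th a j s))).

(** Nothing is assumed on how [th] depends on the sample point. By the Gronwall estimate the
    position on the circle is a continuous function of finitely many measurable data: the
    frequencies and the sines and cosines of the initial positions. *)
Lemma measurable_particles b j : measurable_fun setT (fun a => trig b (th a j t)).
Proof.
pose z (i : option bool * 'I_n.+1) a :=
  if i.1 is Some b' then trig b' (th a i.2 0) else om i.2 a.
apply: (@measurable_modulus _ T R (option bool * 'I_n.+1)%type z) => [[[b'|] i]|a e e0].
- exact: mth0.
- exact: mom.
(* The factor n + 1 passes from the average to a single particle. In 2 + t, the 2 stands for the
   sine and cosine of the initial position and t for the difference of frequencies accumulated over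
   time. *)
pose M := n.+1%:R * (expR ((2 + 12 * K) * t) * (2 + t)).
have M0 : 0 <= M by rewrite mulr_ge0// mulr_ge0 ?expR_ge0 ?addr_ge0.
exists (e / (M + 1)); first by rewrite divr_gt0// ltr_wpDl.
set dl := e / (M + 1) => a' Ha.
have dl0 : 0 <= dl by rewrite divr_ge0 ?addr_ge0// ltW.
have sq (x : R) : `|x| < dl -> x ^+ 2 <= dl ^+ 2.
  by move=> xd; rewrite -[leLHS]real_normK ?num_real// lerXn2r ?nnegrE// ltW.
have dep := continuous_dependence K0 t0 (@cth a') (@cth a) (@thd a') (@thd a).
set S := av _ in dep; set S0 := av _ in dep; set SW := av _ in dep.
have S0le : S0 <= 2 * dl ^+ 2.
  rewrite -(av_cst n (2 * dl ^+ 2)); apply: le_av => i; rewrite mulr_natl mulr2n.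
  by apply: lerD; apply: sq; [exact: (Ha (Some true, i))|exact: (Ha (Some false, i))].
have SWle : SW <= dl ^+ 2.
  rewrite -(av_cst n (dl ^+ 2)); apply: le_av => i.
  by apply: sq; exact: (Ha (None, i)).
have Sle : S <= expR ((2 + 12 * K) * t) * ((2 + t) * dl ^+ 2).
  rewrite (le_trans dep)// ler_wpM2l ?expR_ge0// mulrDl lerD//.
  by rewrite mulrC ler_wpM2l.
have diff2 : (trig b (th a' j t) - trig b (th a j t)) ^+ 2 <= M * dl ^+ 2.
  apply: (@le_trans _ _ (n.+1%:R * S)); last first.
    rewrite /M -mulrA ler_wpM2l// (le_trans Sle)//.
    by rewrite mulrA.
  rewrite /S /av mulrA mulfV ?mul1r; last by rewrite pnatr_eq0.
  rewrite (bigD1 j)//= -[leLHS]addr0 lerD//; last first.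
    by apply: sumr_ge0 => i _; rewrite addr_ge0 ?sqr_ge0.
  by case: b; rewrite ?lerDl ?lerDr ?sqr_ge0.
have Me : M * dl ^+ 2 < e ^+ 2.
  have M1 : 0 < M + 1 by rewrite ltr_wpDl.
  have -> : e = (M + 1) * dl by rewrite /dl mulrC divfK// gt_eqF.
  rewrite [ltRHS]exprMn ltr_pM2r; last by rewrite exprn_gt0// divr_gt0.
  by nra.
have := le_lt_trans diff2 Me.
set x := _ - _ => xe; rewrite ltNge; apply/negP => ex; move: xe; apply/negP; rewrite -leNgt.
by rewrite -[leRHS]real_normK ?num_real// lerXn2r ?nnegrE// ltW.
Qed.

End measurable_particles.

(** * The Kuramoto model on the circle *)

Section circle_functions.
Variable R : realType.

(** In the quotient topology a set is open when its preimage in the line is, so continuity in the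
    angular coordinate makes the preimages of open intervals open, hence Borel. *)
Lemma measurable_circle (g : circle R -> R) :
  continuous (fun a : R => g (angle a)) -> measurable_fun setT g.
Proof.
move=> cg; apply: (measurability (@RGenOpens.G R)); first exact: RGenOpens.measurableE.
move=> _ [_ [x [y ->] <-]]; rewrite setTI.
apply: sub_sigma_algebra; rewrite /open /= /quotient_open.
have /continuousP H := cg.
exact: (H _ (itv_open x y)).
Qed.

Lemma trig_crepr_angle b (a : R) : trig b (crepr (angle a)) = trig b a.
Proof. by have [n ->] := crepr_angle a; case: b; rewrite /= sincos_periodz. Qed.

Lemma measurable_trig_crepr b : measurable_fun setT (fun z : circle R => trig b (crepr z)).
Proof.
apply: measurable_circle; rewrite (_ : (fun a => _) = trig b); first exact: cont_trig.
by apply/funext => a; exact: trig_crepr_angle.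
Qed.

Lemma csin_subE (z : circle R) (a : R) :
  csin_sub z (angle a) = trig true (crepr z) * dtrig true a + trig false (crepr z) * dtrig false a.
Proof. by rewrite -[in LHS](creprK z) csin_sub_angle sinB /= mulrN. Qed.

Lemma cexp_trig (k : int) (z : circle R) :
  cexp k z = (trig false (k%:~R * crepr z) +i* trig true (k%:~R * crepr z))%C.
Proof. by []. Qed.

Lemma trig_mulz_angle c (k : int) (a : R) :
  trig c (k%:~R * crepr (angle a)) = trig c (k%:~R * a).
Proof.
have := cexp_angle k a; rewrite cexp_trig => -[h1 h2].
by case: c.
Qed.

(** The given lift is translated by a multiple of 2 pi to start at the prescribed [a0], and frozen
    for negative times, so that it becomes continuous on the whole line. *)
Lemma has_velocity_lift (y : R -> circle R) v a0 : has_velocity y v -> angle a0 = y 0 ->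
  exists Y : R -> R, [/\ Y 0 = a0, forall s, 0 <= s -> angle (Y s) = y s,
    forall s, angle (Y s) = y (Num.max s 0), continuous Y & forall s, 0 < s -> isd Y s (v s)].
Proof.
move=> [Y [Yy cY Yd]] a0y.
have /angleP[n an] : angle a0 = angle (Y 0) by rewrite Yy.
pose cl (s : R) := Num.max s 0.
have cl0 s : 0 <= cl s by rewrite le_max lexx orbT.
pose Y1 s := Y (cl s) + n%:~R * (2 * pi).
have Y1y s : angle (Y1 s) = y (cl s).
  rewrite -Yy//; apply/angleP; exists n; rewrite /Y1; ring.
exists Y1; split => //.
- by rewrite /Y1 /cl maxxx -an addrC subrK.
- by move=> s s0; rewrite Y1y /cl; congr y; apply/max_idPl.
- apply: contD; last exact: cont_cst.
  move=> s; have /subspace_continuousP H := cY.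
  have c0 : `[0, +oo[%classic (cl s) by rewrite /= in_itv /= cl0.
  have ccl : cl x @[x --> s] --> cl s.
    by apply: continuous_max; [exact: cont_id|exact: cont_cst].
  move=> U /(H _ c0) HU.
  have := ccl _ HU; rewrite !nbhs_simpl /=.
  by apply: filterS => z /=; apply; rewrite /= in_itv /= cl0.
move=> s s0; apply: (@isd_near _ (fun z => Y z + n%:~R * (2 * pi))); last first.
  by apply: isd_eq; [apply: isdD; [exact: Yd|exact: isd_cst]|rewrite addr0].
near=> z; congr (Y _ + _); rewrite /cl; apply/esym/max_idPl.
by apply: ltW; near: z; exact: lt_nbhsr.
Unshelve. all: by end_near. Qed.

Lemma measurable_lift d (T : measurableType d) (Z : T -> R) :
  measurable_fun setT (fun a => angle (Z a)) -> forall b, measurable_fun setT (fun a => trig b (Z a)).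
Proof.
move=> mZ b.
rewrite (_ : (fun a => _) = (fun z => trig b (crepr z)) \o (fun a => angle (Z a))).
  by apply: measurableT_comp => //; exact: measurable_trig_crepr.
by apply/funext => a /=; rewrite trig_crepr_angle.
Qed.

Lemma Rintegral_csin_sub d (T : measurableType d) (P : probability T R) (Z : T -> R) (a : R) :
  (forall b, measurable_fun setT (fun x => trig b (Z x))) ->
  \int[P]_x csin_sub (angle (Z x)) (angle a) =
  (\int[P]_x trig true (Z x)) * dtrig true a + (\int[P]_x trig false (Z x)) * dtrig false a.
Proof.
move=> mZ.
have I b : rint P (fun x => trig b (Z x)).
  by apply: (@rint_bounded _ _ _ _ _ 1) => // x; exact: trig_max.
transitivity (\int[P]_x (dtrig true a * trig true (Z x) + dtrig false a * trig false (Z x))).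
  apply: eq_Rintegral => x _; rewrite csin_subE !trig_crepr_angle.
  by rewrite ![dtrig _ _ * _]mulrC.
rewrite (RintegralD measurableT (rintZ _ (I true)) (rintZ _ (I false))).
by rewrite !RintegralZl//; [rewrite ![dtrig _ _ * _]mulrC|exact: I|exact: I].
Qed.

End circle_functions.

Section kuramoto_lifts.
Context (R : realType) (h : probability (circle R * R)%type R) (K : R).
Let T' : measurableType _ := (circle R * R)%type.

(** The trajectory of each starting point is lifted separately, by choice, which leaves no
    measurability of [Y] in that point. Its sine and cosine are measurable because they factor
    through the flow on the circle, and the coupling integral needs no more. *)
Lemma flow_lift x : kuramoto_flow h K x ->
  exists Y : T' -> R -> R, [/\ forall p s, 0 <= s -> angle (Y p s) = x s 0 p.1 p.2,
    forall p, angle (Y p 0) = p.1,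
    forall p, continuous (Y p),
    forall b s, measurable_fun setT (fun p => trig b (Y p s)) &
    forall p s, 0 < s -> isd (Y p) s (p.2 + K *
      (mean_trig h Y true s * dtrig true (Y p s) + mean_trig h Y false s * dtrig false (Y p s)))].
Proof.
move=> [mx xv].
have H (p : T') := has_velocity_lift (proj2 (xv 0 p.1 p.2 (lexx 0))) (creprK _).
have [Y HY] := choice H; exists Y.
have mY b s : measurable_fun setT (fun p => trig b (Y p s)).
  apply: measurable_lift.
  rewrite (_ : (fun p => _) = (fun p => x (Num.max s 0) 0 p.1 p.2)).
    by apply: mx; rewrite le_max lexx orbT.
  by apply/funext => p; have [_ _ ->] := HY p.
split => //.
- by move=> p s s0; have [_ ->] := HY p.
- by move=> p; have [_ -> //] := HY p; have [-> _] := xv 0 p.1 p.2 (lexx 0).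
- by move=> p; have [_ _ _ ? _] := HY p.
move=> p s s0; have [_ E _ _ Yd] := HY p.
apply: isd_eq; first exact: Yd.
congr (_ + _ * _); rewrite -(E s) ?ltW// -(Rintegral_csin_sub h _ (mY ^~ s)).
by apply: eq_Rintegral => q _; have [_ -> //] := HY q; rewrite ltW.
Qed.

(** The initial values [a0] are prescribed so that a particle and the mean-field trajectory of the
    same sample have lifts that coincide, not merely agree modulo 2 pi, at time 0. *)
Lemma solution_lift n (om : 'I_n.+1 -> R) th (a0 : 'I_n.+1 -> R) :
  kuramoto_solution K om th -> (forall j, angle (a0 j) = th 0 j) ->
  exists Th : 'I_n.+1 -> R -> R, [/\ forall j, Th j 0 = a0 j,
    forall j s, 0 <= s -> angle (Th j s) = th s j,
    forall j, continuous (Th j) &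
    forall j s, 0 < s -> isd (Th j) s (om j + K *
      (av (fun i => trig true (Th i s)) * dtrig true (Th j s) +
       av (fun i => trig false (Th i s)) * dtrig false (Th j s)))].
Proof.
move=> ks a0E.
have H j := has_velocity_lift (ks j) (a0E j).
have [Th HT] := choice H; exists Th; split.
- by move=> j; have [] := HT j.
- by move=> j s s0; have [_ ->] := HT j.
- by move=> j; have [_ _ _ ? _] := HT j.
move=> j s s0; have [_ E _ _ Td] := HT j.
apply: isd_eq; first exact: Td.
rewrite -mulrA; congr (_ + _ * _); rewrite /av -!mulrA -mulrDr; congr (_ * _).
rewrite !mulr_suml -big_split; apply: eq_bigr => i _ /=.
rewrite -E ?ltW//; have [_ <- //] := HT i; last exact: ltW.
by rewrite csin_subE !trig_crepr_angle.
Qed.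

End kuramoto_lifts.

(** * Polynomial observables and the deviation *)

Section polynomial_observables.
Context (R : realType) (h : probability (circle R * R)%type R).

Lemma normc_real_cexp (a : R) (k : int) (z : circle R) : normc (a%:C * cexp k z)%C = `|a|.
Proof.
rewrite /cexp /= !mul0r subr0 addr0 !exprMn -mulrDr cos2Dsin2 mulr1.
exact: sqrtr_sqr.
Qed.

(** As |exp(i k theta)| = 1, the absolute moment of order n with k = 0 is the absolute moment of the
    frequency; a polynomial is a finite combination of such powers. *)
Lemma rint_polynomial (q : {poly R}) : abs_moments_exist h -> rint h (fun p => q.[p.2]).
Proof.
move=> mom.
have E : (fun p : circle R * R => \sum_(i < size q) q`_i * p.2 ^+ i) =1 (fun p => q.[p.2]).
  by move=> p; rewrite horner_coef.
apply: (rint_eq E).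
apply: rint_sum => i; apply: rintZ; apply/integrableP; split.
  by apply/measurable_EFinP; apply: measurable_funX; exact: measurable_snd.
apply: le_lt_trans (mom i 0); rewrite le_eqVlt; apply/orP; left; apply/eqP.
apply: eq_integral => p _; rewrite [RHS](_ : _ = (`|p.2 ^+ i|)%:E)//.
by congr EFin; exact: normc_real_cexp.
Qed.

Lemma measurable_polynomial (q : {poly R}) :
  measurable_fun setT (fun p : circle R * R => q.[p.2]).
Proof.
apply: (@measurableT_comp _ _ _ _ _ _ (fun x => q.[x])); last exact: measurable_snd.
by apply: continuous_measurable_fun; exact: continuous_horner.
Qed.

Definition Zpart (q : {poly R}) (k : int) (c : bool) (p : circle R * R) : R :=
  q.[p.2] * trig c (k%:~R * crepr p.1).

Lemma Zfun_parts q k p : Zfun q k p = (Zpart q k false p +i* Zpart q k true p)%C.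
Proof. by rewrite /Zfun /cexp /Zpart /=; congr (_ +i* _)%C; ring. Qed.

Lemma measurable_Zpart q k c : measurable_fun setT (Zpart q k c).
Proof.
apply: measurable_funM; first exact: measurable_polynomial.
apply: (@measurable_trig_mulz _ _ _ (fun p : circle R * R => crepr p.1)) => b.
apply: (@measurableT_comp _ _ _ _ _ _ (fun z => trig b (crepr z))); last exact: measurable_fst.
exact: measurable_trig_crepr.
Qed.

Lemma mean_Zfun n (om : 'I_n.+1 -> R) (z : 'I_n.+1 -> circle R) q k :
  (n.+1%:R)^-1 * \sum_(j < n.+1) Zfun q k (z j, om j) =
  (av (fun j => Zpart q k false (z j, om j)) +i* av (fun j => Zpart q k true (z j, om j)))%C.
Proof.
have -> : \sum_(j < n.+1) Zfun q k (z j, om j) =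
  ((\sum_(j < n.+1) Zpart q k false (z j, om j)) +i*
   (\sum_(j < n.+1) Zpart q k true (z j, om j)))%C.
  by elim/big_rec3: _ => [//|j x y w _ ->]; rewrite Zfun_parts.
have -> : (n.+1%:R : R[i])^-1 = (n.+1%:R^-1)%:C%C.
  by rewrite fmorphV rmorph_nat.
by rewrite /av /=; congr (_ +i* _)%C; ring.
Qed.

Lemma Rintegral_pushforward (rho : probability (circle R * R)%type R)
  (phi : circle R * R -> circle R * R) (F : circle R * R -> R) :
  (forall A, measurable A -> rho A = pushforward h phi A) ->
  measurable_fun setT phi -> measurable_fun setT F -> rint h (F \o phi) ->
  \int[rho]_p F p = \int[h]_p F (phi p).
Proof.
move=> rE mphi mF IF.
pose H := isMeasurableFun.Build _ _ _ _ phi mphi.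
pose Phi : {RV h >-> (circle R * R)%type} := HB.pack_for {mfun (circle R * R)%type >-> (circle R * R)%type} phi H.
rewrite /Rintegral; congr fine.
rewrite (eq_measure_integral (distribution h Phi)); last by move=> A mA _; exact: rE.
by rewrite integral_distribution//; exact/measurable_EFinP.
Qed.

End polynomial_observables.

Section deviations.
Context (R : realType) (h : probability (circle R * R)%type R) (K : R)
  (rho : R -> probability (circle R * R)%type R)
  (d : measure_display) (T : measurableType d) (P : probability T R)
  (X : nat -> {RV P >-> (circle R * R)%type})
  (theta : forall N : nat, T -> R -> 'I_N -> circle R).
Hypotheses (mom : abs_moments_exist h) (K0 : 0 < K)
  (sol : continuous_kuramoto_solution h K rho)
  (iX : mutually_independent X) (dX : identically_distributed X h).
Hypothesis solN : forall (N : nat) (a : T),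
     kuramoto_solution K (fun j : 'I_N => (X j a).2) (@theta N a) /\
     forall j : 'I_N, @theta N a 0 j = (X j a).1.
Variables (m : nat) (k : int) (t : R).
Hypothesis t0 : 0 <= t.

Lemma deviation_fluct : exists fl : bool -> nat -> T -> R, [/\
  forall n a, normc (Z h rho m k t -
    Zhat h (fun j : 'I_n.+1 => (X j a).2) (@theta n.+1 a) m k t) =
    Num.sqrt (fl false n a ^+ 2 + fl true n a ^+ 2),
  forall c n, measurable_fun setT (fl c n),
  forall c, {ae P, forall a, fl c n a @[n --> \oo] --> (0 : R)} &
  forall c, exists F : circle R * R -> R,
    [/\ measurable_fun setT F, rint h (fun x => F x ^+ 2), \int[h]_x F x = 0 &
     exists C : R, forall n,
      (\int[P]_a (`|fl c n a - avg X F n a|)%:E <= (C / n.+1%:R)%:E)%E]].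
Proof.
set q := orthonormal_poly (frequency_distribution h) m.
have [x fx rhoE] := sol.
have [Y [Yx Y0 cY mY Yd]] := flow_lift fx.
have angle0 n a (j : 'I_n.+1) : angle (Y (X j a) 0) = @theta n.+1 a 0 j.
  by rewrite Y0; have [_ ->] := solN n.+1 a.
have H n a := solution_lift (proj1 (solN n.+1 a)) (angle0 n a).
(* A lift is chosen for every sample point separately. Measurability in [a] is recovered below in
   [mth], and only for sines and cosines of integer multiples. *)
pose th n a := projT1 (cid (H n a)).
have th0 n a j : th n a j 0 = Y (X j a) 0 by have [E _ _ _] := projT2 (cid (H n a)); exact: E.
have thE n a j s : 0 <= s -> angle (th n a j s) = @theta n.+1 a s j.
  by have [_ E _ _] := projT2 (cid (H n a)); exact: E.
have cth n a j : continuous (th n a j) by have [_ _ C _] := projT2 (cid (H n a)); exact: C.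
have thd n a j s : 0 < s < t -> isd (th n a j) s ((X j a).2 + K *
      (av (fun i => trig true (th n a i s)) * dtrig true (th n a j s) +
       av (fun i => trig false (th n a i s)) * dtrig false (th n a j s))).
  by move=> /andP[s0 _]; have [_ _ _ D] := projT2 (cid (H n a)); exact: D.
have Yd' p s : 0 < s < t -> isd (Y p) s (p.2 + K *
      (mean_trig h Y true s * dtrig true (Y p s) + mean_trig h Y false s * dtrig false (Y p s))).
  by move=> /andP[s0 _]; exact: Yd.
pose f (p : circle R * R) := q.[p.2].
have mf : measurable_fun setT f by exact: measurable_polynomial.
have If4 : rint h (fun p => f p ^+ 4).
  apply: (rint_eq _ (rint_polynomial (q ^+ 4) mom)) => p.
  by rewrite horner_exp.
have mkY b : measurable_fun setT (fun p => trig b (k%:~R * Y p t)).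
  by apply: (@measurable_trig_mulz _ _ _ (fun p => Y p t)) => b'; exact: mY.
have mth c n j : measurable_fun setT (fun a => trig c (k%:~R * th n a j t)).
  apply: (@measurable_trig_mulz _ _ _ (fun a => th n a j t)) => b'.
  apply: (@measurable_particles _ _ _ n K t (ltW K0) t0 (fun j a => (X j a).2)) => //.
  - by move=> i; apply: (@measurableT_comp _ _ _ _ _ _ snd) => //; exact: measurable_snd.
  - move=> b i; rewrite (_ : (fun a => _) = (fun p => trig b (Y p 0)) \o X i).
      by apply: measurableT_comp => //; exact: mY.
    by apply/funext => a /=; rewrite th0.
  - by move=> a i s st; exact: thd.
exists (fun c => fluct h X t Y f k%:~R c th); split.
- move=> n a.
  have ZE : Z h rho m k t = ((\int[h]_p (f p * trig false (k%:~R * Y p t))) +i*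
      (\int[h]_p (f p * trig true (k%:~R * Y p t))))%C.
    have part c : \int[rho t]_p Zpart q k c p = \int[h]_p (f p * trig c (k%:~R * Y p t)).
      have E p : Zpart q k c (x t 0 p.1 p.2, p.2) = f p * trig c (k%:~R * Y p t).
        by rewrite /Zpart /= -(Yx p t t0) trig_mulz_angle.
      rewrite (Rintegral_pushforward (rhoE t t0)).
      + by apply: eq_Rintegral => p _; exact: E.
      + apply: measurable_fun_pair; last exact: measurable_snd.
        by have [mx _] := fx; exact: mx.
      + exact: measurable_Zpart.
      apply: (@rint_le _ _ _ _ _ (fun p => `|f p|)).
      + apply: (eq_measurable_fun _ _ (measurable_funM mf (mkY c))) => p _ /=.
        by rewrite E.
      + by move=> p /=; rewrite E normrM ler_piMr// trig_max.
      + by apply: rint_abs; exact: rint_polynomial.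
    rewrite /Z /Cintegral; congr (_ +i* _)%C.
      by rewrite -part; apply: eq_Rintegral => p _; rewrite Zfun_parts.
    by rewrite -part; apply: eq_Rintegral => p _; rewrite Zfun_parts.
  rewrite ZE /Zhat -/q mean_Zfun /fluct.
  have avE c : av (fun j : 'I_n.+1 => Zpart q k c (@theta n.+1 a t j, (X j a).2)) =
      av (fun j => f (X j a) * trig c (k%:~R * th n a j t)).
    by apply: av_eq => j; rewrite /Zpart /= -thE// trig_mulz_angle.
  by rewrite !avE /=; congr Num.sqrt; ring.
- move=> c n; apply: measurable_funB; last exact: measurable_cst.
  apply: measurable_av => j; apply: measurable_funM; last exact: mth.
  by apply: (@measurableT_comp _ _ _ _ _ _ f) => //.
- move=> c; exact: (fluct_cvg0 iX dX (ltW K0) t0 cY mY Yd' c mf If4 mkY cth th0 thd).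
- move=> c; exact: (fluct_linear iX dX (ltW K0) t0 cY mY Yd' mf If4 mkY cth th0 thd (mth c)).
Qed.

End deviations.

Theorem theorem3p3 (R : realType)
    (h : probability (circle R * R)%type R) (K : R)
    (rho : R -> probability (circle R * R)%type R)
    (d : measure_display) (T : measurableType d) (P : probability T R)
    (X : nat -> {RV P >-> (circle R * R)%type})
    (theta : forall N : nat, T -> R -> 'I_N -> circle R) :
  M_determinate h ->
  abs_moments_exist h ->
  infinite_set (measure_support (frequency_distribution h)) ->
  0 < K ->
  continuous_kuramoto_solution h K rho ->
  mutually_independent X ->
  identically_distributed X h ->
  (forall (N : nat) (a : T),
     kuramoto_solution K (fun j : 'I_N => (X j a).2) (theta N a) /\
     forall j : 'I_N, theta N a 0 j = (X j a).1) ->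
  let deviation m k t (N : nat) (a : T) : R :=
    normc (Z h rho m k t -
           Zhat h (fun j : 'I_N => (X j a).2) (theta N a) m k t) in
  let prob_within m k t (C : R) (N : nat) : \bar R :=
    P [set a | deviation m k t N a < C / Num.sqrt N%:R] in
  forall (m : nat) (k : int) (t : R), 0 <= t ->
    {ae P, forall a : T, deviation m k t N a @[N --> \oo] --> 0} /\
    ((* sqrt N times the deviation does not tend to 0 in probability *)
     ~ (forall C : R, 0 < C -> prob_within m k t C N @[N --> \oo] --> 1%:E) ->
     forall delta : R, 0 < delta < 1 ->
       exists2 C : R, 0 < C &
         prob_within m k t C N @[N --> \oo] --> (1 - delta)%:E).
Proof.
move=> _ mom _ K0 sol iX dX solN deviation prob_within m k t t0.
have [fl [devE mfl fl0 flF]] := deviation_fluct mom K0 sol iX dX solN m k t0.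
have {}devE n a : deviation m k t n.+1 a = Num.sqrt (fl false n a ^+ 2 + fl true n a ^+ 2).
  exact: devE.
split.
  have := fl0 true; have := fl0 false; apply: filterS2 => a cv0 cv1.
  have sq0 c : fl c n a @[n --> \oo] --> (0 : R) -> fl c n a ^+ 2 @[n --> \oo] --> (0 : R).
    by move=> cv; rewrite -[X in _ --> X](mulr0 (0 : R)) /GRing.exp /=; exact: cvgM.
  have cv : Num.sqrt (fl false n a ^+ 2 + fl true n a ^+ 2) @[n --> \oo] --> (0 : R).
    rewrite -[X in _ --> X](@sqrtr0 R) -[X in Num.sqrt X](addr0 (0 : R)).
    apply: continuous_cvg; first exact: sqrt_continuous.
    by apply: cvgD; exact: sq0.
  (* The limit does not see the term N = 0, where [Zhat] is an empty sum; from here on N = n + 1. *)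
  rewrite -(@cvg_shiftS R) /=.
  by rewrite (_ : (fun n => _) = (fun n => Num.sqrt (fl false n a ^+ 2 + fl true n a ^+ 2)));
    last by apply/funext => n; exact: devE.
pose V c n a := Num.sqrt n.+1%:R * fl c n a.
(* Squaring removes the modulus and the square root of N, and exhibits the event as one on the
   squared norm of the vector [V] to which [clt_quantile] applies. *)
have withinE C n : 0 < C ->
    prob_within m k t C n.+1 = P [set a | V false n a ^+ 2 + V true n a ^+ 2 < C ^+ 2].
  move=> C0; congr (P _); apply/seteqP; split => a /=; rewrite devE.
    rewrite ltr_pdivlMr ?sqrtr_gt0// -sqrtrM ?addr_ge0 ?sqr_ge0// => H.
    have : Num.sqrt ((fl false n a ^+ 2 + fl true n a ^+ 2) * n.+1%:R) ^+ 2 < C ^+ 2.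
      by rewrite ltrXn2r ?nnegrE ?sqrtr_ge0// ltW.
    rewrite sqr_sqrtr ?mulr_ge0 ?addr_ge0 ?sqr_ge0// /V ![(Num.sqrt _ * _) ^+ 2]exprMn.
    by rewrite sqr_sqrtr// -mulrDr mulrC.
  rewrite /V ![(Num.sqrt _ * _) ^+ 2]exprMn sqr_sqrtr// -mulrDr => H.
  rewrite ltr_pdivlMr ?sqrtr_gt0// -sqrtrM ?addr_ge0 ?sqr_ge0//.
  rewrite [ltRHS](_ : C = Num.sqrt (C ^+ 2)); last by rewrite sqrtr_sqr ger0_norm ?ltW.
  by rewrite ltr_sqrt ?exprn_gt0// mulrC.
move=> nondeg delta delta01.
have [F1 [mF1 IF1 F1c [C1 VF1]]] := flF false.
have [F2 [mF2 IF2 F2c [C2 VF2]]] := flF true.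
(* The L^1 errors C1/N and C2/N, multiplied by sqrt N, are dominated by this common sequence, which
   tends to 0. *)
pose c (n : nat) : R := (`|C1| + `|C2|) * (Num.sqrt n.+1%:R)^-1.
have c0 : c n @[n --> \oo] --> (0 : R).
  by rewrite -[X in _ --> X](mulr0 (`|C1| + `|C2|)); apply: cvgM; [exact: cvg_cst|exact: sqrtN_cvg].
have mV b n : measurable_fun setT (V b n).
  by apply: measurable_funM => //; exact: mfl.
have scale b F C : measurable_fun setT F -> C <= `|C1| + `|C2| ->
  (forall n, (\int[P]_a (`|fl b n a - avg X F n a|)%:E <= (C / n.+1%:R)%:E)%E) -> forall n,
  (\int[P]_a (`|V b n a - (Num.sqrt n.+1%:R)^-1 * (\sum_(j < n.+1) F (X j a))|)%:E <= (c n)%:E)%E.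
  move=> mF CC flC n.
  have s0 : 0 < Num.sqrt n.+1%:R :> R by rewrite sqrtr_gt0.
  have sV : Num.sqrt n.+1%:R * n.+1%:R^-1 = (Num.sqrt n.+1%:R)^-1 :> R.
    rewrite -[X in X^-1](@sqr_sqrtr R n.+1%:R)// expr2 invfM mulrA mulfV ?mul1r// gt_eqF.
  under eq_integral => a _.
    rewrite /V -sV -mulrA -/(avg X F n a) -mulrBr normrM (ger0_norm (ltW s0)) EFinM.
    over.
  rewrite ge0_integralZl//; last first.
    apply/measurable_EFinP; apply: measurableT_comp => //.
    by apply: measurable_funB; [exact: mfl|exact: measurable_avg].
  apply: (@le_trans _ _ ((Num.sqrt n.+1%:R)%:E * (C / n.+1%:R)%:E)%E).
    by apply: lee_wpmul2l => //; rewrite lee_fin ltW.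
  by rewrite -EFinM lee_fin /c mulrCA sV ler_wpM2r// invr_ge0 ltW.
have nondeg' : ~ (forall s : R, 0 < s ->
    P [set a | V false n a ^+ 2 + V true n a ^+ 2 < s] @[n --> \oo] --> 1%E).
  move=> all1; apply: nondeg => C C0.
  rewrite -cvg_shiftS /=; under eq_cvg => n do rewrite withinE//.
  by apply: all1; rewrite exprn_gt0.
have p01 : 0 < 1 - delta < 1.
  by case/andP: delta01 => d0 d1; rewrite subr_gt0 d1 ltrBlDr ltrDl.
have CC1 : C1 <= `|C1| + `|C2| by rewrite (le_trans (ler_norm _))// lerDl.
have CC2 : C2 <= `|C1| + `|C2| by rewrite (le_trans (ler_norm _))// lerDr.
have [s s0 Hs] := clt_quantile iX dX mF1 mF2 IF1 IF2 F1c F2c (mV false) (mV true) c0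
  (scale _ _ _ mF1 CC1 VF1) (scale _ _ _ mF2 CC2 VF2) nondeg' p01.
(* [s] is a quantile of the limit law of the squared norm, so C is its square root. *)
exists (Num.sqrt s); first by rewrite sqrtr_gt0.
rewrite -cvg_shiftS /=; under eq_cvg => n do rewrite withinE ?sqrtr_gt0// sqr_sqrtr ?ltW//.
exact: Hs.
Qed.
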